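(* Let $d\ge1$, let $\sigma,\alpha,\nu>0$ and $M\in SL(d,\mathbb R)$, and let $Y$ be a mean zero, geometric anisotropic $d$-dimensional Matérn Gaussian random field with parameters $(\sigma,\alpha,\nu,M)$. Let $\Omega$ be a (nonempty) bounded, open subset of $\mathbb R^d$ and let $\boldsymbol h\in\mathbb R^d$ be a fixed nonzero vector. Suppose $p\ne q$ are positive integers such that $p,q>\nu+1$ and both are large enough so that $4<\min\{2p-2\nu,d\}$ and $4<\min\{2q-2\nu,d\}$. Then $$n^2\left[Q_n^p-\frac{a_\nu^p}{a_\nu^q}Q_n^q\right]\to\left[b_\nu^p-\frac{a_\nu^p}{a_\nu^q}b_\nu^q\right]\quad\text{with probability one as } n\to\infty .$$
   Context: Matérn field: $Y$ is a mean zero Gaussian random field on $\mathbb R^d$ with $\operatorname{cov}(Y(\boldsymbol s),Y(\boldsymbol t))=K(|M\boldsymbol s-M\boldsymbol t|)$, where $|\cdot|$ is the Euclidean norm, $K(t)=\frac{\sigma^2(\alpha t)^\nu}{\Gamma(\nu)2^{\nu-1}}\mathcal K_\nu(\alpha t)$ for $t>0$, $K(0)=\sigma^2$, and $\mathcal K_\nu$ is the modified Bessel function of the second kind of order $\nu$. $SL(d,\mathbb R)$ is the group of real $d\times d$ matrices of determinant 1. Increments: $\Delta_{\boldsymbol h}Y(\boldsymbol t)=Y(\boldsymbol t+\boldsymbol h)-Y(\boldsymbol t)$ and $\Delta^m_{\boldsymbol h}Y(\boldsymbol t)=\Delta_{\boldsymbol h}\Delta_{\boldsymbol h}^{m-1}Y(\boldsymbol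 t)$. Quadratic variation: $\Omega_n=\Omega\cap\{\mathbb Z^d/n\}$, $\#\Omega_n$ is its cardinality, and $Q_n^m=\frac1{\#\Omega_n}\sum_{\boldsymbol j\in\Omega_n}n^{2\nu}\bigl(\Delta^m_{\boldsymbol h/n}Y(\boldsymbol j)\bigr)^2$. For $\mu>0$ and $t>0$: $G_\mu(t)=\frac{(-1)^{\mu+1}}{2^{2\mu-1}\Gamma(\mu)\Gamma(\mu+1)}t^{2\mu}\log t$ if $\mu\in\mathbb Z$, and $G_\mu(t)=\frac{-\pi}{2^{2\mu}\sin(\mu\pi)\Gamma(\mu)\Gamma(\mu+1)}t^{2\mu}$ otherwise; $G_\mu(0)=0$. Coefficients: $$a_\nu^m=\sigma^2\alpha^{2\nu}|M\boldsymbol h|^{2\nu}\sum_{i,j=0}^m(-1)^{i+j}\binom mi\binom mj G_\nu(|i-j|),$$ $$b_\nu^m=\sigma^2\alpha^{2\nu+2}|M\boldsymbol h|^{2\nu+2}\sum_{i,j=0}^m(-1)^{i+j}\binom mi\binom mj(-\nu)G_{\nu+1}(|i-j|).$$ *)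

(* Defs.v *)
From HB Require Import structures.
From mathcomp Require Import all_boot all_order all_algebra finmap.
From mathcomp Require Import all_classical all_reals all_analysis.

Set Implicit Arguments.
Unset Strict Implicit.
Unset Printing Implicit Defensive.

Import Order.TTheory GRing.Theory Num.Theory.
Import numFieldNormedType.Exports.

Local Open Scope classical_set_scope.
Local Open Scope ring_scope.

Section SpecialFunctions.
Variable R : realType.
Implicit Types x t nu mu : R.

(* Euler's integral; meaningful for x > 0, the only range used below. *)
Definition Gamma x : R :=
  \int[@lebesgue_measure R]_(u in `]0, +oo[) (u `^ (x - 1) * expR (- u)).

Definition cosh x : R := (expR x + expR (- x)) / 2.

(* Modified Bessel function of the second kind, for x > 0 and any real order,
   integer or not, through its integral representation
     K_nu(x) = int_0^oo exp(-x cosh u) cosh(nu u) du. *)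
Definition besselK nu x : R :=
  \int[@lebesgue_measure R]_(u in `[0, +oo[) (expR (- (x * cosh u)) * cosh (nu * u)).

Definition matern (sigma alpha nu t : R) : R :=
  if t == 0 then sigma ^+ 2
  else sigma ^+ 2 * (alpha * t) `^ nu / (Gamma nu * 2 `^ (nu - 1))
       * besselK nu (alpha * t).

(* Principal irregular term, for mu > 0 and t >= 0. When mu is an integer,
   Num.floor mu is that integer. *)
Definition maternG mu t : R :=
  if t == 0 then 0
  else if mu \is a Num.int then
    (-1) ^ (Num.floor mu + 1)
      / (2 `^ (2 * mu - 1) * Gamma mu * Gamma (mu + 1))
      * t `^ (2 * mu) * ln t
  else
    - pi / (2 `^ (2 * mu) * sin (mu * pi) * Gamma mu * Gamma (mu + 1))
      * t `^ (2 * mu).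

End SpecialFunctions.

Section Space.
Variables (R : realType) (d : nat).

(* Euclidean norm; the library's `|x| on matrices is the sup norm. *)
Definition enorm (x : 'cV[R]_d) : R := Num.sqrt (\sum_i x i ord0 ^+ 2).

(* Omega_n, the points of Omega in Z^d / n *)
Definition grid (Omega : set 'cV[R]_d) (n : nat) : set 'cV[R]_d :=
  Omega `&` range (fun z : 'cV[int]_d => n%:R^-1 *: map_mx intr z).

Definition increment (T : Type) (h : 'cV[R]_d) (Y : 'cV[R]_d -> T -> R)
  : 'cV[R]_d -> T -> R := fun t w => Y (t + h) w - Y t w.

Definition qvar (T : Type) (Y : 'cV[R]_d -> T -> R) (nu : R)
    (Omega : set 'cV[R]_d) (h : 'cV[R]_d) (m n : nat) (w : T) : R :=
  (#|` fset_set (grid Omega n)|%:R)^-1 *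
  \sum_(j \in grid Omega n)
    n%:R `^ (2 * nu) * (iter m (increment (n%:R^-1 *: h)) Y j w) ^+ 2.

Definition coef_a (sigma alpha nu : R) (M : 'M[R]_d) (h : 'cV[R]_d) (m : nat)
  : R :=
  sigma ^+ 2 * alpha `^ (2 * nu) * enorm (M *m h) `^ (2 * nu) *
  \sum_(i < m.+1) \sum_(j < m.+1)
    (-1) ^+ (i + j) * 'C(m, i)%:R * 'C(m, j)%:R
    * maternG nu `|i%:R - j%:R|.

Definition coef_b (sigma alpha nu : R) (M : 'M[R]_d) (h : 'cV[R]_d) (m : nat)
  : R :=
  sigma ^+ 2 * alpha `^ (2 * nu + 2) * enorm (M *m h) `^ (2 * nu + 2) *
  \sum_(i < m.+1) \sum_(j < m.+1)
    (-1) ^+ (i + j) * 'C(m, i)%:R * 'C(m, j)%:R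
    * (- nu * maternG (nu + 1) `|i%:R - j%:R|).

End Space.

Section Fields.
Context d (T : measurableType d) (R : realType) (P : probability T R).

(* Gaussian law with mean m and standard deviation s. The degenerate case is
   a Dirac mass: normal_prob m 0 is not (it is uniform on [0, 1]). *)
Definition gaussian_law (m s : R) : set R -> \bar R :=
  if s == 0 then \d_m else normal_prob m s.

Definition gaussian_var (X : T -> R) : Prop :=
  measurable_fun setT X /\
  exists m s : R, 0 <= s /\
    forall A : set R, measurable A -> pushforward P X A = gaussian_law m s A.

(* Gaussian random field: all finite-dimensional laws are (possibly
   degenerate) multivariate normal, that is, every finite linear combination
   of values of the field is a Gaussian variable. *)
Definition gaussian_field (I : Type) (Y : I -> T -> R) : Prop :=
  forall (k : nat) (t : 'I_k -> I) (c : 'I_k -> R),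
    gaussian_var (fun w => \sum_(i < k) c i * Y (t i) w).

Definition matern_field (dim : nat) (sigma alpha nu : R) (M : 'M[R]_dim)
    (Y : 'cV[R]_dim -> T -> R) : Prop :=
  [/\ gaussian_field Y,
      forall t, ('E_P[Y t] = 0)%E &
      forall s t, covariance P (Y s) (Y t) =
        (matern sigma alpha nu (enorm (M *m s - M *m t)))%:E].

End Fields.

(* Main.v *)
Require Import Defs.
From mathcomp Require Import all_boot all_order all_algebra finmap.
From mathcomp Require Import all_classical all_reals all_analysis.
From mathcomp Require Import measurable_realfun zify ring lra.
Set Implicit Arguments.
Unset Strict Implicit.
Unset Printing Implicit Defensive.
Import Order.TTheory GRing.Theory Num.Theory.
Import numFieldNormedType.Exports.
Local Open Scope classical_set_scope.
Local Open Scope ring_scope.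

(** Each quadratic variation is an average, over the N grid points in Omega, of
squares of centred Gaussian variables: the increments of step h / n, rescaled
by n^nu. Its mean is the common variance V_n of these increments, so the limit
follows from an expansion V_n = a + b n^(-2) + o(n^(-2)) and from the
fluctuations around V_n being o(n^(-2)) almost surely. In the combination of
the theorem the terms a cancel and the terms b remain.

Mean. The Matern covariance is a mixture of Gaussian covariances
[matern_mixture]. The variance of an increment of order m is a second
difference [dsum m] of the covariance, which annihilates the polynomials of
degree less than 2 m, hence the regular part of the covariance at 0. After a
translation of the mixing variable, n only occurs in the prefactor y^nu and in
a factor exp(- y exp(- v)) with y of order n^(-2), and a Taylor expansion in y
gives the two coefficients as integrals [J m nu] and [J m (nu + 1)]
[mixt_expansion, scaled_var_cvg]. These integrals are computed by Fubini's
theorem, which turns the Gaussian kernel into the Cauchy kernel [Gamma_J]; a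
primitive with a logarithm, when the exponent is an integer, or Euler's
reflection formula, otherwise, then produces the functions G_mu
[dsum_maternG]. The coefficient a is not zero because the Gaussian kernel is
positive definite [J_gt0].

Fluctuations. The same mixture shows that the covariance of the rescaled
increments at s and t is at most a constant times (1 + n |s - t|)^(-4), since
2 m - 2 nu > 4 [scaled_cov_le]. The square of this bound is at most a product
of five weights, each depending on one coordinate and summable; as the
dimension is at least 5, the squared covariances over all pairs of grid points
sum up to O(N n^(d - 5)) [sum_sqr_scaled_cov]. By Wick's formula the fourth
moment of a centred sum of squares is at most 60 times the square of that sum
[Int_csq4_le]. Since N is at least of order n^d, the fourth moment of n^2 times
the fluctuation is O(n^(-2)), which is summable, and this yields almost sure
convergence to 0 [ae_cvg0_of_moment4, fluct_ae_cvg0]. *)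

(** * Integration of real functions *)

Section Integrals.
Context {disp : measure_display} {T : measurableType disp} {R : realType}.
Variable m : {measure set T -> \bar R}.
Implicit Types f g : T -> R.

Definition L1 f := m.-integrable setT (EFin \o f).
Definition Int f : R := \int[m]_x f x.

Lemma EFin_Int f : L1 f -> (\int[m]_x (f x)%:E)%E = (Int f)%:E.
Proof. by move=> If; rewrite /Int /Rintegral fineK// integrable_fin_num. Qed.

Lemma L1_measurable f : L1 f -> measurable_fun setT f.
Proof. by move=> /integrableP[/measurable_EFinP]. Qed.

Lemma le_L1 f g : measurable_fun setT f -> (forall x, `|f x| <= g x) ->
  L1 g -> L1 f.
Proof.
move=> mf fg Ig; apply: (le_integrable _ _ _ Ig) => //.
- exact/measurable_EFinP.
- by move=> x _; rewrite /= lee_fin (le_trans (fg x))// ler_norm.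
Qed.

Lemma L1_norm f : L1 f -> L1 (fun x => `|f x|).
Proof. by move=> If; exact: integrable_norm. Qed.

Lemma L1D f g : L1 f -> L1 g -> L1 (fun x => f x + g x).
Proof. exact: integrableD. Qed.

Lemma L1Z a f : L1 f -> L1 (fun x => a * f x).
Proof. exact: integrableZl. Qed.

Lemma L1B f g : L1 f -> L1 g -> L1 (fun x => f x - g x).
Proof. exact: integrableB. Qed.

Lemma L1_sum (I : Type) (s : seq I) (F : I -> T -> R) :
  (forall i, L1 (F i)) -> L1 (fun x => \sum_(i <- s) F i x).
Proof.
move=> IF; elim: s => [|i s IHs].
  by under eq_fun do rewrite big_nil; exact: integrable0.
by under eq_fun do rewrite big_cons; exact: L1D.
Qed.

Lemma IntD f g : L1 f -> L1 g -> Int (fun x => f x + g x) = Int f + Int g.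
Proof. by move=> If Ig; exact: RintegralD. Qed.

Lemma IntB f g : L1 f -> L1 g -> Int (fun x => f x - g x) = Int f - Int g.
Proof. by move=> If Ig; exact: RintegralB. Qed.

Lemma IntZ a f : L1 f -> Int (fun x => a * f x) = a * Int f.
Proof. by move=> If; exact: RintegralZl. Qed.

Lemma Int0 : Int (fun=> 0) = 0.
Proof. by rewrite /Int Rintegral_cst// mul0r. Qed.

Lemma Int_sum (I : Type) (s : seq I) (F : I -> T -> R) :
  (forall i, L1 (F i)) ->
  Int (fun x => \sum_(i <- s) F i x) = \sum_(i <- s) Int (F i).
Proof.
move=> IF; elim: s => [|i s IHs].
  by under eq_fun do rewrite big_nil; rewrite big_nil Int0.
under eq_fun do rewrite big_cons.
by rewrite IntD// ?big_cons ?IHs//; exact: L1_sum.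
Qed.

Lemma le_Int f g : L1 f -> L1 g -> (forall x, f x <= g x) -> Int f <= Int g.
Proof. by move=> If Ig fg; apply: le_Rintegral => // x _; exact: fg. Qed.

Lemma Int_ge0 f : (forall x, 0 <= f x) -> 0 <= Int f.
Proof. by move=> f0; exact: Rintegral_ge0. Qed.

Lemma le_norm_Int f : L1 f -> `|Int f| <= Int (fun x => `|f x|).
Proof. by move=> If; exact: le_normr_Rintegral. Qed.

(** A nonnegative function with a finite integral is integrable: this is how
integrability and value are obtained together from nonnegative Lebesgue
integrals, for which changes of variable need no integrability. *)
Lemma ge0_L1 f (l : R) : measurable_fun setT f -> (forall x, 0 <= f x) ->
  (\int[m]_x (f x)%:E)%E = l%:E -> L1 f /\ Int f = l.
Proof.
move=> mf f0 fl; split; last by rewrite /Int /Rintegral fl.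
apply/integrableP; split; first exact/measurable_EFinP.
by under eq_integral do rewrite /= ger0_norm//; rewrite fl ltry.
Qed.

End Integrals.

Section RealLine.
Context {R : realType}.
Local Notation mu := (@lebesgue_measure R).
Implicit Types f g F : R -> R.

Lemma cvg_Int_itv f : L1 mu f ->
  (fun n : nat => \int[mu]_(x in `[- n%:R, n%:R]) f x) @ \oo --> Int mu f.
Proof.
move=> If; have mf := L1_measurable If.
pose fn (n : nat) : R -> \bar R := EFin \o (f \_ `[- n%:R, n%:R]).
have [|||||_ _] := @dominated_convergence _ _ _ mu setT measurableT fn
   (EFin \o f) (EFin \o (fun x => `|f x|)).
- move=> n; apply/measurable_EFinP.
  by apply/(measurable_restrictT _ _).1 => //; exact: measurable_funTS.
- exact/measurable_EFinP.
- apply: aeW => x _; apply: cvg_near_cst; near=> n.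
  rewrite /fn/= patchE mem_set//= in_itv/= -ler_norml.
  by near: n; exact: nbhs_infty_ger.
- exact: integrable_norm.
- apply: aeW => n x _; rewrite /fn /= lee_fin patchE.
  by case: ifPn => //; rewrite normr0.
rewrite (EFin_Int If) => /fine_cvg; apply: cvg_trans.
apply: near_eq_cvg; apply: nearW => n /=; rewrite /fn /Rintegral.
by rewrite [in RHS]integral_mkcond restrict_EFin.
Unshelve. all: by end_near. Qed.

(** On the whole line the fundamental theorem of calculus needs integrability
of the derivative, because the limit of the integrals over bounded intervals
is taken by dominated convergence. *)
Lemma Int_derive f F (l r : R) : L1 mu f -> continuous f ->
  (forall x : R, is_derive x (1 : R) F (f x)) ->
  F x @[x --> -oo] --> l -> F x @[x --> +oo] --> r -> Int mu f = r - l.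
Proof.
move=> If cf dF Fl Fr.
apply: (cvg_unique _ (cvg_Int_itv If)) => //.
have cF : continuous F.
  move=> x; apply/differentiable_continuous/derivable1_diffP.
  by have [] := dF x.
have : (fun n : nat => F n%:R - F (- n%:R)) @ \oo --> r - l.
  apply: cvgB; first exact: (cvg_comp _ _ (@cvgr_idn R)).
  have N : (fun n : nat => - n%:R : R) @ \oo --> -oo%R.
    by have /cvgNrNy := @cvgr_idn R.
  exact: (cvg_comp _ _ N).
apply: cvg_trans; apply: near_eq_cvg; near=> n.
have n0 : (0 : R) < n%:R by near: n; exact: nbhs_infty_gtr.
rewrite /Rintegral (@continuous_FTC2 _ f F) ?fineD//=.
- by rewrite (lt_trans _ n0)// oppr_lt0.
- exact: continuous_subspaceT.
- split.
  + by move=> x _; have [] := dF x.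
  + exact/cvg_at_right_filter/cF.
  + exact/cvg_at_left_filter/cF.
- by move=> x _; rewrite derive1E; exact: derive_val.
Unshelve. all: by end_near. Qed.

End RealLine.

(** * Exponential decay and changes of variable on the line *)

Section Decay.
Context {R : realType}.
Local Notation mu := (@lebesgue_measure R).
Implicit Types f g F : R -> R.

Lemma is_derive_continuous f F :
  (forall x : R, is_derive x (1 : R) F (f x)) -> continuous F.
Proof.
move=> dF x; apply/differentiable_continuous/derivable1_diffP.
by have [] := dF x.
Qed.

Lemma L1_expRN_norm (c : R) : 0 < c -> L1 mu (fun u => expR (- c * `|u|)).
Proof.
move=> c0.
have cf : continuous (fun u : R => expR (- c * `|u|)).
  move=> u; apply: continuous_comp; last exact: continuous_expR.
  by apply: cvgM; [exact: cvg_cst|exact: norm_continuous].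
apply: (@ge0_L1 _ _ _ mu _ (2 / c) _ _ _).1 => //.
- exact: continuous_measurable_fun.
- rewrite ge0_symfun_integralT//; last 1 first.
    by move=> x /=; rewrite normrN.
  rewrite -set_itvcy.
  under eq_integral => x.
    rewrite inE/= in_itv/= andbT => x0; rewrite ger0_norm//; over.
  rewrite (@ge0_continuous_FTC2y _ _ (fun x => - (c^-1 * expR (- c * x))) 0 0)//.
  + by rewrite -EFinB -EFinM mulr0 expR0; congr EFin; field; exact: lt0r_neq0.
  + apply: continuous_subspaceT => u; apply: continuous_comp; last exact: continuous_expR.
    exact: mulrl_continuous.
  + rewrite -oppr0; apply: cvgN; rewrite -(mulr0 c^-1); apply: cvgM; first exact: cvg_cst.
    under eq_fun do rewrite mulNr.
    apply: (@cvg_comp _ _ _ (fun x => c * x) (fun x => expR (- x)) _ (+oo%R)).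
      by apply: gt0_cvgMry => //; exact: cvg_id.
    exact: cvgr_expR.
  + apply: cvg_at_right_filter; move: {+}0; exact: is_derive_continuous.
  + by move=> x _; rewrite derive1E derive_val /GRing.scale/=; field; exact: lt0r_neq0.
Qed.

(** Integrable functions for which integration by parts on the line has no
boundary terms. *)
Definition expdec f := exists C c : R, 0 < c /\ forall u, `|f u| <= C * expR (- c * `|u|).

Lemma expdec_L1 f : measurable_fun setT f -> expdec f -> L1 mu f.
Proof.
move=> mf [C [c [c0 fC]]]; apply: (@le_L1 _ _ _ mu _ _ mf fC).
exact/L1Z/L1_expRN_norm.
Qed.

Lemma expdecD f g : expdec f -> expdec g -> expdec (fun u => f u + g u).
Proof.
move=> [C [c [c0 fC]]] [D [e [e0 gD]]].
have C0 : 0 <= C by have := le_trans (normr_ge0 _) (fC 0); rewrite normr0 mulr0 expR0 mulr1.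
have D0 : 0 <= D by have := le_trans (normr_ge0 _) (gD 0); rewrite normr0 mulr0 expR0 mulr1.
exists (C + D), (Num.min c e); split; first by rewrite lt_min c0.
move=> u; rewrite (le_trans (ler_normD _ _))// mulrDl lerD//.
- rewrite (le_trans (fC u))// ler_wpM2l// ler_expR !mulNr lerN2 ler_wpM2r//.
  by rewrite ge_min lexx.
- rewrite (le_trans (gD u))// ler_wpM2l// ler_expR !mulNr lerN2 ler_wpM2r//.
  by rewrite ge_min lexx orbT.
Qed.

Lemma expdec_le (C : R) f g : (forall u, `|f u| <= C * `|g u|) -> expdec g -> expdec f.
Proof.
move=> fg [D [c [c0 gD]]]; exists (`|C| * D), c; split => // u.
rewrite (le_trans (fg u))// -mulrA.
by rewrite (le_trans (ler_norm (C * `|g u|)))// normrM normr_id ler_pM.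
Qed.

Lemma expdecZ a f : expdec f -> expdec (fun u => a * f u).
Proof. by apply: (@expdec_le `|a|) => u; rewrite normrM. Qed.

Lemma expdecN f : expdec f -> expdec (fun u => f (- u)).
Proof.
move=> [C [c [c0 fC]]]; exists C, c; split => // u.
by rewrite (le_trans (fC _))// normrN.
Qed.

Lemma expdec_cvgy f : expdec f -> f x @[x --> +oo] --> 0.
Proof.
move=> [C [c [c0 fC]]]; apply: norm_cvg0.
apply: (@squeeze_cvgr _ _ _ _ (fun=> 0) (fun u => C * expR (- (c * u)))).
- near=> u; rewrite normr_ge0 (le_trans (fC u))//.
  by rewrite ger0_norm ?mulNr//; near: u; exact: nbhs_pinfty_ge.
- exact: cvg_cst.
- rewrite -[X in _ --> X](mulr0 C); apply: cvgM; first exact: cvg_cst.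
  apply: (@cvg_comp _ _ _ (fun x => c * x) (fun x => expR (- x)) _ (+oo%R)).
    by apply: gt0_cvgMry => //; exact: cvg_id.
  exact: cvgr_expR.
Unshelve. all: by end_near. Qed.

Lemma expdec_cvgNy f : expdec f -> f x @[x --> -oo] --> 0.
Proof. by move=> /expdecN/expdec_cvgy/cvgy_compNP/=; under eq_fun do rewrite opprK. Qed.

(** Integration by parts in the form used throughout: the integrand is the
derivative of a decaying function. *)
Lemma Int_derive0 f F : expdec f -> expdec F -> continuous f ->
  (forall x : R, is_derive x (1 : R) F (f x)) -> Int mu f = 0.
Proof.
move=> ef eF cf dF; rewrite (@Int_derive _ _ F 0 0) ?subrr//.
- by apply: expdec_L1 => //; exact: continuous_measurable_fun.
- exact: expdec_cvgNy.
- exact: expdec_cvgy.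
Qed.

Lemma ge0_integral_shift (c : R) f : continuous f -> (forall x, 0 <= f x) ->
  (\int[mu]_x (f x)%:E = \int[mu]_x (f (x + c))%:E)%E.
Proof.
move=> cf f0.
have D : derive1 (fun x : R => x + c) = cst 1.
  by apply/funext => x; rewrite derive1E derive_val addr0.
rewrite (@increasing_ge0_integration_by_substitutionT _ (fun x => x + c))//.
- by apply: eq_integral => x _; rewrite D /= mulr1.
- by move=> x y; rewrite ltrD2r.
- by rewrite D => x; exact: cvg_cst.
- by rewrite D; exact: is_cvg_cst.
- by rewrite D; exact: is_cvg_cst.
- exact: cvg_addrr_Ny.
- exact: cvg_addrr.
Qed.

(** Reflection preserves Lebesgue measure; the integral is transported along
it. *)
Lemma ge0_integral_oppr f : continuous f -> (forall x, 0 <= f x) ->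
  (\int[mu]_x (f x)%:E = \int[mu]_x (f (- x))%:E)%E.
Proof.
move=> cf f0.
transitivity (\int[pushforward mu (-%R : _ -> measurableTypeR R)]_x (f x)%:E)%E.
  by apply: eq_measure_integral => //= A mA _; exact/esym/lebesgue_measureN.
rewrite ge0_integral_pushforward//=.
- by apply/measurable_EFinP; exact: continuous_measurable_fun.
- by move=> x _; rewrite lee_fin.
Qed.

(** The exponential maps the line onto the half line. The substitution is made
on [-n, n] and the two sides converge monotonically. *)
Lemma ge0_integral_expR f : {in `]0, +oo[, continuous f} ->
  (forall x, 0 < x -> 0 <= f x) ->
  (\int[mu]_(x in `]0%R, +oo[) (f x)%:E = \int[mu]_u (f (expR u) * expR u)%:E)%E.
Proof.
move=> cf f0.
have De : derive1 (@expR R) = @expR R.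
  by apply/funext => x; rewrite derive1E derive_val.
have cfe : continuous (fun u => f (expR u) * expR u).
  move=> u; apply: cvgM; last exact: continuous_expR.
  apply: continuous_comp; first exact: continuous_expR.
  by apply: cf; rewrite in_itv/= expR_gt0.
pose A (n : nat) := `[expR (- n%:R : R), expR n%:R]%classic.
pose B (n : nat) := `[- n%:R : R, n%:R]%classic.
have AB n : (\int[mu]_(x in A n) (f x)%:E =
             \int[mu]_(x in B n) (f (expR x) * expR x)%:E)%E.
  rewrite /A /B integration_by_substitution_increasing ?De//.
  - by rewrite (@le_trans _ _ 0)// oppr_le0.
  - by move=> x y _ _ xy; rewrite ltr_expR.
  - by move=> x _; exact: continuous_expR.
  - by apply/cvg_ex; exists (expR (- n%:R)); exact/cvg_at_right_filter/continuous_expR.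
  - by apply/cvg_ex; exists (expR n%:R); exact/cvg_at_left_filter/continuous_expR.
  - split; first by move=> x _; exact: derivable_expR.
    + exact/cvg_at_right_filter/continuous_expR.
    + exact/cvg_at_left_filter/continuous_expR.
  - apply: continuous_in_subspaceT => x; rewrite inE/= in_itv/= => /andP[xn _].
    by apply: cf; rewrite in_itv/= (lt_le_trans _ xn)// expR_gt0.
have UA : \bigcup_n A n = `]0, +oo[%classic.
  apply/seteqP; split=> [x [n _]|x]; rewrite /A/= !in_itv/= andbT.
    by move=> /andP[+ _]; apply: lt_le_trans; exact: expR_gt0.
  move=> x0; exists (Num.truncn `|ln x|).+1 => //=; rewrite in_itv/=.
  rewrite -(lnK (x := x)) ?posrE// !ler_expR ?expRK.
  by rewrite -ler_norml ltW// truncnS_gt.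
have UB : \bigcup_n B n = [set: R].
  apply/seteqP; split=> // x _; exists (Num.truncn `|x|).+1 => //=.
  by rewrite /B/= in_itv/= -ler_norml ltW// truncnS_gt.
have A0 n x : A n x -> 0 < x.
  by rewrite /A/= in_itv/= => /andP[+ _]; apply: lt_le_trans; exact: expR_gt0.
have cA : (fun n => \int[mu]_(x in A n) (f x)%:E)%E @ \oo -->
    (\int[mu]_(x in `]0%R, +oo[) (f x)%:E)%E.
  rewrite -UA; apply: ge0_nondecreasing_set_cvg_integral => //.
  - move=> n k nk; apply/subsetPset => x; rewrite /A/= !in_itv/= => /andP[nx xn].
    rewrite (le_trans _ nx) ?(le_trans xn)// ?ler_expR ?lerN2 ?ler_nat//.
  - by move=> n; exact: measurable_itv.
  - move=> n; apply/measurable_EFinP.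
    apply: subspace_continuous_measurable_fun => //.
      exact: measurable_itv.
    apply: continuous_in_subspaceT => x; rewrite inE => /A0 x0.
    by apply: cf; rewrite in_itv/= x0.
  - by move=> n x /A0/f0; rewrite lee_fin.
have cB : (fun n => \int[mu]_(x in B n) (f (expR x) * expR x)%:E)%E @ \oo -->
    (\int[mu]_x (f (expR x) * expR x)%:E)%E.
  rewrite -UB; apply: ge0_nondecreasing_set_cvg_integral => //.
  - move=> n k nk; apply/subsetPset => x; rewrite /B/= !in_itv/= => /andP[nx xn].
    by rewrite (le_trans _ nx) ?(le_trans xn)// ?lerN2 ?ler_nat.
  - by move=> n; exact: measurable_itv.
  - move=> n; apply/measurable_EFinP/measurable_funTS.
    exact: continuous_measurable_fun.
  - by move=> n x _; rewrite lee_fin mulr_ge0 ?expR_ge0// f0// expR_gt0.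
apply: (cvg_unique _ cA) => //.
apply: cvg_trans cB; apply: near_eq_cvg; apply: nearW => n.
exact/esym/AB.
Qed.

End Decay.

(** * Euler's reflection formula *)

Section Euler.
Context {R : realType}.
Local Notation mu := (@lebesgue_measure R).
Implicit Types (a b c u x : R) (f g F : R -> R) (n m : nat).

Lemma is_derive_exprn f n x (df : R) : is_derive x (1 : R) f df ->
  is_derive x (1 : R) (fun y => f y ^+ n) (n%:R * f x ^+ n.-1 * df).
Proof. by move=> /(@is_deriveX _ _ f n x 1 df); rewrite exprfctE. Qed.

(** By continuity the integrand dominates a positive multiple of the indicator
of a neighbourhood of x. *)
Lemma Int_gt0 f x : continuous f -> L1 mu f -> (forall u, 0 <= f u) -> 0 < f x ->
  0 < Int mu f.
Proof.
move=> cf If f0 fx.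
have [e /= e0 xe] : \forall e \near 0^'+, forall y, `|x - y| <= e -> f x / 2 <= f y.
  have /cvgrPdist_lt/(_ (f x / 2)) := cf x.
  move=> /(_ _)[|e /= e0 H]; first by rewrite divr_gt0.
  near=> d => y yd; have /= := H y; rewrite /ball_/=.
  have dlt : d < e by near: d; exact: nbhs_right_lt.
  move=> /(_ (le_lt_trans yd dlt)); rewrite ltr_norml => /andP[_]; lra.
have {xe} [d d0 xd] : exists2 d : R, 0 < d & forall y, `|x - y| <= d -> f x / 2 <= f y.
  exists (e / 2); first by rewrite divr_gt0.
  apply: xe => //=; last by rewrite divr_gt0.
  by rewrite sub0r normrN gtr0_norm ?divr_gt0// ltr_pdivrMr// ltr_pMr// ltr1n.
apply: (@lt_le_trans _ _ (f x / 2 * (d *+ 2))).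
  by rewrite mulr_gt0 ?divr_gt0// pmulrn_lgt0.
pose g := (fun y => f x / 2 * \1_(`[x - d, x + d]%classic) y).
have [I1 I2] : L1 mu (\1_(`[x - d, x + d]%classic) : R -> R) /\
    Int mu (\1_(`[x - d, x + d]%classic) : R -> R) = d *+ 2.
  apply: ge0_L1 => //.
  rewrite integral_indic//= setIT lebesgue_measure_itv/= lte_fin.
  by rewrite ltrD2l gtrN// -EFinB/= opprD opprK addrACA subrr add0r mulr2n.
rewrite -I2 -IntZ//.
have Ig : L1 mu g by exact: L1Z.
apply: le_Int => // y; rewrite /g indicE.
case: (boolP (y \in _)) => [|_]; last by rewrite mulr0.
rewrite inE/= in_itv/= => /andP[xy yx]; rewrite mulr1; apply: xd.
by rewrite ler_distl; apply/andP; split; lra.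
Unshelve. all: by end_near. Qed.

(** Exponential bounds growing in opposite directions: each one is the useful
bound on one half line. *)
Lemma expdec2 (C a b : R) f : 0 < a -> 0 < b ->
  (forall u, `|f u| <= C * expR (a * u)) ->
  (forall u, `|f u| <= C * expR (- b * u)) -> expdec f.
Proof.
move=> a0 b0 fa fb.
have C0 : 0 <= C by have := le_trans (normr_ge0 _) (fa 0); rewrite mulr0 expR0 mulr1.
exists C, (Num.min a b); split; first by rewrite lt_min a0.
move=> u; have [u0|u0] := leP 0 u.
- rewrite (le_trans (fb u))// ler_wpM2l// ler_expR !mulNr lerN2 ger0_norm//.
  by rewrite ler_wpM2r// ge_min lexx orbT.
- rewrite (le_trans (fa u))// ler_wpM2l// ler_expR ltr0_norm// mulrNN.
  by rewrite ler_wnM2r// ?ge_min ?lexx// ltW.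
Qed.

(** The integrand of the Beta integral B(a, m - a), after the substitution
x = exp u. *)
Definition blog a m u : R := expR (a * u) / (1 + expR u) ^+ m.

Lemma blog_ge0 a m u : 0 <= blog a m u.
Proof. by rewrite divr_ge0 ?expR_ge0// exprn_ge0// addr_ge0// expR_ge0. Qed.

Lemma blog_gt0 a m u : 0 < blog a m u.
Proof. by rewrite divr_gt0 ?expR_gt0// exprn_gt0// addr_gt0// expR_gt0. Qed.

Lemma blog_expdec a m : 0 < a -> a < m%:R -> expdec (blog a m).
Proof.
move=> a0 am; apply: (@expdec2 1 a (m%:R - a)) => //.
- by rewrite subr_gt0.
- move=> u; rewrite ger0_norm ?blog_ge0// mul1r ler_pdivrMr ?exprn_gt0 ?addr_gt0 ?expR_gt0//.
  by rewrite ler_peMr ?expR_ge0// exprn_ege1// lerDl expR_ge0.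
- move=> u; rewrite ger0_norm ?blog_ge0// mul1r ler_pdivrMr ?exprn_gt0 ?addr_gt0 ?expR_gt0//.
  rewrite opprB mulrBl expRD -mulrA ler_peMr ?expR_ge0//.
  rewrite expRN ler_pdivlMl ?expR_gt0// mulr1 expRM_natl.
  by rewrite lerXn2r ?nnegrE ?addr_ge0 ?expR_ge0// lerDr.
Qed.

Lemma is_derive_blog a m u : is_derive u (1 : R) (blog a m) (a * blog a m u - m%:R * blog (a + 1) m.+1 u).
Proof.
have e0 : 1 + expR u != 0 by rewrite gt_eqF// addr_gt0// expR_gt0.
have e1 : (1 + expR u) ^+ m != 0 by rewrite expf_neq0.
have d1 : is_derive u (1 : R) (fun v => (1 + expR v) ^+ m)
    (m%:R * (1 + expR u) ^+ m.-1 * expR u).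
  by apply: is_derive_exprn; apply: is_derive_eq; rewrite add0r mul1r.
have d2 := @is_deriveV _ (fun v => (1 + expR v) ^+ m) u _ 1 e1 d1.
rewrite /blog; apply: is_derive_eq; rewrite /GRing.scale/=.
rewrite mulrDl mul1r expRD.
case: m e1 {d1 d2} => [|m] e1; first by rewrite !expr0; field.
by rewrite /= exprS in e1 *; rewrite !exprS; field; rewrite ?e0 ?expf_neq0.
Qed.

Lemma blog_continuous a m : continuous (blog a m).
Proof. exact: is_derive_continuous (is_derive_blog a m). Qed.

(** The Beta function B(a, m - a). *)
Definition Tbeta a m := Int mu (blog a m).

Lemma blog_L1 a m : 0 < a -> a < m%:R -> L1 mu (blog a m).
Proof.
move=> a0 am; apply: expdec_L1; last exact: blog_expdec.
by apply: continuous_measurable_fun; exact: blog_continuous.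
Qed.

(** Integration by parts. *)
Lemma Tbeta_recl a m : 0 < a -> a < m%:R ->
  Tbeta (a + 1) m.+1 = a / m%:R * Tbeta a m.
Proof.
move=> a0 am; have m0 : (0 : R) < m%:R by rewrite (lt_trans a0).
have aS : a + 1 < m.+1%:R by rewrite -natr1 ltrD2r.
have a1 : 0 < a + 1 by rewrite addr_gt0.
have : Int mu (fun u => a * blog a m u - m%:R * blog (a + 1) m.+1 u) = 0.
  apply: (Int_derive0 _ (blog_expdec a0 am)).
  - apply: expdecD; first exact/expdecZ/blog_expdec.
    apply: (@expdec_le _ m%:R _ (blog (a + 1) m.+1)); last exact: blog_expdec.
    by move=> u; rewrite normrN normrM ger0_norm.
  - move=> u; apply: cvgB; apply: cvgM; by [exact: cvg_cst|exact: blog_continuous].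
  - exact: is_derive_blog.
rewrite IntB ?IntZ; try by [exact: blog_L1|exact/L1Z/blog_L1].
by move=> /eqP; rewrite subr_eq0 => /eqP H; rewrite /Tbeta mulrAC H; field; rewrite gt_eqF.
Qed.

(** The integrand splits as 1 = 1 / (1 + exp u) + exp u / (1 + exp u). *)
Lemma Tbeta_split a m : 0 < a -> a < m%:R ->
  Tbeta a m = Tbeta a m.+1 + Tbeta (a + 1) m.+1.
Proof.
move=> a0 am.
have aS : a + 1 < m.+1%:R by rewrite -natr1 ltrD2r.
have a1 : 0 < a + 1 by rewrite addr_gt0.
have aS' : a < m.+1%:R by rewrite (lt_trans am)// ltr_nat.
rewrite /Tbeta -IntD; try exact: blog_L1.
congr (Int mu _); apply/funext => u.
have e0 : 1 + expR u != 0 by rewrite gt_eqF// addr_gt0// expR_gt0.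
rewrite /blog mulrDl mul1r expRD exprS; field.
by rewrite e0 expf_neq0.
Qed.

Lemma Tbeta_recr a m : 0 < a -> a < m%:R ->
  Tbeta a m.+1 = (m%:R - a) / m%:R * Tbeta a m.
Proof.
move=> a0 am; have := Tbeta_split a0 am; rewrite Tbeta_recl// => H.
have m0 : m%:R != 0 :> R by rewrite gt_eqF// (lt_trans a0).
by rewrite mulrBl divff// mulrBl mul1r {1}H addrK.
Qed.

Lemma Tbeta_gt0 a m : 0 < a -> a < m%:R -> 0 < Tbeta a m.
Proof.
move=> a0 am; apply: (@Int_gt0 _ 0).
- exact: blog_continuous.
- exact: blog_L1.
- exact: blog_ge0.
- exact: blog_gt0.
Qed.

(** The symmetry of the Beta function, by u -> - u. *)
Lemma Tbeta_sym a m : Tbeta (m%:R - a) m = Tbeta a m.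
Proof.
rewrite /Tbeta /Int /Rintegral [in RHS]ge0_integral_oppr; last 2 first.
- exact: blog_continuous.
- exact: blog_ge0.
congr fine; apply: eq_integral => u _; congr EFin.
have e0 : 1 + expR u != 0 by rewrite gt_eqF// addr_gt0// expR_gt0.
rewrite /blog mulrBl expRB expRM_natl mulrN !expRN.
have -> : 1 + (expR u)^-1 = (1 + expR u) / expR u.
  by rewrite mulrDl mul1r divff ?expR_eq0// addrC.
by rewrite expr_div_n; field; rewrite !expf_neq0// ?expR_eq0.
Qed.

End Euler.

Section Reflection.
Context {R : realType}.
Local Notation mu := (@lebesgue_measure R).
Implicit Types (a b c u x t : R) (f g F : R -> R) (n m : nat).

(** B(n + t, n + 1 - t): the integrand is exp((t - 1/2) u) times a power of
1 / cosh(u / 2), whose mass concentrates at u = 0 as n grows. *)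
Definition hyp_moment n t := Tbeta (n%:R + t) n.*2.+1.

Lemma hyp_moment_dom n t : 0 < t < 1 -> 0 < n%:R + t /\ n%:R + t < n.*2.+1%:R.
Proof.
move=> /andP[t0 t1]; split; first by rewrite ltr_wpDl.
by rewrite -natr1 ler_ltD// ler_nat -addnn leq_addr.
Qed.

Lemma hyp_moment_gt0 n t : 0 < t < 1 -> 0 < hyp_moment n t.
Proof. by move=> /(hyp_moment_dom n)[? ?]; exact: Tbeta_gt0. Qed.

Lemma hyp_momentS n t : 0 < t < 1 -> hyp_moment n.+1 t =
  (n%:R + t) * (n.+1%:R - t) / (n.*2.+1%:R * n.*2.+2%:R) * hyp_moment n t.
Proof.
move=> t01; have [h1 h2] := hyp_moment_dom n t01.
rewrite /hyp_moment doubleS.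
rewrite Tbeta_recr; last 2 first.
- by rewrite -natr1 addrAC; lra.
- by rewrite -natr1 addrAC -[X in _ < X]natr1 ltrD2r.
rewrite -[n.+1%:R in LHS]natr1 [n%:R + 1 + t]addrAC Tbeta_recl//.
rewrite -!natr1 -muln2 natrM in h2 *.
by field; lra.
Qed.

(** Symmetrised in t and 1 - t, the bound is the inequality of arithmetic and
geometric means for exp(t u) and exp((1 - t) u). *)
Lemma hyp_moment_ge n t : 0 < t < 1 -> hyp_moment n (1 / 2) <= hyp_moment n t.
Proof.
move=> t01; have [h1 h2] := hyp_moment_dom n t01.
have t01' : 0 < 1 - t < 1 by lra.
have [h3 h4] := hyp_moment_dom n t01'.
have h01 : 0 < (1 / 2 : R) < 1 by lra.
have [h5 h6] := hyp_moment_dom n h01.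
have sym : hyp_moment n t = hyp_moment n (1 - t).
  rewrite /hyp_moment -Tbeta_sym; congr Tbeta.
  by rewrite -natr1 -muln2 natrM; ring.
rewrite -(ler_pMn2r (ltn0Sn 1)) [in leRHS]mulr2n {2}sym.
rewrite /hyp_moment /Tbeta -IntD; try exact: blog_L1.
rewrite -[leLHS]mulr_natl -IntZ; last exact: blog_L1.
apply: le_Int; first by apply: L1Z; exact: blog_L1.
  by apply: L1D; exact: blog_L1.
move=> u; rewrite /blog -mulrDl [leLHS]mulrA ler_wpM2r//.
have e s : expR ((n%:R + s) * u) = expR (n%:R * u) * expR (s * u).
  by rewrite mulrDl expRD.
rewrite !e -mulrDr mulrCA ler_wpM2l ?expR_ge0//.
have -> : expR (t * u) = expR (t * u / 2) ^+ 2.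
  by rewrite -expRM_natl; congr expR; field.
have -> : expR ((1 - t) * u) = expR ((1 - t) * u / 2) ^+ 2.
  by rewrite -expRM_natl; congr expR; field.
have -> : expR (1 / 2 * u) = expR (t * u / 2) * expR ((1 - t) * u / 2).
  by rewrite -expRD; congr expR; field.
have := sqr_ge0 (expR (t * u / 2) - expR ((1 - t) * u / 2)).
by rewrite sqrrB; lra.
Qed.

(** Both moments are compared with the Beta function at an integer: by
exp(t u) + exp((1 - t) u) <= 1 + exp u on one side and
2 exp(u / 2) <= 1 + exp u on the other. The two Beta functions that appear
differ by an explicit factor. *)
Lemma hyp_moment_le n t : 0 < t < 1 ->
  hyp_moment n.+1 t <= (1 + (2 * n.+1%:R)^-1) * hyp_moment n.+1 (1 / 2).
Proof.
move=> t01; have [h1 h2] := hyp_moment_dom n.+1 t01.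
have t01' : 0 < 1 - t < 1 by lra.
have [h3 h4] := hyp_moment_dom n.+1 t01'.
have h01 : 0 < (1 / 2 : R) < 1 by lra.
have [h5 h6] := hyp_moment_dom n.+1 h01.
have sym : hyp_moment n.+1 t = hyp_moment n.+1 (1 - t).
  rewrite /hyp_moment -Tbeta_sym; congr Tbeta.
  by rewrite -natr1 -muln2 natrM; ring.
have k1 : (0 : R) < n.+1%:R by [].
have k2 : (n.+1%:R : R) < n.+1.*2%:R by rewrite ltr_nat -addnn -addn1 leq_add2l.
have k3 : (n.+1%:R : R) < n.+1.*2.+1%:R by rewrite (lt_trans k2)// ltr_nat.
have k4 : 0 < n.+1%:R + 1 :> R by rewrite ltr_wpDl.
have k5 : n.+1%:R + 1 < n.+1.*2.+2%:R :> R.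
  by rewrite -[X in _ < X]natr1 ltrD2r.
(* The difference of the two sides factors as (1 - exp(t u)) (1 - exp((1 - t) u)). *)
have le1 : hyp_moment n.+1 t *+ 2 <= Tbeta n.+1%:R n.+1.*2.
  rewrite mulr2n {2}sym /hyp_moment /Tbeta -IntD; try exact: blog_L1.
  apply: le_Int; [by apply: L1D; exact: blog_L1|exact: blog_L1|].
  move=> u; have p0 : 0 < 1 + expR u by rewrite addr_gt0 ?expR_gt0.
  rewrite /blog -mulrDl exprS invfM mulrA ler_wpM2r//.
  have e s : expR ((n.+1%:R + s) * u) = expR (n.+1%:R * u) * expR (s * u).
    by rewrite mulrDl expRD.
  rewrite ler_pdivrMr// !e -mulrDr ler_wpM2l ?expR_ge0//.
  have -> : expR u = expR (t * u) * expR ((1 - t) * u).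
    by rewrite -expRD; congr expR; ring.
  set x := expR (t * u); set y := expR ((1 - t) * u).
  suff : 0 <= (1 - x) * (1 - y) by lra.
  have [u0|u0] := leP 0 u.
    by apply: mulr_le0; rewrite subr_le0 -expR0 ler_expR ?mulr_ge0//; nra.
  by apply: mulr_ge0; rewrite subr_ge0 expR_le1 ?mulr_ge0_le0//; nra.
have le2 : Tbeta (n.+1%:R + 1) n.+1.*2.+2 <= hyp_moment n.+1 (1 / 2) / 2.
  rewrite /hyp_moment /Tbeta mulrC -IntZ; last exact: blog_L1.
  apply: le_Int; [exact: blog_L1|by apply: L1Z; exact: blog_L1|].
  move=> u; have p0 : 0 < 1 + expR u by rewrite addr_gt0 ?expR_gt0.
  rewrite /blog exprS invfM !mulrA ler_wpM2r//.
  have e s : expR ((n.+1%:R + s) * u) = expR (n.+1%:R * u) * expR (s * u).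
    by rewrite mulrDl expRD.
  rewrite ler_pdivrMr// !e.
  rewrite [leRHS](_ : _ = expR (n.+1%:R * u) * (2^-1 * expR (1 / 2 * u) * (1 + expR u))); last by ring.
  rewrite ler_wpM2l ?expR_ge0// mul1r.
  have -> : expR u = expR (1 / 2 * u) ^+ 2.
    by rewrite -expRM_natl; congr expR; field.
  have := expR_ge0 (1 / 2 * u); have := sqr_ge0 (expR (1 / 2 * u) - 1).
  set z := expR _; nra.
have eq1 : Tbeta (n.+1%:R + 1 : R) n.+1.*2.+2 =
    n.+1%:R / (2 * (2 * n.+1%:R + 1)) * Tbeta n.+1%:R n.+1.*2.
  rewrite (@Tbeta_recl _ n.+1%:R n.+1.*2.+1)// (@Tbeta_recr _ n.+1%:R n.+1.*2)//.
  by rewrite -natr1 -muln2 natrM; field; lra.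
move: le2; rewrite eq1 => le2.
rewrite -(ler_pMn2r (ltn0Sn 1)) (le_trans le1)//.
rewrite -(ler_pM2l (x := n.+1%:R / (2 * (2 * n.+1%:R + 1)))); last first.
  by rewrite divr_gt0// mulr_gt0// addr_gt0// mulr_gt0.
rewrite (le_trans le2)// le_eqVlt; apply/orP; left; apply/eqP.
by rewrite -mulr_natr; field; lra.
Qed.

End Reflection.

Section ReflectionTrig.
Context {R : realType}.
Local Notation mu := (@lebesgue_measure R).
Implicit Types (a b c u x t : R) (f g F : R -> R) (n m : nat).

Lemma Rintegral_itv_derive f F a b : a < b -> continuous f ->
  (forall x : R, is_derive x (1 : R) F (f x)) ->
  \int[mu]_(x in `[a, b]) f x = F b - F a.
Proof.
move=> ab cf dF; have cF := is_derive_continuous dF.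
rewrite /Rintegral (@continuous_FTC2 _ f F) ?fineD//=.
- exact: continuous_subspaceT.
- split.
  + by move=> x _; have [] := dF x.
  + exact/cvg_at_right_filter/cF.
  + exact/cvg_at_left_filter/cF.
- by move=> x _; rewrite derive1E; exact: derive_val.
Qed.

Lemma continuous_itv_integrable f a b : continuous f ->
  mu.-integrable `[a, b] (EFin \o f).
Proof.
move=> cf; apply: continuous_compact_integrable; first exact: segment_compact.
exact: continuous_subspaceT.
Qed.

Definition cosfun a n x := cos (a * x) * cos x ^+ n.

Lemma is_derive_cosM a x : is_derive x (1 : R) (fun y => cos (a * y)) (- (a * sin (a * x))).
Proof. by apply: is_derive_eq; rewrite /GRing.scale/=; ring. Qed.

Lemma is_derive_sinM a x : is_derive x (1 : R) (fun y => sin (a * y)) (a * cos (a * x)).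
Proof. by apply: is_derive_eq; rewrite /GRing.scale/=; ring. Qed.

Lemma cosfun_continuous a n : continuous (cosfun a n).
Proof.
move=> x; apply: cvgM; first exact: (is_derive_continuous (is_derive_cosM a)).
by apply: (is_derive_continuous (fun y => is_derive_exprn n (is_derive_cos y))).
Qed.

(** The trigonometric counterpart of hyp_moment. For a = 2 t - 1 the
dependence on t of its recursion in n is, up to a shift of n, the inverse of
that of hyp_moment. *)
Definition trig_moment a n := \int[mu]_(x in `[- (pi / 2), pi / 2]) cosfun a n x.

Let pih : - (pi / 2) < pi / 2 :> R.
Proof. by have := @pi_gt0 R; lra. Qed.

Lemma trig_moment1 a : (1 - a ^+ 2) * trig_moment a 1 = 2 * cos (a * (pi / 2)).
Proof.
rewrite /trig_moment -RintegralZl//; last first.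
  exact/continuous_itv_integrable/cosfun_continuous.
have dF x : is_derive x (1 : R) (fun x => cos (a * x) * sin x - a * (sin (a * x) * cos x))
    ((1 - a ^+ 2) * cosfun a 1 x).
  have d1 := is_derive_cosM a x; have d2 := is_derive_sinM a x.
  by apply: is_derive_eq; rewrite /GRing.scale/= /cosfun; ring.
have cf : continuous (fun x => (1 - a ^+ 2) * cosfun a 1 x).
  by move=> x; apply: cvgM; [exact: cvg_cst|exact: cosfun_continuous].
rewrite (Rintegral_itv_derive pih cf dF) !mulrN sinN !cosN sinN cos_pihalf sin_pihalf.
ring.
Qed.

(** Two integrations by parts, carried out at once on an explicit primitive. *)
Lemma trig_momentSS a n : (n.+2%:R ^+ 2 - a ^+ 2) * trig_moment a n.+2 =
  n.+2%:R * n.+1%:R * trig_moment a n.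
Proof.
have dF x : is_derive x (1 : R) (fun x =>
      n.+2%:R * (cos (a * x) * (cos x ^+ n.+1 * sin x)) - a * (sin (a * x) * cos x ^+ n.+2))
    ((n.+2%:R ^+ 2 - a ^+ 2) * cosfun a n.+2 x - n.+2%:R * n.+1%:R * cosfun a n x).
  have d1 := is_derive_cosM a x; have d2 := is_derive_sinM a x.
  have d3 := is_derive_exprn n.+1 (is_derive_cos x).
  have d4 := is_derive_exprn n.+2 (is_derive_cos x).
  apply: is_derive_eq; rewrite /GRing.scale/= /cosfun.
  have z : - ((n%:R + 1 + 1) * (n%:R + 1) * cos (a * x) * cos x ^+ n)
      * (sin x ^+ 2 - (1 - cos x ^+ 2)) = 0 by rewrite sin2cos2 subrr mulr0.
  by rewrite -[LHS]subr0 -z /= !exprS -!natr1; ring.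
have c1 : continuous (fun x => (n.+2%:R ^+ 2 - a ^+ 2) * cosfun a n.+2 x).
  by move=> x; apply: cvgM; [exact: cvg_cst|exact: cosfun_continuous].
have c2 : continuous (fun x => n.+2%:R * n.+1%:R * cosfun a n x).
  by move=> x; apply: cvgM; [exact: cvg_cst|exact: cosfun_continuous].
have cf : continuous (fun x =>
    (n.+2%:R ^+ 2 - a ^+ 2) * cosfun a n.+2 x - n.+2%:R * n.+1%:R * cosfun a n x).
  by move=> x; apply: cvgB; [exact: c1|exact: c2].
rewrite /trig_moment -!RintegralZl//; try exact/continuous_itv_integrable/cosfun_continuous.
apply/eqP; rewrite -subr_eq0 -RintegralB//; try exact: continuous_itv_integrable.
rewrite (Rintegral_itv_derive pih cf dF) !cosN cos_pihalf !expr0n/=.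
by apply/eqP; ring.
Qed.

End ReflectionTrig.

Section ReflectionFormula.
Context {R : realType}.
Local Notation mu := (@lebesgue_measure R).
Implicit Types (a b c u x y t : R) (f g F : R -> R) (n m : nat).

(** Passing to the limit in a bound with error C / n. *)
Lemma le_of_harmonic C x y : (forall n, x <= y + C / n.+1%:R) -> x <= y.
Proof.
move=> H; rewrite leNgt; apply/negP => yx.
have xy : 0 < x - y by rewrite subr_gt0.
have := H (Num.truncn (C / (x - y))); have := truncnS_gt (C / (x - y)).
rewrite ltr_pdivrMr// => h; rewrite -lerBlDl => h2.
have : C / (Num.truncn (C / (x - y))).+1%:R < x - y by rewrite ltr_pdivrMr// mulrC.
by rewrite ltNge h2.
Qed.

Lemma trig_moment_le a n : trig_moment a n <= trig_moment 0 n.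
Proof.
apply: le_Rintegral => //; try exact/continuous_itv_integrable/cosfun_continuous.
move=> x; rewrite /= in_itv/= => xpi.
by rewrite /cosfun ler_wpM2r ?exprn_ge0 ?cos_ge0_pihalf// mul0r cos0 cos_le1.
Qed.

(** On the interval of integration cos x <= cos (a x). *)
Lemma trig_moment_ge a n : `|a| <= 1 -> trig_moment 0 n.+1 <= trig_moment a n.
Proof.
move=> a1.
apply: le_Rintegral => //; try exact/continuous_itv_integrable/cosfun_continuous.
move=> x; rewrite /= in_itv/= => xpi.
rewrite /cosfun exprS mulrA ler_wpM2r ?exprn_ge0 ?cos_ge0_pihalf//.
rewrite mul0r cos0 mul1r -[leLHS]cos_norm -[leRHS]cos_norm.
have xx : `|x| <= pi / 2 by rewrite ler_norml.
have := @pi_gt0 R => pi0.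
have ax : `|a * x| <= `|x| by rewrite normrM ler_piMl.
by rewrite leNgt ltr_cos ?in_itv/= ?normr_ge0 -?leNgt//=; lra.
Qed.

Lemma trig_moment0_gt0 n : 0 < trig_moment (0 : R) n.*2.+1.
Proof.
elim: n => [|n IHn].
  have := trig_moment1 (0 : R); rewrite expr0n/= subr0 mul1r mul0r cos0 mulr1 => ->.
  by [].
rewrite doubleS; have := trig_momentSS (0 : R) n.*2.+1.
rewrite expr0n/= subr0 => H.
rewrite -(pmulr_rgt0 (x := n.*2.+3%:R ^+ 2)) ?exprn_gt0// H.
by rewrite !mulr_gt0.
Qed.

(** The last factor compensates the shift of n between the two recursions. *)
Let prodm n t := hyp_moment n t * trig_moment (2 * t - 1) n.*2.+1 *
  ((n%:R + t) * (n.+1%:R - t)).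

Let prodmS n t : 0 < t < 1 ->
  prodm n.+1 t = n.*2.+3%:R / (4 * n.*2.+1%:R) * prodm n t.
Proof.
move=> t01; rewrite /prodm hyp_momentS// doubleS.
have := trig_momentSS (2 * t - 1) n.*2.+1.
set S := trig_moment _ _.+2; set S' := trig_moment _ _.
set E := hyp_moment _ _.
have k1 : n.*2.+3%:R ^+ 2 - (2 * t - 1) ^+ 2 = 4 * (n.+1%:R + t) * (n.+2%:R - t).
  by rewrite -!natr1 -muln2 natrM; ring.
rewrite k1 => H.
have p1 : n.*2.+1%:R != 0 :> R by rewrite pnatr_eq0.
have p2 : n.*2.+2%:R != 0 :> R by rewrite pnatr_eq0.
move: H p1 p2; move: n.*2.+1%:R n.*2.+2%:R n.*2.+3%:R n.+1%:R n.+2%:R => x1 x2 x3 y1 y2 H p1 p2.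
transitivity ((n%:R + t) * (y1 - t) / (x1 * x2) * E / 4 *
  (4 * (y1 + t) * (y2 - t) * S)); first by field; rewrite ?p1 ?p2.
by rewrite H; field; rewrite ?p1 ?p2.
Qed.

Let prodm_ratio n t s : 0 < t < 1 -> 0 < s < 1 ->
  prodm n t * prodm 0 s = prodm n s * prodm 0 t.
Proof.
move=> t01 s01; elim: n => [|n IHn]; first by rewrite mulrC.
by rewrite !prodmS// -[LHS]mulrA IHn mulrA.
Qed.

Let prodm0 t : 0 < t < 1 -> prodm 0 t = Tbeta t 1 * sin (pi * t) / 2.
Proof.
move=> t01; rewrite /prodm /hyp_moment add0r double0.
have := trig_moment1 (2 * t - 1).
have -> : (2 * t - 1) * (pi / 2) = pi * t - pi / 2 by field.
rewrite cosBpihalf => H.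
rewrite -[sin _](mulKf (x := 2))// -H; by field.
Qed.

Let h01 : 0 < (1 / 2 : R) < 1. Proof. lra. Qed.

Let half0 : 2 * (1 / 2) - 1 = 0 :> R. Proof. by field. Qed.

Let prodm_half_gt0 n : 0 < prodm n (1 / 2).
Proof.
rewrite /prodm half0 !mulr_gt0 ?hyp_moment_gt0 ?trig_moment0_gt0//.
by rewrite -natr1 subr_gt0; have : (0 : R) <= n%:R by []; lra.
Qed.

Let prodm_le n t : 0 < t < 1 ->
  prodm n.+1 t <= (1 + (2 * n.+1%:R)^-1) * prodm n.+1 (1 / 2).
Proof.
move=> t01; rewrite /prodm half0 !mulrA -mulrA -[leRHS]mulrA.
have n0 : (0 : R) <= n.+1%:R by [].
apply: ler_pM.
- rewrite mulr_ge0 ?(ltW (hyp_moment_gt0 _ t01))//.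
  apply: le_trans (trig_moment_ge _ _); last by rewrite ler_norml; lra.
  rewrite -doubleS; apply: le_trans (trig_moment_ge _ _); last by rewrite normr0.
  exact: ltW (trig_moment0_gt0 _).
- by rewrite mulr_ge0// -?natr1; lra.
- apply: ler_pM; rewrite ?(ltW (hyp_moment_gt0 _ t01))//.
  + apply: le_trans (trig_moment_ge _ _); last by rewrite ler_norml; lra.
    rewrite -doubleS; apply: le_trans (trig_moment_ge _ _); last by rewrite normr0.
    exact: ltW (trig_moment0_gt0 _).
  + exact: hyp_moment_le.
  + exact: trig_moment_le.
- rewrite -!natr1 -subr_ge0 [leRHS](_ : _ = (t - 1 / 2) ^+ 2) ?sqr_ge0//.
  by field.
Qed.

Let prodm_ge n t : 0 < t < 1 ->
  (1 - n.+1%:R^-1) * prodm n.+1 (1 / 2) <= prodm n.+1 t.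
Proof.
move=> t01; rewrite /prodm half0.
have n0 : (0 : R) < n.+1%:R by [].
have T0 := trig_moment0_gt0 n.+1.
have T1 : n.+1.*2.+2%:R / n.+1.*2.+3%:R * trig_moment (0 : R) n.+1.*2.+1 <=
    trig_moment (2 * t - 1) n.+1.*2.+1.
  apply: le_trans (trig_moment_ge _ _); last by rewrite ler_norml; lra.
  apply: le_trans (trig_moment_ge _ _); last by rewrite normr0.
  have := trig_momentSS (0 : R) n.+1.*2.+1; rewrite expr0n/= subr0 => H.
  rewrite -(ler_pM2l (x := n.+1.*2.+3%:R ^+ 2)) ?exprn_gt0// H.
  have p3 : n.+1.*2.+3%:R != 0 :> R by rewrite pnatr_eq0.
  rewrite le_eqVlt; apply/orP; left; apply/eqP; move: p3.
  by move: n.+1.*2.+3%:R n.+1.*2.+2%:R => x3 x2 p3; field.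
have E0 := hyp_moment_gt0 n.+1 h01.
have E1 := hyp_moment_ge n.+1 t01.
set E := hyp_moment n.+1 _ in E0 E1 *; set S := trig_moment _ _ in T0 T1 *.
apply: (@le_trans _ _ (E * (n.+1.*2.+2%:R / n.+1.*2.+3%:R * S) *
   ((n.+1%:R + t) * (n.+2%:R - t)))).
  set r := n.+1.*2.+2%:R / _.
  rewrite [leLHS](_ : _ = E * S * ((1 - n.+1%:R^-1) * ((n.+1%:R + 1 / 2) * (n.+2%:R - 1 / 2)))); last by ring.
  rewrite [leRHS](_ : _ = E * S * (r * ((n.+1%:R + t) * (n.+2%:R - t)))); last by ring.
  rewrite ler_wpM2l ?mulr_ge0 ?(ltW E0) ?(ltW T0)// /r.
  rewrite -(@natr1 R n.+1.*2.+2) -(@natr1 R n.+1.*2.+1) -(@natr1 R n.+1.*2) -(@natr1 R n.+1) -muln2 natrM.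
  have n1 : (1 : R) <= n.+1%:R by rewrite ler1n.
  set k : R := n.+1%:R in n0 n1 *.
  apply: (@le_trans _ _ ((k * 2 + 1 + 1) / (k * 2 + 1 + 1 + 1) * (k * (k + 1)))); last first.
    rewrite ler_wpM2l ?divr_ge0//; try lra; nra.
  rewrite -(ler_pM2r (x := k * (k * 2 + 1 + 1 + 1))) ?mulr_gt0//; last by lra.
  rewrite [leLHS](_ : _ = (k - 1) * ((k + 1 / 2) * (k + 1 / 2)) * (k * 2 + 3)); last by field; lra.
  rewrite [leRHS](_ : _ = (k * 2 + 2) * (k * (k + 1)) * k); last by field; lra.
  nra.
rewrite ler_wpM2r//; first by rewrite mulr_ge0// -?natr1; lra.
by rewrite ler_pM ?mulr_ge0 ?divr_ge0 ?(ltW E0) ?(ltW T0).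
Qed.

(** Euler's integral [Tbeta t 1], the Beta function B(t, 1 - t). The moments
[hyp_moment n t] and [trig_moment (2 t - 1) (2 n + 1)] obey two-term
recursions in n whose dependence on t cancels in their product, so the ratio
of this product at t and at 1/2 is independent of n; for large n both families
lose their dependence on t and the ratio tends to 1. *)
Lemma Tbeta_reflection t : 0 < t < 1 -> Tbeta t 1 * sin (pi * t) = Tbeta (1 / 2) 1.
Proof.
move=> t01; suff /eqP : prodm 0 t = prodm 0 (1 / 2).
  rewrite !prodm0// => /eqP H.
  have -> : Tbeta (1 / 2) 1 = 2 * (Tbeta (1 / 2) 1 * sin (pi * (1 / 2)) / 2) :> R.
    by rewrite mul1r sin_pihalf; field.
  by rewrite -H; field.
have e n : prodm 0 t = prodm 0 (1 / 2) * (prodm n t / prodm n (1 / 2)).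
  rewrite mulrA (mulrC (prodm 0 (1 / 2))) prodm_ratio// (mulrC (prodm n _)) mulfK//.
  by rewrite gt_eqF.
apply/eqP; rewrite eq_le; apply/andP; split.
- apply: (@le_of_harmonic (prodm 0 (1 / 2) / 2)) => n.
  rewrite (e n.+1) [leRHS](_ : _ = prodm 0 (1 / 2) * (1 + (2 * n.+1%:R)^-1)).
    by rewrite ler_wpM2l ?(ltW (prodm_half_gt0 0))// ler_pdivrMr// prodm_le.
  have p1 : n.+1%:R != 0 :> R by rewrite pnatr_eq0.
  by move: n.+1%:R p1 => x1 p1; field.
- apply: (@le_of_harmonic (prodm 0 (1 / 2))) => n.
  rewrite -lerBlDr (e n.+1) [leLHS](_ : _ = prodm 0 (1 / 2) * (1 - n.+1%:R^-1)).
    by rewrite ler_wpM2l ?(ltW (prodm_half_gt0 0))// ler_pdivlMr// prodm_ge.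
  have p1 : n.+1%:R != 0 :> R by rewrite pnatr_eq0.
  by move: n.+1%:R p1 => x1 p1; field.
Qed.

Lemma cvgNy_expR : @expR R x @[x --> -oo] --> 0.
Proof. by apply/cvgNy_compNP; exact: cvgr_expR. Qed.

Lemma cvgy_expR : @expR R x @[x --> +oo] --> +oo.
Proof.
apply/cvgryPge => A; near=> x; rewrite (le_trans _ (expR_ge1Dx _))// -lerBlDl.
by near: x; apply: nbhs_pinfty_ge; exact: num_real.
Unshelve. all: by end_near. Qed.

(** The primitive of the integrand is twice the arctangent of exp(u / 2). *)
Lemma Tbeta_half : Tbeta (1 / 2) 1 = pi :> R.
Proof.
have dF x : is_derive x (1 : R) (fun u => 2 * atan (expR (u / 2))) (blog (1 / 2) 1 x).
  have d1 : is_derive x (1 : R) (fun u => expR (u / 2)) (expR (x / 2) / 2).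
    by apply: is_derive_eq; rewrite /GRing.scale/=; ring.
  have d2 := @is_derive1_comp _ atan (fun u => expR (u / 2)) x _ _
    (is_derive1_atan (expR (x / 2))) d1.
  have d3 : is_derive x (1 : R) (fun u => atan (expR (u / 2)))
     ((1 + expR (x / 2) ^+ 2)^-1 * (expR (x / 2) / 2)) by [].
  have e0 : 1 + expR x != 0 by rewrite gt_eqF// addr_gt0// expR_gt0.
  apply: is_derive_eq; rewrite /GRing.scale/= /blog expr1.
  have -> : expR (x / 2) ^+ 2 = expR x by rewrite -expRM_natl; congr expR; field.
  have -> : 1 / 2 * x = x / 2 by field.
  by field.
rewrite /Tbeta (@Int_derive _ (blog (1 / 2) 1) _ 0 pi _ _ dF) ?subr0//.
- by apply: blog_L1; lra.
- exact: blog_continuous.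
- rewrite -(mulr0 2) -atan0; apply: cvgM; first exact: cvg_cst.
  apply: (@cvg_comp _ _ _ (fun u => expR (u / 2)) atan _ (nbhs 0)).
    apply: (@cvg_comp _ _ _ (fun u => u / 2) expR _ (-oo%R)); last exact: cvgNy_expR.
    by apply: gt0_cvgMlNy => //; exact: cvg_id.
  exact: continuous_atan.
- rewrite [X in _ --> X](_ : _ = 2 * (pi / 2)); last by field.
  apply: cvgM; first exact: cvg_cst.
  apply: (@cvg_comp _ _ _ (fun u => expR (u / 2)) atan _ (+oo%R)).
    apply: (@cvg_comp _ _ _ (fun u => u / 2) expR _ (+oo%R)); last exact: cvgy_expR.
    by apply: gt0_cvgMly => //; exact: cvg_id.
  exact: cvgy_atan.
Qed.

Lemma Tbeta_pi t : 0 < t < 1 -> Tbeta t 1 = pi / sin (pi * t).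
Proof.
move=> t01; rewrite -[RHS](congr1 (fun x => x / _) Tbeta_half) -(Tbeta_reflection t01).
rewrite mulfK// gt_eqF// sin_gt0_pi//.
have := @pi_gt0 R; move: t01 => /andP[t0 t1] p0.
by rewrite mulr_gt0//= gtr_pMr.
Qed.

End ReflectionFormula.

(** * Iterated differences *)

Section Differences.
Implicit Types (V W : zmodType).

Fixpoint dif V W (s : seq V) (f : V -> W) (y : V) : W :=
  if s is x :: s' then dif s' f (y + x) - dif s' f y else f y.

Lemma eq_dif V W (s : seq V) (f g : V -> W) y : f =1 g -> dif s f y = dif s g y.
Proof. by move=> fg; elim: s y => [|x s IHs] y //=; rewrite !IHs. Qed.

Lemma dif_cat V W (s t : seq V) (f : V -> W) y :
  dif (s ++ t) f y = dif s (dif t f) y.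
Proof. by elim: s y => [|x s IHs] y //=; rewrite !IHs. Qed.

Lemma dif_comp V V' W (phi : V -> V') (s : seq V) (f : V' -> W) y :
  {morph phi : a b / a + b} ->
  dif s (f \o phi) y = dif (map phi s) f (phi y).
Proof. by move=> phiD; elim: s y => [|x s IHs] y //=; rewrite !IHs phiD. Qed.

Lemma difZ V (W : pzRingType) a (s : seq V) (f : V -> W) y :
  dif s (fun z => a * f z) y = a * dif s f y.
Proof. by elim: s y => [|x s IHs] y //=; rewrite !IHs mulrBr. Qed.

Definition del (T : Type) (j : nat) (s : seq T) := take j s ++ drop j.+1 s.

Lemma del_cons (T : Type) j x (s : seq T) : del j.+1 (x :: s) = x :: del j s.
Proof. by []. Qed.

Lemma del0 (T : Type) x (s : seq T) : del 0 (x :: s) = s.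
Proof. by rewrite /del /= drop0. Qed.

Lemma size_del (T : Type) j (s : seq T) : (j < size s)%N -> size (del j s) = (size s).-1.
Proof. by move=> js; rewrite size_cat size_take size_drop js; lia. Qed.

Lemma del_map (T U : Type) (h : T -> U) j s : del j (map h s) = map h (del j s).
Proof. by rewrite /del -map_take -map_drop map_cat. Qed.

Lemma prod_del (A : comNzRingType) j (s : seq A) : (j < size s)%N ->
  s`_j * \prod_(x <- del j s) x = \prod_(x <- s) x.
Proof.
move=> js; rewrite /del big_cat/= mulrCA -[in RHS](cat_take_drop j s) big_cat/=.
by rewrite (drop_nth 0 js) big_cons.
Qed.

(** Leibniz' rule for a product with an additive factor: at most one of the
differences acts on the additive factor. *)
Lemma dif_leibniz V (W : comNzRingType) (l : V -> W) (g : V -> W) (s : seq V) y :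
  {morph l : a b / a + b} ->
  dif s (fun z => l z * g z) y =
  l y * dif s g y + \sum_(j < size s) l (s`_j) * dif (del j s) g (y + s`_j).
Proof.
move=> lD; elim: s y => [|x s IHs] y /=; first by rewrite big_ord0 addr0.
rewrite !IHs lD big_ord_recl del0 [(x :: s)`_ord0]/=.
under [in RHS]eq_bigr => j _.
  rewrite lift0 del_cons /= mulrBr [y + _ + x]addrAC; over.
rewrite sumrB mulrDl mulrBr.
by ring.
Qed.

(** Differences lower the degree: a power of degree less than the number of
steps is annihilated and one of the same degree becomes a constant. The
induction writes the power as a product with an additive factor. *)
Lemma dif_exp (A : comNzRingType) (s : seq A) a y : (a <= size s)%N ->
  dif s (fun z => z ^+ a) y = (a == size s)%:R * (a`!%:R * \prod_(x <- s) x).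
Proof.
elim: a s y => [|a IHa] s y sa.
  have dif0 t z : dif t (fun=> 1 : A) z = (size t == 0)%N%:R.
    elim: t z => [|x t IHt] z //=; rewrite !IHt subrr //.
  rewrite (eq_dif _ _ (g := fun=> 1)) ?dif0 //.
  by case: s {sa} => [|x s]; rewrite /= ?big_nil ?mulr1// !mul0r.
rewrite (eq_dif _ _ (g := fun z => idfun z * z ^+ a)); last by move=> z; rewrite exprS.
rewrite dif_leibniz//.
have -> := IHa s y (ltnW sa).
rewrite ltn_eqF// mul0r mulr0 add0r.
transitivity (\sum_(j < size s) (a == (size s).-1)%:R * (a`!%:R * \prod_(x <- s) x)).
  apply: eq_bigr => j _.
  have -> := IHa (del j s) (y + s`_j); last by rewrite size_del//; lia.
  by rewrite size_del//= mulrCA [X in _ * X]mulrCA prod_del.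
rewrite sumr_const card_ord.
case: (eqVneq a.+1 (size s)) => [<-|ne] /=.
  by rewrite eqxx !mul1r factS natrM -mulrA [RHS]mulr_natl.
by rewrite (_ : (a == (size s).-1) = false) ?mul0r ?mul0rn//; apply/negbTE; lia.
Qed.

Lemma dif_nseq V (W : pzRingType) m (h : V) (f : V -> W) y :
  dif (nseq m h) f y =
  \sum_(i < m.+1) (-1) ^+ (m + i) * 'C(m, i)%:R * f (y + h *+ i).
Proof.
elim: m y => [|m IHm] y /=.
  by rewrite big_ord1 /= expr0 !mul1r addr0.
rewrite !IHm.
pose F (n i : nat) := (-1) ^+ (m.+1 + i) * 'C(n, i)%:R * f (y + h *+ i).
have -> : \sum_(i < m.+2) (-1) ^+ (m.+1 + i) * 'C(m.+1, i)%:R * f (y + h *+ i) =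
   F m.+1 0%N + \sum_(i < m.+1) F m.+1 i.+1 by rewrite big_ord_recl.
have -> : \sum_(i < m.+1) F m.+1 i.+1 = \sum_(i < m.+1) F m i.+1 +
    \sum_(i < m.+1) (-1) ^+ (m + i) * 'C(m, i)%:R * f (y + h + h *+ i).
  rewrite -big_split; apply: eq_bigr => i _; rewrite /F binS natrD mulrDr mulrDl.
  congr (_ + _ * _); last by rewrite mulrS addrA.
  by rewrite addSn addnS !exprS !mulN1r opprK.
rewrite addrA addrC; congr (_ + _).
have -> : F m.+1 0%N = F m 0%N by rewrite /F !bin0.
have -> : F m 0%N + \sum_(i < m.+1) F m i.+1 = \sum_(i < m.+1) F m i.
  transitivity (\sum_(i < m.+2) F m i); first by rewrite [RHS]big_ord_recl.
  by rewrite big_ord_recr /= {2}/F bin_small// mulr0 mul0r addr0.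
rewrite -sumrN; apply: eq_bigr => i _.
by rewrite /F addSn exprS mulN1r !mulNr.
Qed.

End Differences.

(** * Second differences of the Gaussian kernel *)

Section SecondDifferences.
Context {R : realType}.
Implicit Types (x y k : R) (f g : R -> R) (m l : nat).

Definition dcoef m (i j : nat) : R := (-1) ^+ (i + j) * 'C(m, i)%:R * 'C(m, j)%:R.

(** The second difference of order m; applied to a stationary covariance it
gives the variance of an increment of order m. *)
Definition dsum m f : R :=
  \sum_(i < m.+1) \sum_(j < m.+1) dcoef m i j * f (i%:R - j%:R).

Lemma eq_dsum m f g : f =1 g -> dsum m f = dsum m g.
Proof. by move=> fg; apply: eq_bigr => i _; apply: eq_bigr => j _; rewrite fg. Qed.

Lemma dsumD m f g : dsum m (fun k => f k + g k) = dsum m f + dsum m g.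
Proof.
rewrite -big_split; apply: eq_bigr => i _; rewrite -big_split; apply: eq_bigr => j _.
by rewrite mulrDr.
Qed.

Lemma dsumZ m a f : dsum m (fun k => a * f k) = a * dsum m f.
Proof.
rewrite big_distrr; apply: eq_bigr => i _; rewrite big_distrr; apply: eq_bigr => j _.
by rewrite mulrCA.
Qed.

Lemma dsumB m f g : dsum m (fun k => f k - g k) = dsum m f - dsum m g.
Proof.
rewrite dsumD; congr (_ + _).
by rewrite -mulN1r -dsumZ; apply: eq_dsum => k; rewrite mulN1r.
Qed.

Lemma dsum_sum m (I : Type) (s : seq I) (F : I -> R -> R) :
  dsum m (fun k => \sum_(i <- s) F i k) = \sum_(i <- s) dsum m (F i).
Proof.
elim: s => [|i s IHs].
  rewrite big_nil (@eq_dsum _ _ (fun k => 0 * k)); last by move=> k; rewrite big_nil mul0r.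
  by rewrite dsumZ mul0r.
by rewrite big_cons -IHs -dsumD; apply: eq_dsum => k; rewrite big_cons.
Qed.

Lemma cvg_sum_seq (I T : Type) (s : seq I) (FF : set_system T) {_ : Filter FF}
    (F : I -> T -> R) (lim : I -> R) :
  (forall i, F i x @[x --> FF] --> lim i) ->
  (\sum_(i <- s) F i x) @[x --> FF] --> \sum_(i <- s) lim i.
Proof.
move=> Fl; elim: s => [|i s IHs].
  by rewrite big_nil; under eq_fun do rewrite big_nil; exact: cvg_cst.
by rewrite big_cons; under eq_fun do rewrite big_cons; exact: cvgD.
Qed.

(** As a function of the lag, the covariance is differenced m times with step 1
and m times with step - 1. *)
Lemma dsumE m f : dsum m f = dif (nseq m 1 ++ nseq m (-1)) f 0.
Proof.
rewrite dif_cat dif_nseq; apply: eq_bigr => i _.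
rewrite dif_nseq big_distrr; apply: eq_bigr => j _.
rewrite add0r mulNrn /dcoef /= !exprD.
have := sqrr_sign R m; rewrite expr2.
set a := (-1) ^+ m; set b := (-1) ^+ i; set c := (-1) ^+ j => aa.
rewrite [RHS](_ : _ = a * a * (b * c * 'C(m, i)%:R * 'C(m, j)%:R * f (i%:R - j%:R))).
  by rewrite aa mul1r.
by ring.
Qed.

(** The cancellation that removes the regular part of the covariance at 0. *)
Lemma dsum_exp m l : (l < m.*2)%N -> dsum m (fun k => k ^+ l) = 0.
Proof.
move=> lm; rewrite dsumE dif_exp size_cat !size_nseq addnn ?(ltnW lm)//.
by rewrite ltn_eqF// mul0r.
Qed.

Lemma dif_affine f (c d y : R) (s : seq R) :
  dif s (fun z => f (c + d * z)) y = dif (map ( *%R d) s) f (c + d * y).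
Proof. by elim: s y => [|x s IHs] y //=; rewrite !IHs mulrDr addrA. Qed.

Lemma dsum_affine m f (c d : R) :
  dsum m (fun k => f (c + d * k)) = dif (nseq m d ++ nseq m (- d)) f c.
Proof. by rewrite dsumE dif_affine map_cat !map_nseq mulr1 mulrN1 mulr0 addr0. Qed.

Lemma cvg_dsum (T : Type) (FF : set_system T) {_ : Filter FF} m
    (F : R -> T -> R) (lim : R -> R) :
  (forall k, F k x @[x --> FF] --> lim k) ->
  dsum m (F ^~ x) @[x --> FF] --> dsum m lim.
Proof.
move=> Fl; apply: cvg_sum_seq => i; apply: cvg_sum_seq => j.
by apply: cvgM; [exact: cvg_cst|exact: Fl].
Qed.

Definition dcoef_norm m : R := \sum_(i < m.+1) \sum_(j < m.+1) `|dcoef m i j|.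

Lemma dcoef_norm_ge0 m : 0 <= dcoef_norm m.
Proof. by rewrite sumr_ge0// => i _; rewrite sumr_ge0. Qed.

Lemma dsum_norm_le m f (B : R) : (forall i j, (i <= m)%N -> (j <= m)%N ->
  `|f (i%:R - j%:R)| <= B) -> `|dsum m f| <= dcoef_norm m * B.
Proof.
move=> fB; rewrite (le_trans (ler_norm_sum _ _ _))// mulr_suml ler_sum// => i _.
rewrite (le_trans (ler_norm_sum _ _ _))// mulr_suml ler_sum// => j _.
by rewrite normrM ler_wpM2l// fB// -ltnS.
Qed.

Lemma ge0_of_derive_ge0 f g : f 0 = 0 -> (forall x, is_derive x (1 : R) f (g x)) ->
  (forall x, 0 <= x -> 0 <= g x) -> forall x, 0 <= x -> 0 <= f x.
Proof.
move=> f0 df g0 x; rewrite le_eqVlt => /predU1P[<-|x0]; first by rewrite f0.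
have [|c] := @MVT R f g 0 x x0 (fun z _ => df z).
  by apply: continuous_subspaceT; exact: is_derive_continuous df.
rewrite in_itv/= => /andP[c0 _]; rewrite f0 !subr0 => ->.
by apply: mulr_ge0; [apply: g0|]; exact: ltW.
Qed.

Definition exp_rest m y : R := expR (- y) - \sum_(l < m) (- y) ^+ l / l`!%:R.

Lemma exp_restS m y : exp_rest m.+1 y = exp_rest m y - (- y) ^+ m / m`!%:R.
Proof. by rewrite /exp_rest big_ord_recr/= opprD addrA. Qed.

Lemma is_derive_expn_fact m x :
  is_derive x (1 : R) (fun y => y ^+ m.+1 / m.+1`!%:R) (x ^+ m / m`!%:R).
Proof.
have d := is_derive_exprn m.+1 (is_derive_id x (1 : R)).
apply: is_derive_eq; rewrite /GRing.scale/= factS natrM.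
have m1 : m.+1%:R != 0 :> R by rewrite pnatr_eq0.
have m2 : m`!%:R != 0 :> R by rewrite pnatr_eq0 -lt0n fact_gt0.
by move: m.+1%:R m1 => c c0; field; rewrite ?m2 ?c0.
Qed.

Lemma is_derive_exp_rest m x : is_derive x (1 : R) (exp_rest m.+1) (- exp_rest m x).
Proof.
elim: m => [|m IHm].
  rewrite (_ : exp_rest 1 = fun y => expR (- y) - 1).
    by apply: is_derive_eq; rewrite /exp_rest big_ord0; ring.
  by apply/funext => y; rewrite exp_restS /exp_rest big_ord0 expr0 fact0 mulr1n divr1 subr0.
have d := is_derive_expn_fact m (- x).
have d1 := is_derive1_comp d (is_deriveN (is_derive_id x (1 : R))).
have d2 : is_derive x (1 : R) (fun y => (- y) ^+ m.+1 / m.+1`!%:R)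
  ((- x) ^+ m / m`!%:R * - 1) by [].
rewrite (_ : exp_rest m.+2 = fun y => exp_rest m.+1 y - (- y) ^+ m.+1 / m.+1`!%:R).
  by apply: is_derive_eq; rewrite (exp_restS m); ring.
by apply/funext => y; rewrite exp_restS.
Qed.

(** The alternating series of exp(- y) encloses it: the derivative of each
remainder is, up to sign, the previous remainder. *)
Lemma exp_rest_bounds m y : 0 <= y ->
  0 <= (-1) ^+ m * exp_rest m y <= y ^+ m / m`!%:R.
Proof.
elim: m y => [|m IHm] y y0.
  rewrite /exp_rest big_ord0 subr0 !expr0 fact0 mulr1n !mul1r invr1.
  by rewrite expR_ge0 expR_le1 oppr_le0.
have d0 : forall x, is_derive x (1 : R) (fun y => (-1) ^+ m.+1 * exp_rest m.+1 y) ((-1) ^+ m * exp_rest m x).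
  move=> x; have d := is_derive_exp_rest m x.
  by apply: is_derive_eq; rewrite /GRing.scale/= exprS; ring.
have d1 := is_derive_expn_fact m.
have z : exp_rest m.+1 0 = 0.
  rewrite /exp_rest big_ord_recl /= expr0 fact0 mulr1n divr1 oppr0 expR0.
  by rewrite big1 ?addr0 ?subrr// => i _; rewrite /bump/= add1n exprS !mul0r.
apply/andP; split.
  apply: (ge0_of_derive_ge0 _ d0) => //; first by rewrite z mulr0.
  by move=> x /IHm/andP[].
rewrite -subr_ge0.
apply: (@ge0_of_derive_ge0 (fun y => y ^+ m.+1 / m.+1`!%:R - (-1) ^+ m.+1 * exp_rest m.+1 y)
   (fun x => x ^+ m / m`!%:R - (-1) ^+ m * exp_rest m x)) => //.
- by rewrite z expr0n/= mul0r mulr0 subrr.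
- by move=> x /IHm/andP[_]; rewrite subr_ge0.
Qed.

Lemma exp_rest_norm m y : 0 <= y -> `|exp_rest m y| <= y ^+ m / m`!%:R.
Proof.
move=> y0; have /andP[h0 h1] := exp_rest_bounds m y0.
have -> : `|exp_rest m y| = `|(-1) ^+ m * exp_rest m y|.
  by rewrite normrM normrX normrN1 expr1n mul1r.
by rewrite ger0_norm.
Qed.

(** The m-th order difference, applied in each of the two indices, of the
Gaussian kernel exp(- x (i - j)^2). *)
Definition gauss_dsum m x : R := dsum m (fun k => expR (- (k ^+ 2 * x))).

(** The Taylor polynomial of degree less than m in x has degree less than 2 m
in k, hence is annihilated. *)
Lemma gauss_dsum_le_exp m x : 0 <= x ->
  `|gauss_dsum m x| <= dcoef_norm m * (m%:R ^+ (2 * m) / m`!%:R) * x ^+ m.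
Proof.
move=> x0.
have -> : gauss_dsum m x = dsum m (fun k => exp_rest m (k ^+ 2 * x)).
  rewrite /exp_rest dsumB dsum_sum big1 ?subr0// => l _.
  rewrite (@eq_dsum _ _ (fun k => ((- x) ^+ l / l`!%:R) * k ^+ (2 * l))).
    by rewrite dsumZ dsum_exp ?mulr0// -muln2 mulnC ltn_pmul2r.
  by move=> k; rewrite -mulrN exprMn -exprM; ring.
rewrite -mulrA; apply: dsum_norm_le => i j im jm.
have k0 : 0 <= (i%:R - j%:R) ^+ 2 * x by rewrite mulr_ge0// sqr_ge0.
apply: (le_trans (exp_rest_norm m k0)); rewrite [leRHS]mulrAC ler_wpM2r ?invr_ge0//.
rewrite exprMn -exprM ler_wpM2r ?exprn_ge0// -[leLHS]ger0_norm; last first.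
  by rewrite exprM exprn_ge0// sqr_ge0.
rewrite normrX lerXn2r ?nnegrE//.
have [ij|ij] := leqP i j.
  by rewrite distrC ger0_norm ?subr_ge0 ?ler_nat// lerBlDr -natrD ler_nat; lia.
by rewrite ger0_norm ?subr_ge0 ?ler_nat ?(ltnW ij)// lerBlDr -natrD ler_nat; lia.
Qed.

Lemma gauss_dsum_le m x : 0 <= x -> `|gauss_dsum m x| <= dcoef_norm m.
Proof.
move=> x0; rewrite -[leRHS]mulr1; apply: dsum_norm_le => i j _ _.
by rewrite ger0_norm ?expR_ge0// expR_le1 oppr_le0 mulr_ge0// sqr_ge0.
Qed.

(** The Gaussian kernel is positive definite: after factoring
exp(- x (i^2 + j^2)) out, the remaining exp(2 x i j) is a power series with
nonnegative coefficients in the rank one kernel i j. *)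
Lemma gauss_dsum_ge0 m x : 0 <= x -> 0 <= gauss_dsum m x.
Proof.
move=> x0.
pose v (i : nat) : R := (-1) ^+ i * 'C(m, i)%:R * expR (- (i%:R ^+ 2 * x)).
pose e (i j : nat) : R := 2 * x * i%:R * j%:R.
(* Partial sums of the power series of exp(2 x i j). *)
pose S n := \sum_(0 <= k < n) (2 * x) ^+ k / k`!%:R * (\sum_(i < m.+1) v i * i%:R ^+ k) ^+ 2.
have SE n : S n = \sum_(i < m.+1) \sum_(j < m.+1) v i * v j * series (exp_coeff (e i j)) n.
  rewrite /S.
  transitivity (\sum_(0 <= k < n) \sum_(i < m.+1) \sum_(j < m.+1) v i * v j * exp_coeff (e i j) k).
    apply: eq_bigr => k _; rewrite expr2 mulr_suml mulr_sumr; apply: eq_bigr => i _.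
    rewrite mulr_sumr mulr_sumr; apply: eq_bigr => j _.
    by rewrite /exp_coeff/= /e !exprMn; ring.
  rewrite exchange_big; apply: eq_bigr => i _.
  rewrite exchange_big; apply: eq_bigr => j _.
  by rewrite /series/= mulr_sumr.
have cS : S @ \oo --> gauss_dsum m x.
  rewrite (_ : S = fun n => \sum_(i < m.+1) \sum_(j < m.+1) v i * v j * series (exp_coeff (e i j)) n); last exact/funext.
  have -> : gauss_dsum m x = \sum_(i < m.+1) \sum_(j < m.+1) v i * v j * expR (e i j).
    apply: eq_bigr => i _; apply: eq_bigr => j _.
    rewrite /dcoef /v /e exprD.
    have -> : - ((i%:R - j%:R) ^+ 2 * x) = - (i%:R ^+ 2 * x) + - (j%:R ^+ 2 * x) + 2 * x * i%:R * j%:R :> R.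
      by ring.
    by rewrite !expRD; ring.
  apply: cvg_sum_seq => i; apply: cvg_sum_seq => j; apply: cvgM; first exact: cvg_cst.
  exact: is_cvg_series_exp_coeff.
rewrite -(cvg_lim _ cS)//; apply: limr_ge; first by apply/cvg_ex; exists (gauss_dsum m x).
apply: nearW => n; apply: sumr_ge0 => k _.
by rewrite mulr_ge0 ?sqr_ge0// divr_ge0// exprn_ge0// mulr_ge0.
Qed.

(** For large x the terms with i <> j are negligible and the term i = j = 0,
equal to 1, survives. *)
Lemma gauss_dsum_gt0 m : exists2 x, 0 < x & 0 < gauss_dsum m x.
Proof.
have K0 := dcoef_norm_ge0 m; set K := dcoef_norm m in K0.
have x0 : 0 < K + 1 by rewrite ltr_wpDl.
(* At x = K + 1 the terms off the diagonal sum up to less than 1. *)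
exists (K + 1) => //.
have Kx : K * expR (- (K + 1)) < 1.
  rewrite expRN ltr_pdivrMr ?expR_gt0// mul1r.
  by rewrite (lt_le_trans _ (expR_ge1Dx _))//; lra.
apply: (@lt_le_trans _ _ (1 - K * expR (- (K + 1)))); first by rewrite subr_gt0.
have -> : 1 - K * expR (- (K + 1)) = \sum_(i < m.+1) \sum_(j < m.+1)
    (((i == 0%N :> nat) && (j == 0%N :> nat))%:R - `|dcoef m i j| * expR (- (K + 1))).
  rewrite -[1]/(1 : R) /K /dcoef_norm mulr_suml.
  transitivity (\sum_(i < m.+1) (\sum_(j < m.+1) ((i == 0%N :> nat) && (j == 0%N :> nat))%:R
    - (\sum_(j < m.+1) `|dcoef m i j| * expR (- (K + 1))))); last first.
    by apply: eq_bigr => i _; rewrite sumrB.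
  rewrite sumrB; congr (_ - _); last by apply: eq_bigr => i _; rewrite mulr_suml.
  rewrite big_ord_recl /= big_ord_recl /= big1 ?addr0 => [|i _]; last by [].
  by rewrite big1 ?addr0// => i _; rewrite big1.
apply: ler_sum => i _; apply: ler_sum => j _.
have [ij|ij] := eqVneq (i : nat) j.
  rewrite ij subrr expr0n/= mul0r oppr0 expR0 mulr1 andbb.
  have -> : dcoef m j j = 'C(m, j)%:R ^+ 2.
    by rewrite /dcoef -signr_odd addnn odd_double mul1r.
  apply: (@le_trans _ _ (j == 0%N :> nat)%:R).
    by rewrite lerBlDr lerDl mulr_ge0 ?expR_ge0.
  by case: eqVneq => [->|_]; rewrite ?bin0 ?expr1n// sqr_ge0.
have -> : ((i == 0%N :> nat) && (j == 0%N :> nat)) = false.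
  by apply/negbTE/negP => /andP[/eqP i0 /eqP j0]; rewrite i0 j0 eqxx in ij.
have k1 : 1 <= `|i%:R - j%:R| :> R.
  have [lij|lji|e] := ltngtP i j; last by rewrite e eqxx in ij.
  - by rewrite distrC ger0_norm ?subr_ge0 ?ler_nat 1?ltnW// lerBrDr nat1r ler_nat.
  - by rewrite ger0_norm ?subr_ge0 ?ler_nat 1?ltnW// lerBrDr nat1r ler_nat.
have k2 : 1 <= (i%:R - j%:R) ^+ 2 :> R by rewrite -real_normK ?num_real// exprn_ege1.
rewrite sub0r lerNl -mulNr.
apply: (@le_trans _ _ (`|dcoef m i j| * expR (- ((i%:R - j%:R) ^+ 2 * (K + 1))))).
  by rewrite ler_wpM2r ?expR_ge0// -normrN ler_norm.
by rewrite ler_wpM2l// ler_expR lerN2 ler_peMl// ltW.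
Qed.

End SecondDifferences.

(** * The Gamma function and the Matern covariance as a mixture *)

Section GammaMatern.
Context {R : realType}.
Local Notation mu := (@lebesgue_measure R).
Implicit Types (a b c u v w x y t nu : R) (f g F : R -> R) (n m : nat).

Lemma Int_shift c f : continuous f -> (forall x, 0 <= f x) ->
  Int mu (fun x => f (x + c)) = Int mu f.
Proof. by move=> cf f0; rewrite /Int /Rintegral [in RHS](ge0_integral_shift c). Qed.

Lemma Int_oppr f : continuous f -> (forall x, 0 <= f x) ->
  Int mu (fun x => f (- x)) = Int mu f.
Proof. by move=> cf f0; rewrite /Int /Rintegral [in RHS]ge0_integral_oppr. Qed.

(** The integrand of Gamma, after the substitution x = exp u. *)
Definition gexp a u := expR (a * u - expR u).

Lemma is_derive_gexp a u : is_derive u (1 : R) (gexp a) (a * gexp a u - gexp (a + 1) u).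
Proof.
rewrite /gexp; apply: is_derive_eq; rewrite /GRing.scale/=.
have -> : (a + 1) * u - expR u = (a * u - expR u) + u by ring.
by rewrite (expRD _ u); ring.
Qed.

Lemma gexp_continuous a : continuous (gexp a).
Proof. exact: is_derive_continuous (is_derive_gexp a). Qed.

Lemma gexp_ge0 a u : 0 <= gexp a u. Proof. exact: expR_ge0. Qed.

Lemma exp_le_fact n u : 0 <= u -> expR (- u) * u ^+ n <= n`!%:R.
Proof.
move=> u0; rewrite expRN mulrC ler_pdivrMr ?expR_gt0//.
case: n => [|n]; first by rewrite expr0 fact0 mul1r -expR0 ler_expR.
have := expR_ge1Dxn n u0 => h.
rewrite mulrC -ler_pdivrMr ?ltr0n ?fact_gt0//.
by rewrite (le_trans _ h)// lerDr.
Qed.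

Lemma gexp_expdec a : 0 < a -> expdec (gexp a).
Proof.
move=> a0; pose n := (Num.truncn a).+1.
have an : a < n%:R by exact: truncnS_gt.
apply: (@expdec2 _ (n`!%:R) a (n%:R - a)) => //; first by rewrite subr_gt0.
- move=> u; rewrite ger0_norm ?gexp_ge0// /gexp.
  apply: (@le_trans _ _ (expR (a * u))); first by rewrite ler_expR gerBl expR_ge0.
  by rewrite ler_peMl ?expR_ge0// ler1n fact_gt0.
- move=> u; rewrite ger0_norm ?gexp_ge0// /gexp.
  have -> : - (n%:R - a) * u = a * u - n%:R * u by ring.
  rewrite [leLHS](_ : _ = expR (- expR u) * expR u ^+ n * expR (a * u - n%:R * u)).
    by rewrite ler_wpM2r ?expR_ge0// exp_le_fact// expR_ge0.
  by rewrite -expRM_natl -!expRD; congr expR; ring.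
Qed.

Lemma gexp_L1 a : 0 < a -> L1 mu (gexp a).
Proof.
move=> a0; apply: expdec_L1; last exact: gexp_expdec.
by apply: continuous_measurable_fun; exact: gexp_continuous.
Qed.

Lemma Gamma_exp a : Gamma a = Int mu (gexp a).
Proof.
rewrite /Gamma /Rintegral ge0_integral_expR.
- congr fine; apply: eq_integral => u _; congr EFin.
  by rewrite -expRM /gexp -!expRD; congr expR; ring.
- move=> x; rewrite in_itv/= andbT => x0; apply: cvgM.
    have : derivable (@powR R ^~ (a - 1)) x 1 by apply: derivable_powR; rewrite in_itv/= x0.
    by move=> /derivable1_diffP/differentiable_continuous.
  apply: continuous_comp; last exact: continuous_expR.
  exact: opp_continuous.
- by move=> x x0; rewrite mulr_ge0 ?powR_ge0 ?expR_ge0.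
Qed.

Lemma Gamma_gt0 a : 0 < a -> 0 < Gamma a.
Proof.
move=> a0; rewrite Gamma_exp; apply: (@Int_gt0 _ _ 0).
- exact: gexp_continuous.
- exact: gexp_L1.
- exact: gexp_ge0.
- exact: expR_gt0.
Qed.

(** Integration by parts. *)
Lemma GammaS a : 0 < a -> Gamma (a + 1) = a * Gamma a.
Proof.
move=> a0; have a1 : 0 < a + 1 by rewrite addr_gt0.
have : Int mu (fun u => a * gexp a u - gexp (a + 1) u) = 0.
  apply: (Int_derive0 _ (gexp_expdec a0)).
  - apply: expdecD; first exact/expdecZ/gexp_expdec.
    apply: (@expdec_le _ 1 _ (gexp (a + 1))); last exact: gexp_expdec.
    by move=> u; rewrite normrN mul1r.
  - move=> u; apply: cvgB; last exact: gexp_continuous.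
    by apply: cvgM; [exact: cvg_cst|exact: gexp_continuous].
  - exact: is_derive_gexp.
rewrite IntB ?IntZ; try by [exact: gexp_L1|exact/L1Z/gexp_L1].
by move=> /eqP; rewrite subr_eq0 !Gamma_exp => /eqP ->.
Qed.

Lemma Gamma_scale a x : 0 < a -> 0 < x ->
  L1 mu (fun u => expR (a * u - x * expR u)) /\
  Int mu (fun u => expR (a * u - x * expR u)) = expR (- (a * ln x)) * Gamma a.
Proof.
move=> a0 x0.
have E u : expR (a * u - x * expR u) = expR (- (a * ln x)) * gexp a (u + ln x).
  by rewrite /gexp expRD lnK// -expRD; congr expR; ring.
have cg : continuous (fun u => gexp a (u + ln x)).
  move=> u; apply: continuous_comp; last exact: gexp_continuous.
  by apply: cvgD; [exact: cvg_id|exact: cvg_cst].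
have [I1 I2] : L1 mu (fun u => gexp a (u + ln x)) /\
    Int mu (fun u => gexp a (u + ln x)) = Gamma a.
  apply: ge0_L1 => //.
  - exact: continuous_measurable_fun.
  - by move=> u; exact: gexp_ge0.
  - rewrite -(ge0_integral_shift _ (@gexp_continuous a))//; last exact: gexp_ge0.
    by rewrite (EFin_Int (gexp_L1 a0)) Gamma_exp.
rewrite (_ : (fun u => _) = fun u => expR (- (a * ln x)) * gexp a (u + ln x)); last exact/funext.
by split; [exact: L1Z|rewrite IntZ// I2].
Qed.

Lemma gexp_scale_expdec a x : 0 < a -> 0 < x -> expdec (fun u => expR (a * u - x * expR u)).
Proof.
move=> a0 x0; have [C [c [c0 gC]]] := gexp_expdec a0.
have C0 : 0 <= C by have := le_trans (normr_ge0 _) (gC 0); rewrite normr0 mulr0 expR0 mulr1.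
exists (expR (- (a * ln x)) * C * expR (c * `|ln x|)), c; split => // u.
have -> : expR (a * u - x * expR u) = expR (- (a * ln x)) * gexp a (u + ln x).
  by rewrite /gexp expRD lnK// -expRD; congr expR; ring.
rewrite normrM ger0_norm ?expR_ge0// -!mulrA ler_wpM2l ?expR_ge0//.
rewrite (le_trans (gC _))// ler_wpM2l// -expRD ler_expR.
have : c * `|u| <= c * (`|u + ln x| + `|ln x|).
  by rewrite ler_wpM2l ?(ltW c0)//; have := ler_normB (u + ln x) (ln x); rewrite addrK.
lra.
Qed.

Lemma Gamma1 : Gamma 1 = 1 :> R.
Proof.
rewrite Gamma_exp.
have dF v : is_derive v (1 : R) (fun v => - expR (- expR v)) (gexp 1 v).
  by apply: is_derive_eq; rewrite /GRing.scale/= /gexp expRD mul1r; ring.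
rewrite (Int_derive (l := -1) (r := 0) _ _ dF) ?sub0r ?opprK//.
- exact: gexp_L1.
- exact: gexp_continuous.
- apply: cvgN; rewrite -[X in _ --> X]expR0 -oppr0.
  apply: (@cvg_comp _ _ _ (fun v => - expR v) expR _ (nbhs (- 0))); last exact: continuous_expR.
  by apply: cvgN; exact: cvgNy_expR.
- rewrite -oppr0; apply: cvgN.
  apply: (@cvg_comp _ _ _ expR (fun v => expR (- v)) _ (+oo%R)); last exact: cvgr_expR.
  exact: cvgy_expR.
Qed.

Lemma Int_exp_scale x : 0 < x -> L1 mu (fun v => expR (v - x * expR v)) /\
  Int mu (fun v => expR (v - x * expR v)) = x^-1.
Proof.
move=> x0; have [] := Gamma_scale ltr01 x0.
rewrite Gamma1 mulr1 mul1r expRN lnK//.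
by rewrite (_ : (fun u => expR (1 * u - x * expR u)) = fun u => expR (u - x * expR u))//;
  apply/funext => u; rewrite mul1r.
Qed.

(** The integrand of the Bessel function over the whole line, before
symmetrisation. *)
Definition bkern nu x u := expR (nu * u - x * cosh u).

Lemma coshN u : cosh (- u) = cosh u.
Proof. by rewrite /cosh opprK addrC. Qed.

Lemma cosh_continuous : continuous (@cosh R).
Proof.
have dc u : is_derive u (1 : R) (@cosh R) ((expR u - expR (- u)) / 2).
  by apply: is_derive_eq; rewrite /GRing.scale/=; ring.
exact: is_derive_continuous dc.
Qed.

Lemma bkern_continuous nu x : continuous (bkern nu x).
Proof.
move=> u; apply: continuous_comp; last exact: continuous_expR.
apply: cvgB; first exact: mulrl_continuous.
by apply: cvgM; [exact: cvg_cst|exact: cosh_continuous].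
Qed.

Lemma bkern_expdec nu x : 0 < nu -> 0 < x -> expdec (bkern nu x).
Proof.
move=> nu0 x0; have x2 : 0 < x / 2 by rewrite divr_gt0.
apply: (@expdec_le _ 1 _ (fun u => expR (nu * u - x / 2 * expR u))).
  move=> u; rewrite mul1r !ger0_norm ?expR_ge0// ler_expR lerD2l lerN2.
  rewrite /cosh mulrDl mulrDr [leLHS](_ : _ = x * (expR u / 2)); last by ring.
  by rewrite lerDl mulr_ge0 ?divr_ge0 ?expR_ge0// ltW.
exact: gexp_scale_expdec.
Qed.

Lemma besselK_exp nu x : 0 < nu -> 0 < x -> besselK nu x = Int mu (bkern nu x) / 2.
Proof.
move=> nu0 x0.
have ck := @bkern_continuous nu x.
have k0 u : 0 <= bkern nu x u by exact: expR_ge0.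
have Ik : L1 mu (bkern nu x).
  by apply: expdec_L1; [exact: continuous_measurable_fun|exact: bkern_expdec].
have ckN : continuous (fun u => bkern nu x (- u)).
  by move=> u; apply: continuous_comp; [exact: opp_continuous|exact: ck].
have IkN : L1 mu (fun u => bkern nu x (- u)).
  by apply: expdec_L1; [exact: continuous_measurable_fun|exact/expdecN/bkern_expdec].
pose f u := expR (- (x * cosh u)) * cosh (nu * u).
have fE u : f u = 2^-1 * (bkern nu x u + bkern nu x (- u)).
  by rewrite /f /bkern coshN mulrN {2}/cosh !expRD; ring.
have I2 : Int mu f = Int mu (bkern nu x).
  rewrite (_ : f = fun u => 2^-1 * (bkern nu x u + bkern nu x (- u))); last exact/funext.
  rewrite IntZ ?IntD ?(Int_oppr ck k0)//; last exact: L1D.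
  by field.
have fe : f =1 f \o -%R by move=> u; rewrite /= !fE opprK addrC.
have f0 u : 0 <= f u by rewrite fE mulr_ge0// addr_ge0.
have cf : continuous f.
  rewrite (_ : f = fun u => 2^-1 * (bkern nu x u + bkern nu x (- u))); last exact/funext.
  by move=> u; apply: cvgM; [exact: cvg_cst|apply: cvgD; [exact: ck|exact: ckN]].
have If : L1 mu f.
  rewrite (_ : f = fun u => 2^-1 * (bkern nu x u + bkern nu x (- u))); last exact/funext.
  exact/L1Z/L1D.
rewrite -I2 /besselK /Int /Rintegral (ge0_symfun_integralT f0 cf fe) -set_itvcy.
rewrite fineM//= ?[2 * _]mulrC ?mulfK//.
by apply: integrable_fin_num => //; exact: integrableS If.
Qed.

(** The Gaussian covariance exp(- y / s) weighted by the unnormalised Gamma density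
of s = exp u. *)
Definition mixt nu y u := expR (nu * u - expR u - y * expR (- u)).

Lemma mixt_continuous nu y : continuous (mixt nu y).
Proof.
move=> u; apply: continuous_comp; last exact: continuous_expR.
apply: cvgB; first by apply: cvgB; [exact: mulrl_continuous|exact: continuous_expR].
apply: cvgM; first exact: cvg_cst.
by apply: continuous_comp; [exact: opp_continuous|exact: continuous_expR].
Qed.

Lemma mixt_expdec nu y : 0 < nu -> 0 <= y -> expdec (mixt nu y).
Proof.
move=> nu0 y0; apply: (@expdec_le _ 1 _ (gexp nu)); last exact: gexp_expdec.
move=> u; rewrite mul1r !ger0_norm ?expR_ge0// ler_expR gerBl.
by rewrite mulr_ge0// expR_ge0.
Qed.

Lemma mixt_L1 nu y : 0 < nu -> 0 <= y -> L1 mu (mixt nu y).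
Proof.
move=> nu0 y0; apply: expdec_L1; last exact: mixt_expdec.
by apply: continuous_measurable_fun; exact: mixt_continuous.
Qed.

(** The Gaussian covariances in the mixture are exp(- (alpha t)^2 / (4 s)), with
s = exp u distributed according to a Gamma law. The translation of u by
ln(alpha t / 2) symmetrises the exponent into that of the Bessel function. *)
Lemma matern_mixture (sigma alpha nu t : R) : 0 < alpha -> 0 < nu -> 0 <= t ->
  matern sigma alpha nu t =
  sigma ^+ 2 / Gamma nu * Int mu (mixt nu ((alpha * t) ^+ 2 / 4)).
Proof.
move=> a0 nu0 t0; rewrite /matern; have [->|tn0] := eqVneq t 0.
  rewrite mulr0 expr0n/= mul0r (_ : mixt nu 0 = gexp nu).
    by rewrite -Gamma_exp divfK// gt_eqF// Gamma_gt0.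
  by apply/funext => u; rewrite /mixt mul0r subr0.
have x0 : 0 < alpha * t by rewrite mulr_gt0// lt0r tn0.
move: x0; set x := alpha * t => x0; have x2 : 0 < x / 2 by rewrite divr_gt0.
have y0 : 0 <= x ^+ 2 / 4 by rewrite divr_ge0// sqr_ge0.
have E u : mixt nu (x ^+ 2 / 4) (u + ln (x / 2)) = expR (nu * ln (x / 2)) * bkern nu x u.
  rewrite /mixt /bkern -expRD; congr expR.
  by rewrite opprD !expRD !expRN lnK// /cosh expRN; field; rewrite expR_eq0 gt_eqF.
rewrite besselK_exp// -(Int_shift (ln (x / 2)) (@mixt_continuous _ _) (fun u => expR_ge0 _)).
rewrite (_ : (fun u => _) = fun u => expR (nu * ln (x / 2)) * bkern nu x u); last exact/funext.
rewrite IntZ; last first.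
  apply: expdec_L1; last exact: bkern_expdec.
  by apply: continuous_measurable_fun; exact: bkern_continuous.
have -> : expR (nu * ln (x / 2)) = x `^ nu / 2 `^ nu.
  rewrite mulrC expRM lnK// powRM ?invr_ge0 ?ltW//; congr (_ * _).
  by rewrite -powR_inv1// -powRrM mulN1r powRN.
have -> : 2 `^ (nu - 1) = 2 `^ nu / 2 :> R.
  by rewrite powRB ?powRr1// pnatr_eq0 implybT.
have p0 : 2 `^ nu != 0 :> R by rewrite gt_eqF// powR_gt0.
have g0 : Gamma nu != 0 by rewrite gt_eqF// Gamma_gt0.
move: (2 `^ nu) (x `^ nu) (Gamma nu) p0 g0 => pp xn g p0 g0.
by field; rewrite ?p0 ?g0.
Qed.

End GammaMatern.

(** * Expansion of the variance of an increment *)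

Section Expansion.
Context {R : realType}.
Local Notation mu := (@lebesgue_measure R).
Implicit Types (a b c u v w x y t nu k : R) (f g F : R -> R) (n m : nat).

Lemma dsum_continuous m (F : R -> R -> R) : (forall k, continuous (F k)) ->
  continuous (fun u => dsum m (F ^~ u)).
Proof.
by move=> cF u; apply: cvg_dsum => k; exact: cF.
Qed.

Lemma L1_dsum m (F : R -> R -> R) : (forall k, L1 mu (F k)) ->
  L1 mu (fun u => dsum m (F ^~ u)).
Proof. by move=> IF; apply: L1_sum => i; apply: L1_sum => j; exact: L1Z. Qed.

Lemma Int_dsum m (F : R -> R -> R) : (forall k, L1 mu (F k)) ->
  Int mu (fun u => dsum m (F ^~ u)) = dsum m (fun k => Int mu (F k)).
Proof.
move=> IF; rewrite Int_sum; last by move=> i; apply: L1_sum => j; exact: L1Z.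
by apply: eq_bigr => i _; rewrite Int_sum => [|j]; [apply: eq_bigr => j _; rewrite IntZ|exact: L1Z].
Qed.

Lemma gauss_dsum_continuous m : continuous (@gauss_dsum R m).
Proof.
apply: dsum_continuous => k u; apply: continuous_comp; last exact: continuous_expR.
by apply: cvgN; exact: mulrl_continuous.
Qed.

(** The second difference of the Gaussian kernel against a power of its
parameter exp v; it is integrable because gauss_dsum vanishes to order m at 0. *)
Definition jkern m a v := expR (- (a * v)) * gauss_dsum m (expR v).

(** The Mellin transform of gauss_dsum at - a. *)
Definition J m a := Int mu (jkern m a).

Lemma jkern_ge0 m a v : 0 <= jkern m a v.
Proof. by rewrite mulr_ge0 ?expR_ge0// gauss_dsum_ge0// expR_ge0. Qed.

Lemma jkern_continuous m a : continuous (jkern m a).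
Proof.
move=> v; apply: cvgM.
  apply: continuous_comp; last exact: continuous_expR.
  by apply: cvgN; exact: mulrl_continuous.
by apply: continuous_comp; [exact: continuous_expR|exact: gauss_dsum_continuous].
Qed.

Lemma jkern_expdec m a : 0 < a -> a < m%:R -> expdec (jkern m a).
Proof.
move=> a0 am; pose C := @dcoef_norm R m * (m%:R ^+ (2 * m) / m`!%:R).
have K0 := @dcoef_norm_ge0 R m.
have C0 : 0 <= C by rewrite mulr_ge0// divr_ge0// exprn_ge0.
apply: (@expdec2 _ (dcoef_norm m + C) (m%:R - a) a) => //; first by rewrite subr_gt0.
- move=> v; rewrite normrM ger0_norm ?expR_ge0//.
  rewrite [leRHS](_ : _ = expR (- (a * v)) * ((dcoef_norm m + C) * expR (m%:R * v))).
    rewrite ler_wpM2l ?expR_ge0// (le_trans (gauss_dsum_le_exp _ (expR_ge0 _)))//.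
    by rewrite -expRM_natl ler_wpM2r ?expR_ge0// -/C lerDr.
  by rewrite mulrCA -expRD; congr (_ * expR _); ring.
- move=> v; rewrite normrM ger0_norm ?expR_ge0// mulrC mulNr ler_wpM2r ?expR_ge0//.
  by rewrite (le_trans (gauss_dsum_le _ (expR_ge0 _)))// lerDl.
Qed.

Lemma jkern_L1 m a : 0 < a -> a < m%:R -> L1 mu (jkern m a).
Proof.
move=> a0 am; apply: expdec_L1; last exact: jkern_expdec.
by apply: continuous_measurable_fun; exact: jkern_continuous.
Qed.

Lemma J_gt0 m a : 0 < a -> a < m%:R -> 0 < J m a.
Proof.
move=> a0 am; have [x x0 gx] := @gauss_dsum_gt0 R m.
apply: (@Int_gt0 _ _ (ln x)).
- exact: jkern_continuous.
- exact: jkern_L1.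
- exact: jkern_ge0.
- by rewrite mulr_gt0 ?expR_gt0// lnK.
Qed.

(** The translation u = ln y - v moves y out of the Gaussian kernel and leaves
it in a factor that tends to 1. *)
Lemma dsum_mixt m nu y : 0 < nu -> nu < m%:R -> 0 < y ->
  dsum m (fun k => Int mu (mixt nu (k ^+ 2 * y))) =
  y `^ nu * Int mu (fun v => expR (- (y * expR (- v))) * jkern m nu v).
Proof.
move=> nu0 num y0.
have E k : continuous (mixt nu (k ^+ 2 * y)) by exact: mixt_continuous.
have k0 k : 0 <= k ^+ 2 * y by rewrite mulr_ge0 ?sqr_ge0// ltW.
rewrite -Int_dsum; last by move=> k; exact: mixt_L1.
pose f u := dsum m (fun k => mixt nu (k ^+ 2 * y) u).
have fE u : f u = expR (nu * u - expR u) * gauss_dsum m (y * expR (- u)).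
  rewrite /f /gauss_dsum -dsumZ; apply: eq_dsum => k.
  by rewrite /mixt -expRD; congr expR; ring.
have f0 u : 0 <= f u.
  by rewrite fE mulr_ge0 ?expR_ge0// gauss_dsum_ge0// mulr_ge0 ?expR_ge0// ltW.
have cf : continuous f by exact: dsum_continuous.
have cfN : continuous (fun u => f (- u)).
  by move=> u; apply: continuous_comp; [exact: opp_continuous|exact: cf].
rewrite -/f -(Int_oppr cf f0) -(Int_shift (- ln y) cfN (fun u => f0 _)).
have fv v : f (- (v - ln y)) = y `^ nu * (expR (- (y * expR (- v))) * jkern m nu v).
  rewrite fE opprB /jkern mulrA mulrA opprB; congr (_ * _).
    rewrite /powR gt_eqF// -!expRD [expR (ln y - v)]expRB lnK// expRN.
    by congr expR; ring.
  by rewrite expRB lnK// mulrCA mulrA mulfK// gt_eqF.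
rewrite (_ : (fun v => _) = fun v => y `^ nu * (expR (- (y * expR (- v))) * jkern m nu v)); last exact/funext.
rewrite IntZ//; apply: (le_L1 _ _ (jkern_L1 nu0 num)).
  apply: measurable_funM; apply: continuous_measurable_fun; last exact: jkern_continuous.
  move=> v; apply: continuous_comp; last exact: continuous_expR.
  apply: cvgN; apply: cvgM; first exact: cvg_cst.
  by apply: continuous_comp; [exact: opp_continuous|exact: continuous_expR].
move=> v; rewrite normrM (ger0_norm (jkern_ge0 _ _ _)) ger0_norm ?expR_ge0//.
by rewrite ler_piMl ?jkern_ge0// expR_le1 oppr_le0 mulr_ge0 ?expR_ge0// ltW.
Qed.

Lemma jkern_shift m a v : expR (- v) * jkern m a v = jkern m (a + 1) v.
Proof. by rewrite /jkern mulrA -expRD; congr (expR _ * _); ring. Qed.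

(** Near 0 only the factor exp(- y e^(- v)) depends on y; its Taylor
expansion at order 2 produces the two leading irregular terms. *)
Lemma mixt_expansion m nu y : 0 < nu -> nu + 2 < m%:R -> 0 < y ->
  `|Int mu (fun v => expR (- (y * expR (- v))) * jkern m nu v)
    - (J m nu - y * J m (nu + 1))| <= y ^+ 2 / 2 * J m (nu + 2).
Proof.
move=> nu0 num y0.
have I0 : L1 mu (jkern m nu) by apply: jkern_L1 => //; lra.
have I1 : L1 mu (jkern m (nu + 1)) by apply: jkern_L1 => //; lra.
have I2 : L1 mu (jkern m (nu + 2)) by apply: jkern_L1 => //; lra.
have me : measurable_fun setT (fun v => expR (- (y * expR (- v))) * jkern m nu v).
  apply: measurable_funM; apply: continuous_measurable_fun; last exact: jkern_continuous.
  move=> v; apply: continuous_comp; last exact: continuous_expR.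
  apply: cvgN; apply: cvgM; first exact: cvg_cst.
  by apply: continuous_comp; [exact: opp_continuous|exact: continuous_expR].
have I3 : L1 mu (fun v => expR (- (y * expR (- v))) * jkern m nu v).
  apply: (le_L1 _ _ I0) => // v.
  rewrite normrM (ger0_norm (jkern_ge0 _ _ _)) ger0_norm ?expR_ge0//.
  by rewrite ler_piMl ?jkern_ge0// expR_le1 oppr_le0 mulr_ge0 ?expR_ge0// ltW.
have I4 : L1 mu (fun v => jkern m nu v - y * jkern m (nu + 1) v) by exact/L1B/L1Z.
rewrite /J -IntZ// -IntB//; last exact: L1Z.
rewrite -IntB// -IntZ// (le_trans (le_norm_Int _))//; first exact: L1B.
apply: le_Int; [exact/L1_norm/L1B|exact: L1Z|move=> v].
have z0 : 0 <= y * expR (- v) by rewrite mulr_ge0 ?expR_ge0// ltW.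
have := exp_rest_norm 2 z0.
rewrite /exp_rest !big_ord_recr big_ord0/= add0r expr0 expr1 !factS fact0 => h.
have -> : jkern m (nu + 2) v = expR (- v) ^+ 2 * jkern m nu v.
  by rewrite (_ : nu + 2 = nu + 1 + 1) -?jkern_shift; ring.
rewrite -jkern_shift [X in `|X|](_ : _ = (expR (- (y * expR (- v))) - (1 / 1 + - (y * expR (- v)) / 1)) * jkern m nu v); last by field.
rewrite normrM (ger0_norm (jkern_ge0 _ _ _)) mulrA ler_wpM2r ?jkern_ge0//.
by rewrite (le_trans h)// exprMn le_eqVlt; apply/orP; left; apply/eqP; field.
Qed.

End Expansion.

(** * The constants of the expansion *)

Section Constants.
Context {R : realType}.
Local Notation mu := (@lebesgue_measure R).
Implicit Types (a b c u v w x y t nu k : R) (f g F : R -> R) (n m : nat).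

(** The second difference of the Cauchy kernel 1 / (exp w + k^2) against a
power of exp w. *)
Definition stieltjes m a w := expR ((a + 1) * w) * dsum m (fun k => (expR w + k ^+ 2)^-1).

Lemma stieltjes_den_gt0 w k : 0 < expR w + k ^+ 2.
Proof. by rewrite ltr_pwDl ?expR_gt0// sqr_ge0. Qed.

Lemma stieltjes_continuous m a : continuous (stieltjes m a).
Proof.
move=> w; apply: cvgM.
  by apply: continuous_comp; [exact: mulrl_continuous|exact: continuous_expR].
apply: cvg_dsum => k; apply: cvgV; first by rewrite gt_eqF// stieltjes_den_gt0.
by apply: cvgD; [exact: continuous_expR|exact: cvg_cst].
Qed.

Lemma Int_laplace_gauss_dsum m w :
  L1 mu (fun v => expR v * gauss_dsum m (expR v) * expR (- expR (w + v))) /\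
  Int mu (fun v => expR v * gauss_dsum m (expR v) * expR (- expR (w + v))) =
  dsum m (fun k => (expR w + k ^+ 2)^-1).
Proof.
have I k := Int_exp_scale (stieltjes_den_gt0 w k).
have E v : expR v * gauss_dsum m (expR v) * expR (- expR (w + v)) =
    dsum m (fun k => expR (v - (expR w + k ^+ 2) * expR v)).
  rewrite mulrAC /gauss_dsum -dsumZ; apply: eq_dsum => k.
  by rewrite expRD -!expRD; congr expR; rewrite expRD; ring.
rewrite (_ : (fun v => _) = fun v => dsum m (fun k => expR (v - (expR w + k ^+ 2) * expR v))); last exact/funext.
split; first by apply: L1_dsum => k; exact: (I k).1.
by rewrite Int_dsum => [|k]; [apply: eq_dsum => k; exact: (I k).2|exact: (I k).1].
Qed.

(** Writing Gamma (a + 1) x ^ (- a - 1) as a Laplace transform and exchanging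
the two integrals turns the Gaussian kernel into the Cauchy kernel
1 / (y + k^2). *)
Lemma Gamma_J m a : 0 < a -> a < m%:R ->
  L1 mu (stieltjes m a) /\ Int mu (stieltjes m a) = Gamma (a + 1) * J m a.
Proof.
move=> a0 am; have a1 : 0 < a + 1 by rewrite addr_gt0.
pose f (z : R * R) : \bar R :=
  (expR z.1 * gauss_dsum m (expR z.1) * expR (- expR (z.2 + z.1)) * expR ((a + 1) * z.2))%:E.
have f0 z : (0 <= f z)%E.
  by rewrite lee_fin !mulr_ge0 ?expR_ge0// gauss_dsum_ge0// expR_ge0.
have mf : measurable_fun setT f.
  have m1 : measurable_fun setT (fun z : R * R => z.1) by exact: measurable_fst.
  have m2 : measurable_fun setT (fun z : R * R => z.2) by exact: measurable_snd.
  apply/measurable_EFinP; apply: measurable_funM; first apply: measurable_funM; first apply: measurable_funM.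
  - by apply: measurableT_comp m1; exact: measurable_expR.
  - apply: (measurableT_comp (f := fun u => gauss_dsum m (expR u))) m1.
    apply: continuous_measurable_fun => u.
    by apply: continuous_comp; [exact: continuous_expR|exact: gauss_dsum_continuous].
  - apply: (measurableT_comp (f := fun u => expR (- expR u)) (g := fun z : R * R => z.2 + z.1)).
      apply: continuous_measurable_fun => u; apply: continuous_comp; last exact: continuous_expR.
      by apply: cvgN; exact: continuous_expR.
    exact: measurable_funD.
  - apply: (measurableT_comp (f := fun u => expR ((a + 1) * u))) m2.
    apply: continuous_measurable_fun => u; apply: continuous_comp; last exact: continuous_expR.
    exact: mulrl_continuous.
have FT := @fubini_tonelli _ _ _ _ _ mu mu f mf f0.
have F1 v : fubini_F mu f v = (Gamma (a + 1) * jkern m a v)%:E.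
  rewrite /fubini_F /f /=.
  have [I1 I2] := Gamma_scale a1 (expR_gt0 v).
  have E w : expR v * gauss_dsum m (expR v) * expR (- expR (w + v)) * expR ((a + 1) * w) =
     expR v * gauss_dsum m (expR v) * expR ((a + 1) * w - expR v * expR w).
    by rewrite -mulrA -expRD; congr (_ * expR _); rewrite expRD; ring.
  under eq_integral do rewrite E.
  have I3 := L1Z (expR v * gauss_dsum m (expR v)) I1.
  transitivity (Int mu (fun w => expR v * gauss_dsum m (expR v) * expR ((a + 1) * w - expR v * expR w)))%:E.
    exact: EFin_Int.
  congr EFin.
  rewrite (IntZ _ I1).
  rewrite I2.
  rewrite expRK /jkern.
  have -> : expR (- (a * v)) = expR v * expR (- ((a + 1) * v)).
    by rewrite -expRD; congr expR; ring.
  by ring.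
have F2 w : fubini_G mu f w = (stieltjes m a w)%:E.
  have [I1 I2] := Int_laplace_gauss_dsum m w.
  rewrite /fubini_G /f /=.
  have I3 := L1Z (expR ((a + 1) * w)) I1.
  transitivity (Int mu (fun v => expR ((a + 1) * w) *
      (expR v * gauss_dsum m (expR v) * expR (- expR (w + v)))))%:E.
    rewrite -(EFin_Int I3); apply: eq_integral => v _.
    by rewrite [in RHS]mulrC.
  congr EFin.
  rewrite (IntZ _ I1).
  by rewrite I2.
have s0 w : 0 <= stieltjes m a w.
  rewrite -lee_fin -F2; exact: integral_ge0.
have ms : measurable_fun setT (stieltjes m a).
  by apply: continuous_measurable_fun; exact: stieltjes_continuous.
apply: (@ge0_L1 _ _ _ mu (stieltjes m a) _ _ s0); first exact: ms.
transitivity (\int[mu]_w fubini_G mu f w)%E.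
  by apply: eq_integral => w _; rewrite F2.
rewrite -FT.
have IJ := jkern_L1 a0 am.
have I3 := L1Z (Gamma (a + 1)) IJ.
transitivity (\int[mu]_v (Gamma (a + 1) * jkern m a v)%:E)%E.
  by apply: eq_integral => v _; exact: F1.
rewrite (EFin_Int I3).
congr EFin.
exact: IntZ.
Qed.

Lemma geom_quot n x y : x + y != 0 ->
  x ^+ n / (x + y) = (- y) ^+ n / (x + y) + \sum_(i < n) x ^+ (n.-1 - i) * (- y) ^+ i.
Proof.
move=> xy; apply: (mulIf xy); rewrite mulrDl !divfK//.
have := subrXX x (- y) n; rewrite opprK => H.
by rewrite mulrC -H addrC subrK.
Qed.

(** Powers of y in front of the Cauchy kernel can be traded for powers of
- k^2, because the polynomials in k^2 left over are annihilated. *)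
Lemma dsum_cauchy_pow m n y : (n <= m)%N -> 0 < y ->
  y ^+ n * dsum m (fun k => (y + k ^+ 2)^-1) =
  (-1) ^+ n * dsum m (fun k => k ^+ (2 * n) / (y + k ^+ 2)).
Proof.
move=> nm y0; rewrite -!dsumZ.
rewrite (@eq_dsum _ _ _ (fun k => (-1) ^+ n * (k ^+ (2 * n) / (y + k ^+ 2)) +
  \sum_(i < n) (y ^+ (n.-1 - i) * (-1) ^+ i) * k ^+ (2 * i))).
  rewrite dsumD dsum_sum [X in _ + X]big1 ?addr0// => i _.
  by rewrite dsumZ dsum_exp ?mulr0// -muln2 mulnC ltn_pmul2r// (leq_trans (ltn_ord i)).
move=> k; rewrite geom_quot; last by rewrite gt_eqF// ltr_pwDl// sqr_ge0.
congr (_ + _); first by rewrite -[- k ^+ 2]mulN1r exprMn -exprM mulrA.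
by apply: eq_bigr => i _; rewrite -[- k ^+ 2]mulN1r exprMn -exprM mulrA.
Qed.

(** The translation by ln(k^2) reduces the integral to the Beta function
B(t, 1 - t). *)
Lemma Int_cauchy n t k : 0 < t < 1 ->
  L1 mu (fun w => expR (t * w) * (k ^+ (2 * n.+1) / (expR w + k ^+ 2))) /\
  Int mu (fun w => expR (t * w) * (k ^+ (2 * n.+1) / (expR w + k ^+ 2))) =
  `|k| `^ (2 * (n%:R + t)) * (pi / sin (pi * t)).
Proof.
move=> t01; have /andP[t0 t1] := t01.
have nt : n%:R + t != 0 by rewrite gt_eqF// ltr_wpDl.
have [->|k0] := eqVneq k 0.
  have -> : (fun w => expR (t * w) * (0 ^+ (2 * n.+1) / (expR w + 0 ^+ 2))) = fun=> 0.
    by apply/funext => w; rewrite mulnS addSn exprS !mul0r mulr0.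
  rewrite Int0 normr0 powR0 ?mul0r ?mulf_neq0//; split => //; exact: integrable0.
have k2 : 0 < k ^+ 2 by rewrite exprn_even_gt0.
pose c := `|k| `^ (2 * (n%:R + t)).
pose f w := expR (t * w) * (k ^+ (2 * n.+1) / (expR w + k ^+ 2)).
have fE w : f (w + ln (k ^+ 2)) = c * blog t 1 w.
  rewrite /f /blog expr1 expRD lnK// -[X in _ / X](_ : (1 + expR w) * k ^+ 2 = _); last by ring.
  have -> : c = expR (t * ln (k ^+ 2)) * k ^+ (2 * n).
    rewrite /c mulrDr powRD; last by rewrite normr_eq0 k0 implybT.
    have -> : `|k| `^ (2 * n%:R) = k ^+ (2 * n).
      by rewrite -natrM powR_mulrn// -normrX ger0_norm// exprM exprn_ge0// sqr_ge0.
    rewrite [LHS]mulrC; congr (_ * _).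
    have nk : `|k| != 0 by rewrite normr_eq0.
    have lk : ln (k ^+ 2) = ln `|k| *+ 2.
      by rewrite -real_normK ?num_real// lnXn ?normr_gt0.
    by rewrite lk /powR (negbTE nk) -mulr_natr; congr expR; ring.
  rewrite mulrDr expRD mulnS exprD.
  have w0 : 1 + expR w != 0 by rewrite gt_eqF// addr_gt0// expR_gt0.
  by field; rewrite w0 k0.
have cf : continuous f.
  move=> w; apply: cvgM.
    by apply: continuous_comp; [exact: mulrl_continuous|exact: continuous_expR].
  apply: cvgM; first exact: cvg_cst.
  apply: cvgV; first by rewrite gt_eqF// stieltjes_den_gt0.
  by apply: cvgD; [exact: continuous_expR|exact: cvg_cst].
have f0 w : 0 <= f w.
  by rewrite mulr_ge0 ?expR_ge0// divr_ge0 ?(ltW (stieltjes_den_gt0 _ _))// exprM exprn_ge0// sqr_ge0.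
have Ib : L1 mu (blog t 1) by apply: blog_L1.
apply: ge0_L1 => //; first exact: continuous_measurable_fun.
rewrite (ge0_integral_shift (ln (k ^+ 2)) cf f0).
under eq_integral do rewrite fE.
have I3 := L1Z c Ib.
rewrite (EFin_Int I3); congr EFin.
rewrite (IntZ _ Ib) -(Tbeta_pi t01).
by [].
Qed.

(** The integral of each term of the second difference converges only once the
factor exp((n + 1) w) has been traded for a power of k^2. *)
Lemma Gamma_J_nonint m n t : 0 < t < 1 -> (n < m)%N ->
  Gamma (n%:R + t + 1) * J m (n%:R + t) =
  (-1) ^+ n.+1 * (pi / sin (pi * t)) * dsum m (fun k => `|k| `^ (2 * (n%:R + t))).
Proof.
move=> t01 nm; have /andP[t0 t1] := t01.
have a0 : 0 < n%:R + t by rewrite ltr_wpDl.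
have am : n%:R + t < m%:R.
  by rewrite (@lt_le_trans _ _ n.+1%:R) ?ler_nat// -natr1 ltrD2l.
have [_ <-] := Gamma_J a0 am.
have E w : stieltjes m (n%:R + t) w =
    (-1) ^+ n.+1 * dsum m (fun k => expR (t * w) * (k ^+ (2 * n.+1) / (expR w + k ^+ 2))).
  rewrite /stieltjes (_ : (n%:R + t + 1) * w = t * w + n.+1%:R * w); last by rewrite -natr1; ring.
  by rewrite expRD expRM_natl -mulrA dsum_cauchy_pow ?expR_gt0// mulrCA -dsumZ.
rewrite (_ : stieltjes m (n%:R + t) = fun w => (-1) ^+ n.+1 * dsum m (fun k => expR (t * w) * (k ^+ (2 * n.+1) / (expR w + k ^+ 2)))); last exact/funext.
have I k := Int_cauchy n k t01.
rewrite IntZ; last by apply: L1_dsum => k; exact: (I k).1.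
rewrite Int_dsum; last by move=> k; exact: (I k).1.
rewrite -[RHS]mulrA; congr (_ * _); rewrite -dsumZ; apply: eq_dsum => k.
by rewrite (I k).2 mulrC.
Qed.

Lemma is_derive_sum_seq (I : Type) (s : seq I) (F : I -> R -> R) (G : I -> R) x :
  (forall i, is_derive x (1 : R) (F i) (G i)) ->
  is_derive x (1 : R) (fun y => \sum_(i <- s) F i y) (\sum_(i <- s) G i).
Proof.
move=> dF; elim: s => [|i s IHs].
  rewrite big_nil (_ : (fun y => _) = cst 0); first exact: is_derive_cst.
  by apply/funext => y; rewrite big_nil.
rewrite big_cons (_ : (fun y => _) = fun y => F i y + \sum_(j <- s) F j y).
  exact: (is_deriveD (dF i) IHs).
by apply/funext => y; rewrite big_cons.
Qed.

Lemma is_derive_dsum m (F : R -> R -> R) (G : R -> R) x :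
  (forall k, is_derive x (1 : R) (F k) (G k)) ->
  is_derive x (1 : R) (fun y => dsum m (F ^~ y)) (dsum m G).
Proof.
move=> dF; apply: is_derive_sum_seq => i; apply: is_derive_sum_seq => j.
Qed.

(** At an integer the single terms are not integrable; up to sign, the
second difference of k^(2 n) ln(exp w + k^2) is a primitive of the whole sum,
with limit 0 at +oo and the second difference of 2 k^(2 n) ln |k| at -oo. *)
Lemma Gamma_J_int m n : (0 < n)%N -> (n < m)%N ->
  Gamma (n%:R + 1) * J m n%:R =
  (-1) ^+ n.+1 * 2 * dsum m (fun k => k ^+ (2 * n) * ln `|k|).
Proof.
move=> n0 nm.
have a0 : (0 : R) < n%:R by rewrite ltr0n.
have am : (n%:R : R) < m%:R by rewrite ltr_nat.
have [IS <-] := Gamma_J a0 am.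
have pos w k := stieltjes_den_gt0 w k.
pose F w := (-1) ^+ n * dsum m (fun k => k ^+ (2 * n) * ln (expR w + k ^+ 2)).
have E w : stieltjes m n%:R w =
    (-1) ^+ n * dsum m (fun k => k ^+ (2 * n) * (expR w / (expR w + k ^+ 2))).
  rewrite /stieltjes mulrDl mul1r expRD expRM_natl mulrAC dsum_cauchy_pow ?expR_gt0 1?ltnW//.
  by rewrite -mulrA; congr (_ * _); rewrite mulrC -dsumZ; apply: eq_dsum => k; ring.
have dF w : is_derive w (1 : R) F (stieltjes m n%:R w).
  rewrite E.
  have dk k : is_derive w (1 : R) (fun w => k ^+ (2 * n) * ln (expR w + k ^+ 2))
      (k ^+ (2 * n) * (expR w / (expR w + k ^+ 2))).
    have d1 : is_derive w (1 : R) (fun w => expR w + k ^+ 2) (expR w).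
      by apply: is_derive_eq; rewrite /GRing.scale/=; ring.
    have d2 := @is_derive1_comp _ (@ln R) _ w _ _ (is_derive1_ln (pos w k)) d1.
    have d3 : is_derive w (1 : R) (fun w => ln (expR w + k ^+ 2))
      ((expR w + k ^+ 2)^-1 * expR w) by [].
    by apply: is_derive_eq; rewrite /GRing.scale/=; ring.
  have d := is_derive_dsum m dk.
  by apply: is_derive_eq; rewrite /GRing.scale/=; ring.
have z : dsum m (fun k => k ^+ (2 * n)) = 0 :> R by rewrite dsum_exp// -muln2 mulnC ltn_pmul2r.
rewrite (@Int_derive _ _ F ((-1) ^+ n * dsum m (fun k => k ^+ (2 * n) * (2 * ln `|k|))) 0 IS _ dF).
- have -> : dsum m (fun k => k ^+ (2 * n) * (2 * ln `|k|)) =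
      2 * dsum m (fun k => k ^+ (2 * n) * ln `|k|).
    by rewrite -dsumZ; apply: eq_dsum => k; ring.
  by rewrite exprS; ring.
- exact: stieltjes_continuous.
- apply: cvgM; first exact: cvg_cst.
  apply: cvg_dsum => k; have [->|k0] := eqVneq k 0.
    rewrite expr0n muln_eq0/= eqn0Ngt n0 mul0r.
    by under eq_fun do rewrite mul0r; exact: cvg_cst.
  apply: cvgM; first exact: cvg_cst.
  have k2 : 0 < k ^+ 2 by rewrite exprn_even_gt0.
  rewrite (_ : 2 * ln `|k| = ln (0 + k ^+ 2)); last first.
    by rewrite add0r -real_normK ?num_real// lnXn ?normr_gt0// mulr_natl.
  apply: (@cvg_comp _ _ _ (fun w => expR w + k ^+ 2) (@ln R) _ (nbhs (0 + k ^+ 2))).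
    by apply: cvgD; [exact: cvgNy_expR|exact: cvg_cst].
  by apply: continuous_ln; rewrite add0r.
- have FE w : F w = (-1) ^+ n * dsum m (fun k => k ^+ (2 * n) * ln (1 + k ^+ 2 * expR (- w))).
    rewrite /F -[X in _ * X](subr0) -[X in _ - X](mulr0 w) -z -dsumZ -dsumB.
    congr (_ * _); apply: eq_dsum => k; rewrite mulrC [w * _]mulrC.
    have -> : 1 + k ^+ 2 * expR (- w) = (expR w + k ^+ 2) * expR (- w).
      by rewrite mulrDl -expRD subrr expR0.
    by rewrite lnM ?posrE ?expR_gt0 ?pos// expRK; ring.
  rewrite (_ : F = fun w => (-1) ^+ n * dsum m (fun k => k ^+ (2 * n) * ln (1 + k ^+ 2 * expR (- w)))); last exact/funext.
  rewrite -[X in _ --> X](mulr0 ((-1) ^+ n)); apply: cvgM; first exact: cvg_cst.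
  rewrite -[X in _ --> X](_ : dsum m (fun k => k ^+ (2 * n) * ln (1 + k ^+ 2 * 0)) = 0); last first.
    rewrite (@eq_dsum _ _ _ (fun k => 0 * k ^+ (2 * n))) ?dsumZ ?mul0r// => k.
    by rewrite mulr0 addr0 ln1 mulr0 mul0r.
  apply: cvg_dsum => k; apply: cvgM; first exact: cvg_cst.
  apply: (@cvg_comp _ _ _ (fun w => 1 + k ^+ 2 * expR (- w)) (@ln R) _ (nbhs (1 + k ^+ 2 * 0))).
    by apply: cvgD; [exact: cvg_cst|apply: cvgM; [exact: cvg_cst|exact: cvgr_expR]].
  by apply: continuous_ln; rewrite mulr0 addr0.
Qed.

Lemma sinDnpi n x : sin (x + n%:R * pi) = (-1) ^+ n * sin x.
Proof.
elim: n => [|n IHn]; first by rewrite mul0r addr0 mul1r.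
by rewrite -natr1 mulrDl mul1r addrA sinDpi IHn exprS mulN1r mulNr.
Qed.

(** The principal irregular term of the Matern function has the second
differences that the expansion at 0 requires. The integer and the remaining
exponents are treated separately, as in the definition of G. *)
Lemma dsum_maternG m a : 0 < a -> a < m%:R ->
  dsum m (fun k => maternG a `|k|) = J m a / (Gamma a * 4 `^ a).
Proof.
move=> a0 am.
have g0 : Gamma a != 0 by rewrite gt_eqF// Gamma_gt0.
have g1 : Gamma (a + 1) != 0 by rewrite gt_eqF// Gamma_gt0// addr_gt0.
have q0 : 4 `^ a != 0 :> R by rewrite gt_eqF// powR_gt0.
have q2 : 2 `^ (2 * a) = 4 `^ a :> R.
  by rewrite powRrM powR_mulrn//; congr (_ `^ _); rewrite -natrX.
case: (boolP (a \is a Num.int)) => [aint|anint].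
- have [n n0 an] : exists2 n, (0 < n)%N & a = n%:R.
    move: aint a0 => /intrP[[n|n] ->]; last by rewrite ltr0z.
    by exists n => //; rewrite -(ltr0n R).
  subst a; have nm : (n < m)%N by rewrite -(ltr_nat R).
  have q1 : 2 `^ (2 * n%:R - 1) = 4 `^ n%:R / 2 :> R.
    by rewrite powRB ?powRr1 ?q2// pnatr_eq0 implybT.
  have := Gamma_J_int n0 nm => H.
  rewrite (@eq_dsum _ _ _ (fun k => (-1) ^+ n.+1 / (4 `^ n%:R / 2 * Gamma n%:R * Gamma (n%:R + 1)) * (k ^+ (2 * n) * ln `|k|))).
    rewrite dsumZ.
    apply: (mulfI g1); rewrite [RHS]mulrA H.
    move: q0 g0 g1.
    move: (4 `^ _) (Gamma (n%:R + 1)) (Gamma n%:R) (dsum _ _) => q g1 g0 D q_neq0 g0_neq0 g1_neq0.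
    by field; rewrite ?q_neq0 ?g0_neq0 ?g1_neq0.
  move=> k; rewrite /maternG normr_eq0; have [->|k0] := eqVneq k 0.
    by rewrite expr0n muln_eq0/= eqn0Ngt n0 mul0r mulr0.
  have -> : `|k| `^ (2 * n%:R) = k ^+ (2 * n).
    by rewrite -natrM powR_mulrn// -normrX ger0_norm// exprM exprn_ge0// sqr_ge0.
  have -> : Num.floor (n%:R : R) = n by rewrite -[n%:R]/(n%:~R) intrKfloor.
  rewrite aint q1 (_ : Posz n + 1 = n.+1); last by rewrite -addn1 PoszD.
  by rewrite -exprnP mulrA.
- have [n [t [t01 nm an]]] : exists n t, [/\ 0 < t < 1, (n < m)%N & a = n%:R + t].
    have /andP[h1 h2] := truncn_itv (ltW a0).
    exists (Num.truncn a), (a - (Num.truncn a)%:R); split.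
    - rewrite -natr1 in h2; apply/andP; split; last lra.
      rewrite lt_neqAle subr_ge0 h1 andbT eq_sym subr_eq0.
      by apply: contraNneq anint => ->; exact: natr_int.
    - by rewrite -(ltr_nat R) (le_lt_trans h1).
    - by rewrite addrC subrK.
  subst a; have := Gamma_J_nonint t01 nm => H.
  have st : sin (pi * t) != 0.
    rewrite gt_eqF// sin_gt0_pi//; have p0 := @pi_gt0 R; move: t01 => /andP[t0 t1].
    by rewrite mulr_gt0//= gtr_pMr.
  rewrite (@eq_dsum _ _ _ (fun k => - pi / (4 `^ (n%:R + t) * ((-1) ^+ n * sin (pi * t)) * Gamma (n%:R + t) * Gamma (n%:R + t + 1)) * (`|k| `^ (2 * (n%:R + t))))).
    rewrite dsumZ.
    apply: (mulfI g1); rewrite [RHS]mulrA H exprS -signr_odd.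
    move: q0 st g0 g1.
    move: (4 `^ _) (sin _) (Gamma (n%:R + t + 1)) (Gamma (n%:R + t)) (dsum _ _).
    move=> q s g1 g0 D q_neq0 s_neq0 g0_neq0 g1_neq0.
    by case: (odd n); rewrite ?expr0 ?expr1; field; rewrite ?s_neq0 ?q_neq0 ?g0_neq0 ?g1_neq0.
  move=> k; rewrite /maternG normr_eq0 (negbTE anint) q2 mulrDl [n%:R * pi + _]addrC sinDnpi [t * pi]mulrC.
  case: eqVneq => [->|_//].
  by rewrite normr0 powR0 ?mulr0// mulf_neq0// gt_eqF.
Qed.

End Constants.

(** * Decay of the covariance of distant increments *)

Section Decay.
Context {R : realType}.
Local Notation mu := (@lebesgue_measure R).
Implicit Types (a b c u v w x y z t nu k : R) (f g F : R -> R) (n m : nat).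

Lemma is_derive_shift f g c x : is_derive (x + c) (1 : R) f (g (x + c)) ->
  is_derive x (1 : R) (fun y => f (y + c)) (g (x + c)).
Proof.
move=> d; have d1 : is_derive x (1 : R) (fun y : R => y + c) 1.
  by apply: is_derive_eq; rewrite addr0.
by have := @is_derive1_comp _ f (fun y => y + c) x _ _ d d1; rewrite mulr1.
Qed.

Lemma is_derive_dif (s : seq R) f g x : (forall x, is_derive x (1 : R) f (g x)) ->
  is_derive x (1 : R) (dif s f) (dif s g x).
Proof.
move=> df; elim: s x => [|c s IHs] x /=; first exact: df.
have d1 := is_derive_shift (IHs (x + c)).
exact: (is_deriveB d1 (IHs x)).
Qed.

(** The mean value theorem, without assumption on the sign of the increment. *)
Lemma increment_derive f g x y : (forall x, is_derive x (1 : R) f (g x)) ->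
  exists2 c, `|c - y| <= `|x| & f (y + x) - f y = x * g c.
Proof.
move=> df; have cf := is_derive_continuous df.
have [x0|x0|<-] := ltgtP 0 x; last first.
- by exists y; rewrite ?subrr ?normr0// addr0 subrr mul0r.
- have yx : y + x < y by rewrite gtrDl.
  have [|c] := @MVT R f g _ _ yx (fun z _ => df z); first exact: continuous_subspaceT.
  rewrite in_itv/= => /andP[c1 c2] E; exists c.
    by rewrite distrC ger0_norm ?ltr0_norm// ?subr_ge0; lra.
  by rewrite -opprB E; ring.
- have yx : y < y + x by rewrite ltrDl.
  have [|c] := @MVT R f g _ _ yx (fun z _ => df z); first exact: continuous_subspaceT.
  rewrite in_itv/= => /andP[c1 c2] E; exists c.
    by rewrite !gtr0_norm ?subr_gt0//; lra.
  by rewrite E; ring.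
Qed.

(** An iterated difference is bounded by the derivative of the same order on
the set that the steps can reach. *)
Lemma dif_derive_le (s : seq R) (f : nat -> R -> R) y (B : R) :
  (forall i x, is_derive x (1 : R) (f i) (f i.+1 x)) ->
  (forall x, `|x - y| <= \sum_(c <- s) `|c| -> `|f (size s) x| <= B) ->
  `|dif s (f 0%N) y| <= B * \prod_(c <- s) `|c|.
Proof.
elim: s f y => [|c s IHs] f y df fB /=.
  by rewrite big_nil mulr1; apply: fB; rewrite big_nil subrr normr0.
have [z zy ->] := increment_derive c y (fun x => is_derive_dif s x (df 0%N)).
rewrite normrM big_cons mulrCA ler_wpM2l//.
apply: (IHs (fun i => f i.+1)) => x xz.
apply: fB; rewrite big_cons.
have -> : x - y = (z - y) + (x - z) by ring.
by rewrite (le_trans (ler_normD _ _))// lerD.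
Qed.

(** The k-th derivative of x^a exp(- x^2). *)
Fixpoint hermite (k a : nat) x : R :=
  if k is l.+1 then a%:R * hermite l a.-1 x - 2 * hermite l a.+1 x
  else x ^+ a * expR (- x ^+ 2).

Lemma is_derive_hermite i j x : is_derive x (1 : R) (hermite i j) (hermite i.+1 j x).
Proof.
elim: i j => [|i IHi] j /=.
  have d1 := is_derive_exprn j (is_derive_id x (1 : R)).
  have d2 := is_derive_exprn 2 (is_derive_id x (1 : R)).
  have d3 : is_derive x (1 : R) (fun y => expR (- y ^+ 2)) (expR (- x ^+ 2) * - (2 * x)).
    have d4 : is_derive x (1 : R) (fun y => - y ^+ 2) (- (2 * x)).
      by apply: is_derive_eq; rewrite /= expr1 mulr1.
    exact: (is_derive1_comp (f := expR) (g := fun y => - y ^+ 2) _ d4).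
  by apply: is_derive_eq; rewrite /GRing.scale/= [x ^+ j.+1]exprS; ring.
have d1 := IHi j.-1; have d2 := IHi j.+1.
by apply: is_derive_eq; rewrite /GRing.scale/=.
Qed.

Lemma hermite_bound i j : exists2 C, 0 <= C & forall x, `|hermite i j x| <= C * expR (- (x ^+ 2 / 2)).
Proof.
elim: i j => [|i IHi] j /=.
  exists (1 + 2 ^+ j * j`!%:R); first by rewrite addr_ge0// mulr_ge0.
  move=> x; rewrite normrM [X in _ * X]ger0_norm ?expR_ge0//.
  have -> : expR (- x ^+ 2) = expR (- (x ^+ 2 / 2)) * expR (- (x ^+ 2 / 2)).
    by rewrite -expRD; congr expR; field.
  rewrite mulrA ler_wpM2r ?expR_ge0//.
  have y0 : 0 <= x ^+ 2 / 2 by rewrite divr_ge0// sqr_ge0.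
  have := exp_le_fact j y0; have e1 : expR (- (x ^+ 2 / 2)) <= 1 by rewrite expR_le1 oppr_le0.
  have xx : `|x ^+ j| <= 1 + 2 ^+ j * (x ^+ 2 / 2) ^+ j.
    rewrite -exprMn [2 * _](_ : _ = x ^+ 2); last by field.
    by rewrite -exprM mulnC exprM -[_ ^+ 2]real_normK ?num_real//; set z := `|_|; nra.
  move=> h; have e0 := expR_ge0 (- (x ^+ 2 / 2)).
  rewrite (le_trans (ler_wpM2r e0 xx))// mulrDl mul1r lerD//.
  by rewrite -mulrA ler_wpM2l// mulrC.
have [C1 C10 h1] := IHi j.-1; have [C2 C20 h2] := IHi j.+1.
exists (j%:R * C1 + 2 * C2); first by rewrite addr_ge0// mulr_ge0.
move=> x; rewrite (le_trans (ler_normB _ _))// !normrM (ger0_norm (ler0n R j)) (ger0_norm (ler0n R 2)) [leRHS]mulrDl -(mulrA _ C1) -(mulrA _ C2).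
by rewrite lerD// ler_wpM2l.
Qed.

(** Completing the square turns the exponent into - r - (c + d k)^2 with
d^2 = s C; the difference of order 2 m is then bounded by the derivative of
the Gaussian function of the same order. *)
Lemma gauss_quad_dsum m : exists2 K, 0 <= K & forall A B C s, 0 < C -> 0 <= s ->
  B ^+ 2 <= A * C -> 64 * m%:R ^+ 2 * C <= A ->
  `|dsum m (fun k => expR (- ((A + 2 * B * k + C * k ^+ 2) * s)))| <=
  K * (s * C) ^+ m * expR (- (A / 4 * s)).
Proof.
have [K K0 hK] := hermite_bound (m + m) 0; exists K => // A B C s C0 s0 BAC mCA.
have A0 : 0 <= A by rewrite (le_trans _ mCA)// mulr_ge0 ?(ltW C0)// mulr_ge0// sqr_ge0.
set d := Num.sqrt (s * C); have sC : 0 <= s * C by rewrite mulr_ge0// ltW.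
have d2 : d ^+ 2 = s * C by rewrite sqr_sqrtr.
have d0 : 0 <= d by exact: sqrtr_ge0.
set c := d * (B / C); set r := (A - B ^+ 2 / C) * s.
have r0 : 0 <= r by rewrite mulr_ge0// subr_ge0 ler_pdivrMr.
have E k : expR (- ((A + 2 * B * k + C * k ^+ 2) * s)) = expR (- r) * hermite 0 0 (c + d * k).
  rewrite /= mul1r -expRD; congr expR.
  have -> : (c + d * k) ^+ 2 = d ^+ 2 * (B / C + k) ^+ 2 by rewrite /c; ring.
  by rewrite d2 /r; field; exact: lt0r_neq0.
rewrite (eq_dsum m E) dsumZ dsum_affine normrM ger0_norm ?expR_ge0//.
set s' := nseq m d ++ nseq m (- d).
have ss : size s' = (m + m)%N by rewrite size_cat !size_nseq.
have sumE : \sum_(c <- s') `|c| = 2 * m%:R * d.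
  have S n x : \sum_(c <- nseq n x) `|c| = n%:R * `|x|.
    elim: n => [|n IHn]; first by rewrite big_nil mul0r.
    by rewrite /= big_cons IHn -nat1r; ring.
  by rewrite big_cat /= !S normrN ger0_norm//; ring.
have prodE : \prod_(c <- s') `|c| = (s * C) ^+ m.
  have P n x : \prod_(c <- nseq n x) `|c| = `|x| ^+ n.
    elim: n => [|n IHn]; first by rewrite big_nil.
    by rewrite /= big_cons IHn exprS.
  by rewrite big_cat /= !P normrN ger0_norm// -exprMn -expr2 d2.
(* The steps reach points x with |x - c| <= 2 m d, where
   |c (x - c)| is at most s A / 4: this is the purpose of the constant 64. *)
have := @dif_derive_le s' (fun i => hermite i 0) c (K * expR (- (A / 4 * s) + r)).
move=> /(_ (fun i x => is_derive_hermite i 0 x)); rewrite ss sumE prodE => h.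
apply: (@le_trans _ _ (expR (- r) * (K * expR (- (A / 4 * s) + r) * (s * C) ^+ m))).
  rewrite ler_wpM2l ?expR_ge0//; apply: h => x xc.
  rewrite (le_trans (hK x))// ler_wpM2l// ler_expR.
  have c2 : c ^+ 2 = s * B ^+ 2 / C.
    by rewrite /c exprMn d2; field; exact: lt0r_neq0.
  have sA0 : 0 <= s * A by rewrite mulr_ge0.
  have cd : `|c * (x - c)| <= s * A / 4.
    rewrite -ler_sqr ?nnegrE ?divr_ge0// real_normK ?num_real// exprMn c2.
    have x2 : (x - c) ^+ 2 <= 4 * m%:R ^+ 2 * (s * C).
      have := xc; rewrite -ler_sqr ?nnegrE ?mulr_ge0// real_normK ?num_real//.
      by rewrite exprMn d2 => /le_trans; apply; rewrite exprMn le_eqVlt; apply/orP; left; apply/eqP; ring.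
    apply: (@le_trans _ _ (s * B ^+ 2 / C * (4 * m%:R ^+ 2 * (s * C)))).
      by rewrite ler_wpM2l// divr_ge0 ?(ltW C0)// mulr_ge0// sqr_ge0.
    rewrite [leLHS](_ : _ = s ^+ 2 * (4 * m%:R ^+ 2) * B ^+ 2); last by field; exact: lt0r_neq0.
    apply: (@le_trans _ _ (s ^+ 2 * (4 * m%:R ^+ 2) * (A * C))).
      by rewrite ler_wpM2l// mulr_ge0 ?sqr_ge0// mulr_ge0// sqr_ge0.
    rewrite [leLHS](_ : _ = s ^+ 2 * A / 16 * (64 * m%:R ^+ 2 * C)); last by field.
    rewrite [leRHS](_ : _ = s ^+ 2 * A / 16 * A); last by field.
    by rewrite ler_wpM2l// divr_ge0// mulr_ge0// sqr_ge0.
  have x2 : x ^+ 2 = c ^+ 2 + 2 * (c * (x - c)) + (x - c) ^+ 2 by ring.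
  have rE : r = s * A - c ^+ 2 by rewrite c2 /r; field; exact: lt0r_neq0.
  have := sqr_ge0 (x - c); move: cd; rewrite ler_norml => /andP[cd1 cd2].
  by rewrite x2 rE in r0 *; lra.
by rewrite expRD le_eqVlt; apply/orP; left; apply/eqP; rewrite expRN; field; rewrite expR_eq0.
Qed.

(** Off the diagonal the m-fold second difference of the mixture gains the
factor C ^ m, C being the squared length of the step, and loses as many powers
of the squared distance A. *)
Lemma mixt_dsum_decay m nu : 0 < nu -> nu < m%:R ->
  exists2 K, 0 <= K & forall A B C, 0 < C -> B ^+ 2 <= A * C -> 64 * m%:R ^+ 2 * C <= A -> 0 < A ->
  (forall k, 0 <= A + 2 * B * k + C * k ^+ 2) ->
  `|dsum m (fun k => Int mu (mixt nu (A + 2 * B * k + C * k ^+ 2)))| <=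
  K * C ^+ m * A `^ (nu - m%:R).
Proof.
move=> nu0 num; have [K K0 hK] := gauss_quad_dsum m.
have mn0 : 0 < m%:R - nu by rewrite subr_gt0.
exists (K * (Gamma (m%:R - nu) * 4 `^ (m%:R - nu))).
  by rewrite !mulr_ge0// ?powR_ge0// ltW// Gamma_gt0.
move=> A B C C0 BAC mCA A0 y0.
have I k : L1 mu (mixt nu (A + 2 * B * k + C * k ^+ 2)) by exact: mixt_L1.
have A4 : 0 < A / 4 by rewrite divr_gt0.
have [G1 G2] := Gamma_scale mn0 A4.
pose h u := expR ((m%:R - nu) * u - A / 4 * expR u).
have ch : continuous h.
  move=> u; apply: continuous_comp; last exact: continuous_expR.
  apply: cvgB; first exact: mulrl_continuous.
  by apply: cvgM; [exact: cvg_cst|exact: continuous_expR].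
have h0 u : 0 <= h u by exact: expR_ge0.
have chN : continuous (fun u => h (- u)).
  by move=> u; apply: continuous_comp; [exact: opp_continuous|exact: ch].
have IhN : L1 mu (fun u => h (- u)).
  apply: expdec_L1; first exact: continuous_measurable_fun.
  exact/(@expdecN _ h)/gexp_scale_expdec.
rewrite -Int_dsum// (le_trans (le_norm_Int _))//; first exact: L1_dsum.
apply: (@le_trans _ _ (Int mu (fun u => K * C ^+ m * h (- u)))).
  apply: le_Int; [exact/L1_norm/L1_dsum|exact: L1Z|move=> u].
  have -> : dsum m (fun k => mixt nu (A + 2 * B * k + C * k ^+ 2) u) =
      expR (nu * u - expR u) * dsum m (fun k => expR (- ((A + 2 * B * k + C * k ^+ 2) * expR (- u)))).
    by rewrite -dsumZ; apply: eq_dsum => k; rewrite /mixt -expRD.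
  rewrite normrM ger0_norm ?expR_ge0//.
  apply: (@le_trans _ _ (expR (nu * u) * (K * (expR (- u) * C) ^+ m * expR (- (A / 4 * expR (- u)))))).
    apply: ler_pM; rewrite ?expR_ge0//; first by rewrite ler_expR gerBl expR_ge0.
    by apply: hK => //; exact: expR_ge0.
  rewrite /h exprMn -expRM_natl.
  have -> : (m%:R - nu) * - u - A / 4 * expR (- u) = nu * u + m%:R * - u + - (A / 4 * expR (- u)) by ring.
  by rewrite !expRD le_eqVlt; apply/orP; left; apply/eqP; ring.
rewrite (IntZ _ IhN) (Int_oppr ch h0) /h G2.
have -> : expR (- ((m%:R - nu) * ln (A / 4))) = A `^ (nu - m%:R) * 4 `^ (m%:R - nu).
  rewrite /powR gt_eqF// gt_eqF// ln_div ?posrE// -expRD; congr expR; ring.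
by rewrite le_eqVlt; apply/orP; left; apply/eqP; ring.
Qed.

End Decay.

(** * Moments of Gaussian variables *)

Section NormalMoments.
Context {R : realType}.
Local Notation mu := (@lebesgue_measure R).
Implicit Types (a b c u v w x y z t s m : R) (f g F : R -> R) (n k : nat).

(** The density is the Radon-Nikodym derivative of the normal law. *)
Lemma ge0_integral_normal_prob m s f : s != 0 -> measurable_fun setT f -> (forall x, 0 <= f x) ->
  (\int[normal_prob m s]_x (f x)%:E = \int[mu]_x (f x * normal_pdf m s x)%:E)%E.
Proof.
move=> s0 mf f0.
have dom := normal_prob_dominates m s.
have f0' x : (0 <= (f x)%:E)%E by rewrite lee_fin.
rewrite -(@Radon_Nikodym_SigmaFinite.change_of_variables _ _ _ (normal_prob m s) mu dom _ _ f0')//; last exact/measurable_EFinP.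
under [RHS]eq_integral do rewrite EFinM.
apply: ae_eq_integral => //.
- apply: emeasurable_funM; first exact/measurable_EFinP.
  exact: measurable_int (Radon_Nikodym_SigmaFinite.f_integrable dom).
- by apply: emeasurable_funM; apply/measurable_EFinP => //; exact: measurable_normal_pdf.
- apply: ae_eqe_mul2l; apply: integral_ae_eq => //.
  + exact: Radon_Nikodym_SigmaFinite.f_integrable.
  + by apply/measurable_EFinP; exact: measurable_normal_pdf.
  + by move=> E _ mE; rewrite -Radon_Nikodym_SigmaFinite.f_integral.
Qed.

(** The integrand of the k-th centred moment of the normal law. *)
Definition cmono m s k x := (x - m) ^+ k * normal_pdf m s x.

Lemma normal_pdf_center m s x : s != 0 ->
  normal_pdf m s x = normal_peak s * expR (- (x - m) ^+ 2 / (s ^+ 2 *+ 2)).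
Proof. by move=> s0; rewrite normal_pdfE. Qed.

Lemma is_derive_cmono m s k x : s != 0 ->
  is_derive x (1 : R) (cmono m s k) (k%:R * cmono m s k.-1 x - s ^- 2 * cmono m s k.+1 x).
Proof.
move=> s0.
have d0 : is_derive x (1 : R) (fun x => x - m) 1.
  by apply: is_derive_eq; rewrite subr0.
have d1 := is_derive_exprn k d0.
have d2 := is_derive_exprn 2 d0.
have d3 : is_derive x (1 : R) (fun x => - (x - m) ^+ 2 / (s ^+ 2 *+ 2)) (- (x - m) / s ^+ 2).
  by apply: is_derive_eq; rewrite /GRing.scale/= expr1; field; exact: s0.
have d4 := is_derive1_comp (f := expR) (g := fun x => - (x - m) ^+ 2 / (s ^+ 2 *+ 2)) (is_derive_expR _) d3.
have d5 : is_derive x (1 : R) (fun x => expR (- (x - m) ^+ 2 / (s ^+ 2 *+ 2)))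
   (expR (- (x - m) ^+ 2 / (s ^+ 2 *+ 2)) * (- (x - m) / s ^+ 2)) by [].
rewrite /cmono (_ : (fun y => _) = fun y => (y - m) ^+ k * (normal_peak s * expR (- (y - m) ^+ 2 / (s ^+ 2 *+ 2)))); last first.
  by apply/funext => y; rewrite normal_pdf_center.
apply: is_derive_eq; rewrite /GRing.scale/= !normal_pdf_center// [_ ^+ k.+1]exprS.
by set E := expR _; field; exact: s0.
Qed.

Lemma cmono_continuous m s k : s != 0 -> continuous (cmono m s k).
Proof. by move=> s0; apply: is_derive_continuous => x; exact: is_derive_cmono. Qed.

(** One half of the exponent of the Gaussian density absorbs the power of
x - m, and the other half beats any exponential. *)
Lemma cmono_expdec m s k : s != 0 -> expdec (cmono m s k).
Proof.
move=> s0; have s2 : 0 < s ^+ 2 by rewrite exprn_even_gt0.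
pose C := 1 + (4 * s ^+ 2) ^+ k * k`!%:R.
have C0 : 0 <= C by rewrite addr_ge0// mulr_ge0// exprn_ge0// mulr_ge0// ltW.
exists (normal_peak s * C * expR (s ^+ 2 + `|m|)), 1; split => // x.
rewrite mulN1r /cmono normal_pdf_center//; set z := x - m.
have y0 : 0 <= z ^+ 2 / (4 * s ^+ 2) by rewrite divr_ge0 ?sqr_ge0// mulr_ge0// ltW.
have -> : expR (- z ^+ 2 / (s ^+ 2 *+ 2)) = expR (- (z ^+ 2 / (4 * s ^+ 2))) * expR (- (z ^+ 2 / (4 * s ^+ 2))).
  by rewrite -expRD; congr expR; field; exact: s0.
set e := expR (- (z ^+ 2 / _)).
have e0 : 0 <= e by exact: expR_ge0.
have e1 : e <= 1 by rewrite expR_le1 oppr_le0.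
have h1 : `|z| ^+ k * e <= C.
  have zz : `|z| ^+ k <= 1 + (z ^+ 2) ^+ k.
    by rewrite -[z ^+ 2]real_normK ?num_real// -exprM mulnC exprM; set y := `|z| ^+ k; nra.
  rewrite (le_trans (ler_wpM2r e0 zz))// mulrDl mul1r lerD//.
  have -> : z ^+ 2 = 4 * s ^+ 2 * (z ^+ 2 / (4 * s ^+ 2)) by field; exact: s0.
  rewrite exprMn -mulrA; apply: ler_wpM2l; first by rewrite exprn_ge0// mulr_ge0// ltW.
  by rewrite mulrC /e; exact: exp_le_fact.
have h2 : e <= expR (s ^+ 2 + `|m|) * expR (- `|x|).
  rewrite /e -expRD ler_expR.
  have : `|x| <= `|z| + `|m| by rewrite -[x](subrK m) ler_normD.
  have : `|z| <= z ^+ 2 / (4 * s ^+ 2) + s ^+ 2.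
    rewrite -[z ^+ 2]real_normK ?num_real//; set y := `|z|.
    have q : 0 < 4 * s ^+ 2 by rewrite pmulr_rgt0.
    rewrite -(ler_pM2r q) [leRHS]mulrDl divfK; last by rewrite gt_eqF.
    have := sqr_ge0 (y - 2 * s ^+ 2); nra.
  lra.
rewrite !normrM normrX (ger0_norm (normal_peak_ge0 s)) (ger0_norm e0).
rewrite [leLHS](_ : _ = normal_peak s * ((`|z| ^+ k * e) * e)); last by ring.
rewrite [leRHS](_ : _ = normal_peak s * (C * (expR (s ^+ 2 + `|m|) * expR (- `|x|)))); last by ring.
by rewrite ler_wpM2l ?normal_peak_ge0// ler_pM// mulr_ge0// exprn_ge0.
Qed.

Lemma cmono_L1 m s k : s != 0 -> L1 mu (cmono m s k).
Proof.
move=> s0; apply: expdec_L1; last exact: cmono_expdec.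
by apply: continuous_measurable_fun; exact: cmono_continuous.
Qed.

Lemma cmoment_rec m s k : s != 0 ->
  Int mu (cmono m s k.+1) = s ^+ 2 * (k%:R * Int mu (cmono m s k.-1)).
Proof.
move=> s0.
have : Int mu (fun x => k%:R * cmono m s k.-1 x - s ^- 2 * cmono m s k.+1 x) = 0.
  apply: (Int_derive0 _ (cmono_expdec m k s0)).
  - apply: expdecD; first exact/expdecZ/cmono_expdec.
    apply: (@expdec_le _ 1 _ (fun x => s ^- 2 * cmono m s k.+1 x)).
      by move=> u; rewrite normrN mul1r.
    exact/expdecZ/cmono_expdec.
  - by move=> x; apply: cvgB; apply: cvgM; by [exact: cvg_cst|exact: cmono_continuous].
  - by move=> x; exact: is_derive_cmono.
rewrite IntB ?(IntZ _ (cmono_L1 _ _ s0)); try exact/L1Z/cmono_L1.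
move=> /eqP; rewrite subr_eq0 => /eqP ->.
by field; exact: s0.
Qed.

Lemma cmoment0 m s : s != 0 -> Int mu (cmono m s 0) = 1.
Proof.
move=> s0; rewrite /Int /Rintegral.
under eq_integral do rewrite /cmono expr0 mul1r.
by rewrite integral_normal_pdf.
Qed.

End NormalMoments.

Section GaussianVar.
Context {disp : measure_display} {T : measurableType disp} {R : realType}.
Variable P : probability T R.
Local Notation mu := (@lebesgue_measure R).
Implicit Types (X : T -> R) (f : R -> R) (m s : R) (k : nat).

Lemma ge0_integral_gaussian X m s f : measurable_fun setT X ->
  (forall A : set R, measurable A -> pushforward P X A = gaussian_law m s A) ->
  measurable_fun setT f -> (forall x, 0 <= f x) ->
  (\int[P]_w (f (X w))%:E =
   if (s == 0)%R then (f m)%:E else \int[mu]_x (f x * normal_pdf m s x)%:E)%E.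
Proof.
move=> mX law mf f0.
transitivity (\int[pushforward P (X : T -> measurableTypeR R)]_x (f x)%:E)%E.
  rewrite ge0_integral_pushforward//.
  - exact/measurable_EFinP.
  - by move=> x _; rewrite lee_fin.
rewrite /gaussian_law in law; case: ifPn law => [/eqP s0|s0] law.
  transitivity (\int[\d_(m : measurableTypeR R)]_x (f x)%:E)%E.
    by apply: eq_measure_integral => A mA _; exact: law.
  by rewrite integral_dirac// ?diracT ?mul1e//; exact/measurable_EFinP.
transitivity (\int[normal_prob m s]_x (f x)%:E)%E.
  by apply: eq_measure_integral => A mA _; exact: law.
exact: ge0_integral_normal_prob.
Qed.

(** f is the difference of the nonnegative functions |f| and |f| - f, to which
the change of variables for nonnegative functions applies. *)
Lemma Int_gaussian X m s f : measurable_fun setT X ->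
  (forall A : set R, measurable A -> pushforward P X A = gaussian_law m s A) ->
  measurable_fun setT f -> (s != 0 -> L1 mu (fun x => f x * normal_pdf m s x)) ->
  L1 P (f \o X) /\
  Int P (f \o X) = if s == 0 then f m else Int mu (fun x => f x * normal_pdf m s x).
Proof.
move=> mX law mf If.
pose l (h : R -> R) := if s == 0 then h m else Int mu (fun x => h x * normal_pdf m s x).
have pos (h : R -> R) : measurable_fun setT h -> (forall x, 0 <= h x) ->
    (s != 0 -> L1 mu (fun x => h x * normal_pdf m s x)) ->
    L1 P (h \o X) /\ Int P (h \o X) = l h.
  move=> mh h0 Ih; apply: ge0_L1; first exact: measurableT_comp.
    by move=> w; exact: h0.
  rewrite (ge0_integral_gaussian mX law mh h0) /l; case: ifPn => // s0.
  exact: EFin_Int (Ih s0).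
pose g x := `|f x| - f x.
have mn : measurable_fun setT (fun x => `|f x|) by exact: measurableT_comp.
have mg : measurable_fun setT g by exact: measurable_funB.
have g0 x : 0 <= g x by rewrite subr_ge0 ler_norm.
have In : s != 0 -> L1 mu (fun x => `|f x| * normal_pdf m s x).
  move=> /If/L1_norm; congr (L1 _ _); apply/funext => x.
  by rewrite normrM (ger0_norm (normal_pdf_ge0 _ _ _)).
have Ig : s != 0 -> L1 mu (fun x => g x * normal_pdf m s x).
  move=> s0; rewrite (_ : (fun x => _) = fun x => `|f x| * normal_pdf m s x - f x * normal_pdf m s x).
    by apply: L1B; [exact: In|exact: If].
  by apply/funext => x; rewrite mulrBl.
have [n1 n2] := pos _ mn (fun x => normr_ge0 _) In.
have [g1 g2] := pos _ mg g0 Ig.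
have fE : f \o X = fun w => `|f (X w)| - g (X w).
  by apply/funext => w; rewrite /g /= opprB addrC subrK.
rewrite fE; split; first exact: L1B n1 g1.
rewrite (IntB n1 g1) n2 g2 /l; case: ifPn => [_|s0]; first by rewrite /g; ring.
rewrite -(IntB (In s0) (Ig s0)); congr (Int mu _); apply/funext => x.
by rewrite /g; ring.
Qed.

(** Integration by parts against the normal density; the mean parameter of the
law is identified with the expectation, and a degenerate law is treated apart. *)
Lemma gaussian_moments X : gaussian_var P X -> ('E_P[X] = 0)%E ->
  (forall k, L1 P (fun w => X w ^+ k)) /\
  (forall k, Int P (fun w => X w ^+ k.+2) =
     k.+1%:R * Int P (fun w => X w ^+ 2) * Int P (fun w => X w ^+ k)).
Proof.
move=> [mX [m [s [s0 law]]]] EX.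
have M k : L1 P (fun w => (X w - m) ^+ k) /\ Int P (fun w => (X w - m) ^+ k) =
    if s == 0 then 0 ^+ k else Int mu (cmono m s k).
  have mf : measurable_fun setT (fun x : R => (x - m) ^+ k).
    by apply: measurable_funX; exact: measurable_funB.
  have [|I1 I2] := Int_gaussian mX law mf.
    by move=> sn0; exact: cmono_L1.
  by split => //; rewrite I2 subrr.
have m0 : m = 0.
  have [I1 I2] := M 1%N.
  have z : Int P (fun w => (X w - m) ^+ 1) = 0.
    by rewrite I2; case: ifPn => // sn0; rewrite cmoment_rec// mul0r mulr0.
  have Ic : L1 P (fun=> m) by exact: finite_measure_integrable_cst.
  have EI : Int P X = 0 by rewrite /Int /Rintegral; move: EX; rewrite unlock => ->.
  have : Int P (fun w => (X w - m) ^+ 1 + m) = m.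
    rewrite (IntD I1 Ic) z add0r /Int Rintegral_cst//.
    have /= -> := probability_setT P.
    by rewrite mulr1.
  by under eq_fun do rewrite expr1 subrK; rewrite EI.
rewrite m0 in M.
have E k : (fun w => (X w - 0) ^+ k) = fun w => X w ^+ k.
  by apply/funext => w; rewrite subr0.
have {}M k := M k; have M' k : L1 P (fun w => X w ^+ k) /\ Int P (fun w => X w ^+ k) =
    if s == 0 then 0 ^+ k else Int mu (cmono 0 s k) by rewrite -E.
split=> k; first exact: (M' k).1.
rewrite !(M' _).2; case: ifPn => sn0; first by rewrite !exprS !mul0r mulr0 mul0r.
rewrite cmoment_rec//= [Int mu (cmono 0 s 2)]cmoment_rec//= cmoment0//.
by ring.
Qed.

End GaussianVar.

Section AllMoments.
Context {disp : measure_display} {T : measurableType disp} {R : realType}.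
Variable P : probability T R.
Implicit Types (f g : T -> R) (k n : nat).

(** The functions with moments of all orders form an algebra, which contains
all the products of Gaussian variables met below. *)
Definition allmom f := measurable_fun setT f /\ forall k, L1 P (fun w => `|f w| ^+ k).

Lemma allmom_L1 f : allmom f -> L1 P f.
Proof.
move=> [mf If]; apply: (le_L1 mf _ (If 1%N)) => w.
by rewrite expr1.
Qed.

Lemma allmom_cst (a : R) : allmom (fun=> a).
Proof.
split; first exact: measurable_cst.
by move=> k; exact: finite_measure_integrable_cst.
Qed.

(** The inequality 2 |a b| <= a^2 + b^2. *)
Lemma allmomM f g : allmom f -> allmom g -> allmom (fun w => f w * g w).
Proof.
move=> [mf If] [mg Ig]; split; first exact: measurable_funM.
move=> k; apply: (le_L1 _ _ (L1D (If (k * 2)%N) (Ig (k * 2)%N))).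
  by apply: measurable_funX; apply: measurableT_comp => //; exact: measurable_funM.
move=> w; rewrite normrX normr_id normrM exprMn !exprM.
set a := `|f w| ^+ k; set b := `|g w| ^+ k.
have := sqr_ge0 (a - b); have := sqr_ge0 a; have := sqr_ge0 b; nra.
Qed.

Lemma allmomD f g : allmom f -> allmom g -> allmom (fun w => f w + g w).
Proof.
move=> [mf If] [mg Ig]; split; first exact: measurable_funD.
move=> k; apply: (le_L1 _ _ (L1Z (2 ^+ k) (L1D (If k) (Ig k)))).
  by apply: measurable_funX; apply: measurableT_comp => //; exact: measurable_funD.
move=> w; rewrite normrX normr_id.
wlog fg : f g mf mg If Ig / `|f w| <= `|g w|.
  move=> H; have [/H|/ltW/H] := leP `|f w| `|g w|; first exact.
  by rewrite addrC [X in _ -> _ <= _ * X]addrC; exact.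
apply: (@le_trans _ _ ((2 * `|g w|) ^+ k)).
  rewrite lerXn2r ?nnegrE ?mulr_ge0// (le_trans (ler_normD _ _))//.
  by rewrite mulr_natl mulr2n lerD2r.
by rewrite exprMn ler_wpM2l ?exprn_ge0// lerDr exprn_ge0.
Qed.

Lemma allmomZ (a : R) f : allmom f -> allmom (fun w => a * f w).
Proof. by move=> Mf; apply: allmomM => //; exact: allmom_cst. Qed.

Lemma allmomB f g : allmom f -> allmom g -> allmom (fun w => f w - g w).
Proof.
move=> Mf Mg; have := allmomD Mf (allmomZ (-1) Mg).
by under eq_fun do rewrite mulN1r.
Qed.

Lemma allmom_sum (J : Type) (s : seq J) (F : J -> T -> R) :
  (forall j, allmom (F j)) -> allmom (fun w => \sum_(j <- s) F j w).
Proof.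
move=> MF; elim: s => [|j s IHs].
  by under eq_fun do rewrite big_nil; exact: allmom_cst.
by under eq_fun do rewrite big_cons; exact: allmomD.
Qed.

Lemma allmom_prod (J : Type) (s : seq J) (F : J -> T -> R) :
  (forall j, allmom (F j)) -> allmom (fun w => \prod_(j <- s) F j w).
Proof.
move=> MF; elim: s => [|j s IHs].
  by under eq_fun do rewrite big_nil; exact: allmom_cst.
by under eq_fun do rewrite big_cons; exact: allmomM.
Qed.

Lemma allmomX f k : allmom f -> allmom (fun w => f w ^+ k).
Proof.
move=> Mf; elim: k => [|k IHk]; first exact: allmom_cst.
by under eq_fun do rewrite exprS; exact: allmomM.
Qed.

Lemma is_derive_moment f g n : allmom f -> allmom g ->
  is_derive (0 : R) (1 : R) (fun t => Int P (fun w => (f w + t * g w) ^+ n))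
    (n%:R * Int P (fun w => f w ^+ n.-1 * g w)).
Proof.
move=> Mf Mg.
have I j : L1 P (fun w => f w ^+ (n - j) * g w ^+ j).
  by apply: allmom_L1; apply: allmomM; exact: allmomX.
pose c j := 'C(n, j)%:R * Int P (fun w => f w ^+ (n - j) * g w ^+ j).
have E t : Int P (fun w => (f w + t * g w) ^+ n) = \sum_(j < n.+1) c j * t ^+ j.
  rewrite (_ : (fun w => _) = fun w => \sum_(j < n.+1) ('C(n, j)%:R * t ^+ j) * (f w ^+ (n - j) * g w ^+ j)).
    rewrite Int_sum; last by move=> j; exact: L1Z.
    by apply: eq_bigr => j _; rewrite (IntZ _ (I j)) /c; ring.
  apply/funext => w; rewrite exprDn; apply: eq_bigr => j _.
  by rewrite -mulr_natl exprMn; ring.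
rewrite (_ : (fun t => _) = fun t => \sum_(j < n.+1) c j * t ^+ j); last exact/funext.
have d (j : 'I_n.+1) : is_derive (0 : R) (1 : R) (fun t => c j * t ^+ j) (c j * (j%:R * 0 ^+ j.-1)).
  have d1 := is_derive_exprn j (is_derive_id (0 : R) (1 : R)).
  by apply: is_derive_eq; rewrite /GRing.scale/= mulr1; ring.
have := is_derive_sum_seq (index_enum 'I_n.+1) d.
suff -> : \sum_(j < n.+1) c j * (j%:R * 0 ^+ j.-1) = n%:R * Int P (fun w => f w ^+ n.-1 * g w) by [].
case: n @c {E} d I => [|n] c d I; first by rewrite big_ord1 /= !mul0r mulr0.
rewrite big_ord_recl /= mul0r mulr0 add0r big_ord_recl /= big1 => [|j _].
  by rewrite addr0 /bump/= mul1r /c bin1 subn1/= mulr1.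
by rewrite /bump/= !add1n/= expr0n/= mulr0 mulr0.
Qed.

(** Gaussian integration by parts. The moments of f + t g are polynomials in t,
and their recursion is differentiated at t = 0. *)
Lemma gaussian_ibp f g : allmom f -> allmom g ->
  (forall (t : R) k, Int P (fun w => (f w + t * g w) ^+ k.+2) =
     k.+1%:R * Int P (fun w => (f w + t * g w) ^+ 2) * Int P (fun w => (f w + t * g w) ^+ k)) ->
  forall k, Int P (fun w => f w ^+ k.*2.+1 * g w) =
    k.*2.+1%:R * Int P (fun w => f w * g w) * Int P (fun w => f w ^+ k.*2).
Proof.
move=> Mf Mg H; elim=> [|k IHk].
  rewrite mul1r (_ : (fun w => f w ^+ 0) = fun=> 1)// /Int [in RHS]Rintegral_cst//.
  by have /= -> := probability_setT P; rewrite !mulr1.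
have H0 n : Int P (fun w => (f w + 0 * g w) ^+ n) = Int P (fun w => f w ^+ n).
  by congr (Int P _); apply/funext => w; rewrite mul0r addr0.
have [_ D1] := is_derive_moment k.*2.+4 Mf Mg.
have d2 := is_derive_moment 2 Mf Mg; have dk := is_derive_moment k.*2.+2 Mf Mg.
have [_ D2] : is_derive (0 : R) (1 : R) (fun t => Int P (fun w => (f w + t * g w) ^+ k.*2.+4))
    (k.*2.+3%:R * (2 * Int P (fun w => f w * g w) * Int P (fun w => f w ^+ k.*2.+2) +
     Int P (fun w => f w ^+ 2) * (k.*2.+2%:R * Int P (fun w => f w ^+ k.*2.+1 * g w)))).
  rewrite (_ : (fun t => _) = fun t => k.*2.+3%:R * (Int P (fun w => (f w + t * g w) ^+ 2) *
     Int P (fun w => (f w + t * g w) ^+ k.*2.+2))); last first.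
    by apply/funext => t; rewrite H mulrA.
  apply: is_derive_eq; rewrite /GRing.scale/= !H0; ring.
have := H 0 k.*2; rewrite !H0 => HS.
move: D2; rewrite D1 IHk doubleS/= HS => D2.
apply: (mulfI (x := k.*2.+4%:R)); first by rewrite pnatr_eq0.
rewrite D2 -(@natr1 R k.*2.+3) -(@natr1 R k.*2.+2) -(@natr1 R k.*2.+1); ring.
Qed.

End AllMoments.

(** * Wick's formula and the fourth moment of a centred sum of squares *)

Section Wick.
Context {disp : measure_display} {T : measurableType disp} {R : realType}.
Variable P : probability T R.
Variables (I : finType) (X : I -> T -> R).
Local Notation V := {ffun I -> R}.
Implicit Types (c d v : V) (s : seq V) (a b i : I) (k n : nat).

(** All linear combinations are assumed to have the moments of a centred
Gaussian variable, which is how the X_i are jointly Gaussian. *)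
Definition lin c w := \sum_i c i * X i w.

Hypothesis lin_moments : forall c, (forall k, L1 P (fun w => lin c w ^+ k)) /\
  (forall k, Int P (fun w => lin c w ^+ k.+2) =
     k.+1%:R * Int P (fun w => lin c w ^+ 2) * Int P (fun w => lin c w ^+ k)).

Hypothesis lin_measurable : forall c, measurable_fun setT (lin c).

Lemma linD c d w : lin (c + d) w = lin c w + lin d w.
Proof.
by rewrite /lin -big_split; apply: eq_bigr => i _; rewrite ffunE mulrDl.
Qed.

Lemma allmom_lin c : allmom P (lin c).
Proof.
split; first exact: lin_measurable.
move=> k; have := L1_norm ((lin_moments c).1 k).
by under eq_fun do rewrite normrX.
Qed.

Lemma lin_ibp c d k : Int P (fun w => lin c w ^+ k.*2.+1 * lin d w) =
  k.*2.+1%:R * Int P (fun w => lin c w * lin d w) * Int P (fun w => lin c w ^+ k.*2).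
Proof.
apply: gaussian_ibp => [||t l]; try exact: allmom_lin.
have E w : lin c w + t * lin d w = lin (c + [ffun i => t * d i]) w.
  rewrite linD; congr (_ + _); rewrite /lin mulr_sumr.
  by apply: eq_bigr => i _; rewrite ffunE mulrA.
have EE n : Int P (fun w => (lin c w + t * lin d w) ^+ n) =
    Int P (fun w => lin (c + [ffun i => t * d i]) w ^+ n).
  by congr (Int P _); apply/funext => w; rewrite E.
by rewrite !EE; exact: (lin_moments _).2.
Qed.

Lemma allmom_dif (A : zmodType) (s : seq A) (F : A -> T -> R) y :
  (forall z, allmom P (F z)) -> allmom P (fun w => dif s (F ^~ w) y).
Proof.
move=> MF; elim: s y => [|x s IHs] y /=; first exact: MF.
exact: allmomB (IHs (y + x)) (IHs y).
Qed.

Lemma Int_dif (A : zmodType) (s : seq A) (F : A -> T -> R) y :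
  (forall z, allmom P (F z)) ->
  dif s (fun z => Int P (F z)) y = Int P (fun w => dif s (F ^~ w) y).
Proof.
move=> MF; elim: s y => [|x s IHs] y //=; rewrite !IHs -IntB//;
  exact/allmom_L1/allmom_dif.
Qed.

Lemma dif_lin s (f : R -> R) y w : dif s (fun c => f (lin c w)) y =
  dif (map (lin^~ w) s) f (lin y w).
Proof. by rewrite -[RHS]dif_comp// => c d; rewrite linD. Qed.

(** Polarisation: a product of linear forms is an iterated difference of a
power of one linear form. *)
Lemma dif_lin_exp s y w :
  dif s (fun c => lin c w ^+ size s) y = (size s)`!%:R * \prod_(v <- s) lin v w.
Proof.
rewrite (dif_lin s (fun x => x ^+ size s)) -[in X in dif _ X](size_map (lin^~ w) s).
by rewrite dif_exp// eqxx mul1r size_map big_map.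
Qed.

(** Gaussian integration by parts for powers of a linear form is polarised by
taking as many differences in the form as its degree. *)
Lemma wick_lin d s : odd (size s) ->
  Int P (fun w => lin d w * \prod_(v <- s) lin v w) =
  \sum_(j < size s) Int P (fun w => lin d w * lin s`_j w) *
    Int P (fun w => \prod_(v <- del j s) lin v w).
Proof.
move=> os; set n := size s.
have [k nk] : exists k, n = k.*2.+1.
  by exists n./2; rewrite -[LHS]odd_double_half /n os.
have Ml c m : allmom P (fun w => lin c w ^+ m) by apply: allmomX; exact: allmom_lin.
pose r c := Int P (fun w => lin d w * lin c w).
pose G c := Int P (fun w => lin c w ^+ k.*2).
have rD : {morph r : c e / c + e}.
  have Md c : allmom P (fun w => lin d w * lin c w) by apply: allmomM; exact: allmom_lin.
  move=> c e; rewrite /r -(IntD (allmom_L1 (Md c)) (allmom_L1 (Md e))).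
  by congr (Int P _); apply/funext => w; rewrite linD mulrDr.
have r0 : r 0 = 0.
  by apply: (addIr (r 0)); rewrite -rD !add0r.
have MF c : allmom P (fun w => lin d w * lin c w ^+ n).
  by apply: allmomM; [exact: allmom_lin|exact: Ml].
have dG j y : (j < n)%N -> dif (del j s) G y =
    (k.*2)`!%:R * Int P (fun w => \prod_(v <- del j s) lin v w).
  move=> jn; have sd : size (del j s) = k.*2 by rewrite size_del// -/n nk.
  rewrite Int_dif; last by move=> c; exact: Ml.
  rewrite -IntZ; last by apply: allmom_L1; apply: allmom_prod => v; exact: allmom_lin.
  by congr (Int P _); apply/funext => w; rewrite -sd dif_lin_exp.
have e1 : dif s (fun c => Int P (fun w => lin d w * lin c w ^+ n)) 0 =
    n`!%:R * Int P (fun w => lin d w * \prod_(v <- s) lin v w).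
  rewrite Int_dif// -IntZ; last first.
    apply: allmom_L1; apply: allmomM; first exact: allmom_lin.
    by apply: allmom_prod => v; exact: allmom_lin.
  congr (Int P _); apply/funext => w; rewrite mulrCA -(dif_lin_exp s 0 w) -/n.
  exact: difZ.
have e2 : dif s (fun c => Int P (fun w => lin d w * lin c w ^+ n)) 0 =
    n%:R * dif s (fun c => r c * G c) 0.
  rewrite [LHS](eq_dif _ _ (g := fun c => n%:R * (r c * G c))); last first.
    move=> c /=.
    have -> : Int P (fun w => lin d w * lin c w ^+ n) =
        Int P (fun w => lin c w ^+ k.*2.+1 * lin d w).
      by congr (Int P _); apply/funext => w; rewrite nk mulrC.
    rewrite lin_ibp -mulrA nk; congr (_ * (_ * _)).
    by congr (Int P _); apply/funext => w; rewrite mulrC.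
  exact: difZ.
move: e1; rewrite e2 dif_leibniz// r0 mul0r add0r => e1.
apply: (mulfI (x := n`!%:R)); first by rewrite pnatr_eq0 -lt0n fact_gt0.
rewrite -e1 nk factS natrM -mulrA -nk; congr (_ * _).
rewrite mulr_sumr; apply: eq_bigr => j _.
by rewrite dG// mulrCA.
Qed.

Definition mon (s : seq I) w := \prod_(i <- s) X i w.
(** The covariance matrix of the X_i. *)
Definition rr a b := Int P (fun w => X a w * X b w).

Lemma linE i w : lin [ffun j => (j == i)%:R] w = X i w.
Proof.
rewrite /lin (bigD1 i)//= ffunE eqxx mul1r big1 ?addr0// => j ji.
by rewrite ffunE (negbTE ji) mul0r.
Qed.

Lemma allmomXi i : allmom P (X i).
Proof.
rewrite (_ : X i = lin [ffun j => (j == i)%:R]); first exact: allmom_lin.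
by apply/funext => w; rewrite linE.
Qed.

Lemma allmom_mon (s : seq I) : allmom P (mon s).
Proof. by apply: allmom_prod => i; exact: allmomXi. Qed.

(** Wick's recursion: a variable is paired with each of the others in turn. *)
Lemma wick a (s : seq I) : odd (size s) ->
  Int P (fun w => X a w * mon s w) =
  \sum_(j < size s) rr a (nth a s j) * Int P (mon (del j s)).
Proof.
move=> os; pose e i : V := [ffun j => (j == i)%:R].
have monE t w : mon t w = \prod_(v <- map e t) lin v w.
  by rewrite big_map; apply: eq_bigr => i _; rewrite linE.
have := wick_lin (e a) (s := map e s); rewrite size_map => /(_ os).
have -> : Int P (fun w => lin (e a) w * \prod_(v <- map e s) lin v w) =
    Int P (fun w => X a w * mon s w).
  by congr (Int P _); apply/funext => w; rewrite linE monE.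
move=> ->; apply: eq_bigr => j _; congr (_ * _).
  by congr (Int P _); apply/funext => w; rewrite (nth_map a)// !linE.
by congr (Int P _); apply/funext => w; rewrite monE del_map.
Qed.

(** The centred sum of squares whose fourth moment is to be bounded. *)
Definition csq w := \sum_i (X i w * X i w - rr i i).

Lemma allmom_csq : allmom P csq.
Proof.
apply: allmom_sum => i; apply: allmomB; last exact: allmom_cst.
by apply: allmomM; exact: allmomXi.
Qed.

Lemma rrC a b : rr a b = rr b a.
Proof. by congr (Int P _); apply/funext => w; rewrite mulrC. Qed.

Lemma mon_cons i (s : seq I) w : mon (i :: s) w = X i w * mon s w.
Proof. by rewrite /mon big_cons. Qed.

Let momk a (s : seq I) k := Int P (fun w => X a w * mon s w * csq w ^+ k).
Let mon_csq (s : seq I) k := Int P (fun w => mon s w * csq w ^+ k).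

Let L1_mon_csq (s : seq I) k : L1 P (fun w => mon s w * csq w ^+ k).
Proof.
by apply: allmom_L1; apply: allmomM; [exact: allmom_mon|apply: allmomX; exact: allmom_csq].
Qed.

Let mon_csqS (s : seq I) k :
  mon_csq s k.+1 = \sum_i (mon_csq [:: i, i & s] k - rr i i * mon_csq s k).
Proof.
rewrite /mon_csq.
rewrite (_ : (fun w => _) = fun w => \sum_i (mon [:: i, i & s] w * csq w ^+ k - rr i i * (mon s w * csq w ^+ k))).
  rewrite Int_sum; last by move=> i; apply: L1B => //; exact: L1Z.
  by apply: eq_bigr => i _; rewrite IntB ?IntZ//; exact: L1Z.
apply/funext => w; rewrite exprS mulrCA {1}/csq mulr_suml; apply: eq_bigr => i _.
by rewrite !mon_cons; ring.
Qed.

Let momkS a (s : seq I) k :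
  momk a s k.+1 = \sum_i (momk a [:: i, i & s] k - rr i i * momk a s k).
Proof.
have E t l : momk a t l = mon_csq (a :: t) l.
  by congr (Int P _); apply/funext => w; rewrite mon_cons.
rewrite !E mon_csqS; apply: eq_bigr => i _; rewrite !E; congr (_ - _).
by congr (Int P _); apply/funext => w; rewrite !mon_cons; ring.
Qed.

(** Wick's recursion in the presence of powers of csq. A factor csq contains
two copies of each X_b; pairing X_a with either of them gives the second sum,
and pairing of the two copies with each other is removed by the centring. The
induction on k expands one factor csq. *)
Lemma csq_ibp a (s : seq I) k : odd (size s) ->
  momk a s k = \sum_(j < size s) rr a (nth a s j) * mon_csq (del j s) k +
    (2 * k)%:R * \sum_b rr a b * mon_csq (b :: s) k.-1.
Proof.
elim: k s => [|k IHk] s os.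
  rewrite muln0 mul0r addr0 /momk.
  under eq_fun do rewrite expr0 mulr1.
  rewrite wick//; apply: eq_bigr => j _; congr (_ * _).
  by congr (Int P _); apply/funext => w; rewrite expr0 mulr1.
have perm3 i b l : mon_csq [:: b, i, i & s] l = mon_csq [:: i, i, b & s] l.
  by congr (Int P _); apply/funext => w; rewrite !mon_cons; ring.
pose u i := rr a i * mon_csq (i :: s) k.
pose S i := \sum_(j < size s) rr a (nth a s j) *
  (mon_csq [:: i, i & del j s] k - rr i i * mon_csq (del j s) k).
pose S' i := \sum_b rr a b *
  (mon_csq [:: i, i, b & s] k.-1 - rr i i * mon_csq (b :: s) k.-1).
have step i : momk a [:: i, i & s] k - rr i i * momk a s k =
    2 * u i + S i + (2 * k)%:R * S' i.
  rewrite !IHk//=; last by rewrite negbK.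
  have -> : S i = \sum_(j < size s) rr a (nth a s j) * mon_csq [:: i, i & del j s] k
      - rr i i * \sum_(j < size s) rr a (nth a s j) * mon_csq (del j s) k.
    by rewrite mulr_sumr -sumrB; apply: eq_bigr => j _; ring.
  have -> : S' i = \sum_b rr a b * mon_csq [:: b, i, i & s] k.-1
      - rr i i * \sum_b rr a b * mon_csq (b :: s) k.-1.
    by rewrite mulr_sumr -sumrB; apply: eq_bigr => b _; rewrite perm3; ring.
  rewrite !big_ord_recl /= !del0 /u.
  under [X in _ + (_ + X) + _]eq_bigr do rewrite !del_cons.
  rewrite (_ : del (bump 0 0) _ = i :: s); last by rewrite -[bump 0 0]/1%N del_cons del0.
  by ring.
rewrite momkS (eq_bigr _ (fun i _ => step i)) !big_split/= -!mulr_sumr.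
have -> : \sum_i S i = \sum_(j < size s) rr a (nth a s j) * mon_csq (del j s) k.+1.
  rewrite exchange_big; apply: eq_bigr => j _ /=.
  by rewrite mon_csqS mulr_sumr.
have -> : (2 * k)%:R * \sum_i S' i = (2 * k)%:R * \sum_b u b :> R.
  case: k @u @S @S' {IHk perm3 step} => [|k] u S S'; first by rewrite !mul0r.
  congr (_ * _); rewrite exchange_big; apply: eq_bigr => b _ /=.
  by rewrite /u mon_csqS mulr_sumr.
by rewrite mulnS natrD; ring.
Qed.

Local Notation E f := (Int P f).
Local Notation p2 := (\sum_i \sum_b rr i b ^+ 2).

Lemma Int_csqS k : E (fun w => csq w ^+ k.+1) =
  (2 * k)%:R * \sum_i \sum_b rr i b * E (fun w => X i w * X b w * csq w ^+ k.-1).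
Proof.
have -> : E (fun w => csq w ^+ k.+1) = mon_csq [::] k.+1.
  by congr (Int P _); apply/funext => w; rewrite /mon big_nil mul1r.
rewrite mon_csqS mulr_sumr; apply: eq_bigr => i _.
have -> : mon_csq [:: i; i] k = momk i [:: i] k.
  by congr (Int P _); apply/funext => w; rewrite mon_cons.
rewrite csq_ibp// big_ord1 /= del0 addrAC subrr add0r; congr (_ * _).
apply: eq_bigr => b _; congr (_ * Int P _); apply/funext => w.
by rewrite !mon_cons /mon big_nil; ring.
Qed.

Lemma Int_pair_csq a (c : I) k : E (fun w => X a w * X c w * csq w ^+ k) =
  rr a c * E (fun w => csq w ^+ k) +
  (2 * k)%:R * \sum_b rr a b * E (fun w => X b w * X c w * csq w ^+ k.-1).
Proof.
have -> : E (fun w => X a w * X c w * csq w ^+ k) = momk a [:: c] k.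
  by congr (Int P _); apply/funext => w; rewrite mon_cons /mon big_nil mulr1.
rewrite csq_ibp// big_ord1 /= del0; congr (_ * Int P _ + _ * _).
  by apply/funext => w; rewrite /mon big_nil mul1r.
apply: eq_bigr => b _; congr (_ * Int P _); apply/funext => w.
by rewrite !mon_cons /mon big_nil; ring.
Qed.

Lemma Int_csq0 : E (fun w => csq w ^+ 0) = 1.
Proof.
rewrite (_ : (fun w => csq w ^+ 0) = fun=> 1)// /Int Rintegral_cst//.
by have /= -> := probability_setT P; rewrite mulr1.
Qed.

Lemma Int_csq1 : E (fun w => csq w ^+ 1) = 0.
Proof. by rewrite Int_csqS mul0r. Qed.

Lemma Int_pair0 a (c : I) : E (fun w => X a w * X c w * csq w ^+ 0) = rr a c.
Proof. by rewrite Int_pair_csq Int_csq0 mul0r addr0 mulr1. Qed.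

Lemma Int_csq2 : E (fun w => csq w ^+ 2) = 2 * p2.
Proof.
rewrite Int_csqS; congr (_ * _); apply: eq_bigr => i _; apply: eq_bigr => b _.
by rewrite Int_pair0.
Qed.

(** Wick's formula gives 12 (tr r^2)^2 + 48 tr r^4 for the covariance matrix r,
and tr r^4 is at most (tr r^2)^2. *)
Lemma Int_csq4_le : E (fun w => csq w ^+ 4) <= 60 * p2 ^+ 2.
Proof.
rewrite Int_csqS.
under eq_bigr => i _ do under eq_bigr => b _ do
  (rewrite Int_pair_csq; under eq_bigr => c _ do
    (rewrite Int_pair_csq Int_csq1 mulr0 add0r; under eq_bigr => e _ do rewrite Int_pair0);
   rewrite Int_csq2).
pose t i b (c e : I) : R := rr i b * rr i c * rr c e * rr e b.
have -> : (2 * 3)%:R * \sum_i \sum_b rr i b * (rr i b * (2 * p2) +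
    (2 * 2)%:R * \sum_c rr i c * ((2 * 1)%:R * \sum_e rr c e * rr e b)) =
   12 * p2 ^+ 2 + 48 * \sum_i \sum_b \sum_c \sum_e t i b c e.
  have -> : 12 * p2 ^+ 2 = \sum_i \sum_b 12 * p2 * rr i b ^+ 2.
    rewrite expr2 mulrA mulr_sumr; apply: eq_bigr => i _; exact: mulr_sumr.
  rewrite [LHS]mulr_sumr [48 * _]mulr_sumr -big_split; apply: eq_bigr => i _ /=.
  rewrite [LHS]mulr_sumr [48 * _]mulr_sumr -big_split; apply: eq_bigr => b _ /=.
  rewrite !mulrDr; congr (_ + _); first by ring.
  rewrite !mulr_sumr; apply: eq_bigr => c _ /=.
  rewrite !mulr_sumr; apply: eq_bigr => e _ /=.
  by rewrite /t; ring.
suff : \sum_i \sum_b \sum_c \sum_e t i b c e <= p2 ^+ 2 by lra.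
have h1 : p2 ^+ 2 = \sum_i \sum_b \sum_c \sum_e rr i b ^+ 2 * rr c e ^+ 2.
  rewrite expr2 mulr_suml; apply: eq_bigr => i _; rewrite mulr_suml; apply: eq_bigr => b _.
  rewrite mulr_sumr; apply: eq_bigr => c _; exact: mulr_sumr.
have h2 : p2 ^+ 2 = \sum_i \sum_b \sum_c \sum_e rr i c ^+ 2 * rr e b ^+ 2.
  rewrite h1; apply: eq_bigr => i _; rewrite [RHS]exchange_big; apply: eq_bigr => b _ /=.
  by apply: eq_bigr => c _; apply: eq_bigr => e _; rewrite [rr e c]rrC.
have -> : p2 ^+ 2 = \sum_i \sum_b \sum_c \sum_e 2^-1 * (rr i b ^+ 2 * rr c e ^+ 2 + rr i c ^+ 2 * rr e b ^+ 2).
  transitivity (2^-1 * (p2 ^+ 2 + p2 ^+ 2)); first by lra.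
  rewrite [X in _ * (X + _)]h1 [X in _ * (_ + X)]h2 -big_split/= mulr_sumr.
  apply: eq_bigr => i _; rewrite -big_split/= mulr_sumr; apply: eq_bigr => b _.
  rewrite -big_split/= mulr_sumr; apply: eq_bigr => c _.
  by rewrite -big_split/= mulr_sumr.
apply: ler_sum => i _; apply: ler_sum => b _; apply: ler_sum => c _; apply: ler_sum => e _.
by rewrite /t; have := sqr_ge0 (rr i b * rr c e - rr i c * rr e b); rewrite sqrrB !exprMn; lra.
Qed.

End Wick.

(** * The linear span of a Gaussian field *)

Section GaussianSpan.
Context {disp : measure_display} {T : measurableType disp} {R : realType}.
Variables (P : probability T R) (I : Type) (Y : I -> T -> R).
Implicit Types (f g : T -> R) (k n : nat).

(** In this class every variable is Gaussian with mean 0, and its moments are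
those of the normal law. *)
Definition linspan f := exists s : seq (R * I), forall w, f w = \sum_(x <- s) x.1 * Y x.2 w.

Lemma span_val t : linspan (Y t).
Proof. by exists [:: (1, t)] => w; rewrite big_seq1 mul1r. Qed.

Lemma spanD f g : linspan f -> linspan g -> linspan (fun w => f w + g w).
Proof. by move=> [s fs] [u gu]; exists (s ++ u) => w; rewrite big_cat /= fs gu. Qed.

Lemma spanZ a f : linspan f -> linspan (fun w => a * f w).
Proof.
move=> [s fs]; exists [seq (a * x.1, x.2) | x <- s] => w.
by rewrite big_map fs mulr_sumr; apply: eq_bigr => x _; rewrite mulrA.
Qed.

Lemma spanB f g : linspan f -> linspan g -> linspan (fun w => f w - g w).
Proof.
by move=> sf sg; have := spanD sf (spanZ (-1) sg); under eq_fun do rewrite mulN1r.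
Qed.

Lemma span0 : linspan (fun=> 0).
Proof. by exists [::] => w; rewrite big_nil. Qed.

Lemma span_sum (J : Type) (s : seq J) (F : J -> T -> R) :
  (forall j, linspan (F j)) -> linspan (fun w => \sum_(j <- s) F j w).
Proof.
move=> sF; elim: s => [|j s IHs].
  by under eq_fun do rewrite big_nil; exact: span0.
by under eq_fun do rewrite big_cons; exact: spanD.
Qed.

Hypothesis gY : gaussian_field P Y.
Hypothesis Y0 : forall t, ('E_P[Y t] = 0)%E.

Lemma span_gaussian f : linspan f -> gaussian_var P f.
Proof.
move=> [s fs]; have := gY (fun i => (tnth (in_tuple s) i).2) (fun i => (tnth (in_tuple s) i).1).
rewrite (_ : (fun w => _) = f)//; apply/funext => w.
by rewrite fs [RHS]big_tnth.
Qed.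

Lemma L1_field t : L1 P (Y t).
Proof.
exact: ((gaussian_moments (span_gaussian (span_val t)) (Y0 t)).1 1%N).
Qed.

Lemma Int_field t : Int P (Y t) = 0.
Proof.
by have := Y0 t; rewrite unlock (EFin_Int (L1_field t)) => -[].
Qed.

Lemma span_mean f : linspan f -> ('E_P[f] = 0)%E.
Proof.
move=> [s fs]; have -> : f = fun w => \sum_(x <- s) x.1 * Y x.2 w by apply/funext.
rewrite unlock.
have Ix (x : R * I) : L1 P (fun w => x.1 * Y x.2 w) := L1Z x.1 (L1_field x.2).
rewrite (EFin_Int (L1_sum s Ix)) Int_sum// big1// => x _.
by rewrite (IntZ _ (L1_field _)) Int_field mulr0.
Qed.

Lemma span_measurable f : linspan f -> measurable_fun setT f.
Proof. by case/span_gaussian. Qed.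

Lemma span_moments f : linspan f -> (forall k, L1 P (fun w => f w ^+ k)) /\
  forall k, Int P (fun w => f w ^+ k.+2) =
     k.+1%:R * Int P (fun w => f w ^+ 2) * Int P (fun w => f w ^+ k).
Proof. by move=> sf; apply: gaussian_moments; [exact: span_gaussian|exact: span_mean]. Qed.

Lemma span_allmom f : linspan f -> allmom P f.
Proof.
move=> sf; split; first exact: span_measurable.
move=> k; have := L1_norm ((span_moments sf).1 k).
by under eq_fun do rewrite normrX.
Qed.

Lemma span_L1M f g : linspan f -> linspan g -> L1 P (fun w => f w * g w).
Proof. by move=> sf sg; apply/allmom_L1/allmomM; exact: span_allmom. Qed.

Lemma span_covariance s t : covariance P (Y s) (Y t) = (Int P (fun w => Y s w * Y t w))%:E.
Proof.
have := span_L1M (span_val s) (span_val t) => Ist.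
rewrite -(EFin_Int Ist) unlock !unlock.
have E u : (\int[P]_w (Y u w)%:E)%E = 0%E by rewrite (EFin_Int (L1_field u)) Int_field.
rewrite !E/=; apply: eq_integral => w _ /=; rewrite /cst /=.
by rewrite -[LHS]/((Y s w - 0) * (Y t w - 0))%:E !subr0.
Qed.

End GaussianSpan.

Section Increments.
Context {disp : measure_display} {T : measurableType disp} {R : realType}.
Variables (P : probability T R) (d : nat) (Y : 'cV[R]_d -> T -> R).
Implicit Types (s t h : 'cV[R]_d) (m : nat).

Lemma iter_increment m h t w :
  iter m (increment h) Y t w =
  \sum_(i < m.+1) (-1) ^+ (m + i) * 'C(m, i)%:R * Y (t + h *+ i) w.
Proof.
rewrite -(dif_nseq m h (Y ^~ w) t).
by elim: m t => [|m IHm] t //=; rewrite [LHS]/(increment _ _ _ _)/= !IHm.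
Qed.

Lemma span_increment m h t : linspan Y (iter m (increment h) Y t).
Proof.
elim: m t => [|m IHm] t /=; first exact: span_val.
exact: spanB (IHm (t + h)) (IHm t).
Qed.

Hypothesis gY : gaussian_field P Y.
Hypothesis Y0 : forall t, ('E_P[Y t] = 0)%E.

(** Increments expand into values of the field, with the coefficients of dsum. *)
Lemma increment_covariance (K : 'cV[R]_d -> R) m h s t :
  (forall s t, covariance P (Y s) (Y t) = (K (s - t))%:E) ->
  Int P (fun w => iter m (increment h) Y s w * iter m (increment h) Y t w) =
  dsum m (fun k => K (s - t + k *: h)).
Proof.
move=> cK.
have IY u v : L1 P (fun w => Y u w * Y v w).
  by apply: (span_L1M gY Y0); exact: span_val.
have KE u v : Int P (fun w => Y u w * Y v w) = K (u - v).
  by have := cK u v; rewrite span_covariance// => -[].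
rewrite (_ : (fun w => _) = fun w => \sum_(i < m.+1) \sum_(j < m.+1)
    dcoef m i j * (Y (s + h *+ i) w * Y (t + h *+ j) w)); last first.
  apply/funext => w; rewrite !iter_increment mulr_suml; apply: eq_bigr => i _.
  rewrite mulr_sumr; apply: eq_bigr => j _; rewrite /dcoef !exprD.
  have ee : (-1) ^+ m * (-1) ^+ m = 1 :> R by rewrite -expr2 sqrr_sign.
  move: ee (Y _ w) (Y _ w) ('C(m, i)%:R : R) ('C(m, j)%:R : R) ((-1) ^+ i : R) ((-1) ^+ j : R).
  move: ((-1) ^+ m : R) => e ee y z a b u v.
  transitivity (e * e * (u * v * a * b * (z * y))); first by ring.
  by rewrite ee mul1r.
rewrite Int_sum; last first.
  by move=> i; apply: L1_sum => j; exact: (L1Z (dcoef m i j) (IY _ _)).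
apply: eq_bigr => i _; rewrite Int_sum; last by move=> j; exact: (L1Z (dcoef m i j) (IY _ _)).
apply: eq_bigr => j _; rewrite (IntZ _ (IY _ _)) KE; congr (_ * K _).
by rewrite scalerBl !scaler_nat opprD addrACA.
Qed.

End Increments.

(** * Increments of the Matern field *)

Section MaternIncrements.
Context {R : realType} (d : nat).
Variables (sigma alpha nu : R).
Local Notation mu := (@lebesgue_measure R).
Implicit Types (u v : 'cV[R]_d) (x y k a b : R) (m n : nat).

Definition dotp u v := \sum_i u i ord0 * v i ord0.

Lemma dotpp_ge0 u : 0 <= dotp u u.
Proof. by apply: sumr_ge0 => i _; rewrite -expr2 sqr_ge0. Qed.

Lemma enorm_sqr u : enorm u ^+ 2 = dotp u u.
Proof. by rewrite sqr_sqrtr ?sumr_ge0// => i _; rewrite sqr_ge0. Qed.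

Lemma enorm_ge0 u : 0 <= enorm u.
Proof. exact: sqrtr_ge0. Qed.

Lemma dotpDZ u v k : dotp (u + k *: v) (u + k *: v) =
  dotp u u + 2 * dotp u v * k + dotp v v * k ^+ 2.
Proof.
rewrite /dotp [2 * _]mulr_sumr !mulr_suml -!big_split/=; apply: eq_bigr => i _.
by rewrite !mxE; ring.
Qed.

Lemma dotp0l v : dotp 0 v = 0.
Proof. by rewrite /dotp big1// => i _; rewrite mxE mul0r. Qed.

Lemma enormZ k v : enorm (k *: v) = `|k| * enorm v.
Proof.
apply/eqP; rewrite -(@eqrXn2 _ 2)// ?mulr_ge0 ?enorm_ge0//.
rewrite exprMn !enorm_sqr real_normK ?num_real// /dotp mulr_sumr.
by apply/eqP; apply: eq_bigr => i _; rewrite !mxE; ring.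
Qed.

Lemma ler_entry_enorm u i : `|u i ord0| <= enorm u.
Proof.
rewrite -(@ler_pXn2r _ 2)// ?nnegrE ?enorm_ge0// enorm_sqr real_normK ?num_real//.
rewrite /dotp (bigD1 i)//= -expr2 lerDl sumr_ge0// => j _.
by rewrite -expr2 sqr_ge0.
Qed.

Hypotheses (alpha0 : 0 < alpha) (nu0 : 0 < nu).

(** In the mixture only the square of the distance occurs, which is a quadratic
polynomial in k. *)
Lemma matern_quad u v k : matern sigma alpha nu (enorm (u + k *: v)) =
  sigma ^+ 2 / Gamma nu * Int mu (mixt nu
    (alpha ^+ 2 / 4 * dotp u u + 2 * (alpha ^+ 2 / 4 * dotp u v) * k + alpha ^+ 2 / 4 * dotp v v * k ^+ 2)).
Proof.
rewrite (matern_mixture _ alpha0 nu0 (enorm_ge0 _)); congr (_ * Int mu (mixt nu _)).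
by rewrite exprMn enorm_sqr dotpDZ; field.
Qed.

(** A nonnegative quadratic polynomial has a nonpositive discriminant; this is
used in place of the Cauchy-Schwarz inequality. *)
Lemma quad_discr a b y : 0 < y -> (forall k, 0 <= a + 2 * b * k + y * k ^+ 2) -> b ^+ 2 <= a * y.
Proof.
move=> y0 /(_ (- b / y)); have -> : a + 2 * b * (- b / y) + y * (- b / y) ^+ 2 = (a * y - b ^+ 2) / y.
  by field; rewrite gt_eqF.
by rewrite pmulr_lge0 ?invr_gt0// subr_ge0.
Qed.

Lemma dsum_matern_decay m : nu < m%:R ->
  exists2 K, 0 <= K & forall u v, 0 < enorm v -> 0 < enorm u ->
    8 * m%:R * enorm v <= enorm u ->
    `|dsum m (fun k => matern sigma alpha nu (enorm (u + k *: v)))| <=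
    K * enorm v ^+ (2 * m) * (enorm u ^+ 2) `^ (nu - m%:R).
Proof.
move=> num; have [K K0 HK] := mixt_dsum_decay nu0 num.
pose q := alpha ^+ 2 / 4; have q0 : 0 < q by rewrite divr_gt0// exprn_gt0.
pose c := sigma ^+ 2 / Gamma nu.
have c0 : 0 <= c by rewrite divr_ge0 ?sqr_ge0// ltW// Gamma_gt0.
exists (c * (K * (q ^+ m * q `^ (nu - m%:R)))).
  apply: mulr_ge0 => //; apply: mulr_ge0 => //; apply: mulr_ge0; last exact: powR_ge0.
  by apply: exprn_ge0; exact: ltW.
move=> u v v0 u0 uv.
rewrite (@eq_dsum _ m _ _ (fun k => matern_quad u v k)) dsumZ normrM (ger0_norm c0).
rewrite -[leRHS]mulrA -[leRHS]mulrA.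
apply: ler_wpM2l => //.
have uu : 0 < dotp u u by rewrite -enorm_sqr exprn_gt0.
have vv : 0 < dotp v v by rewrite -enorm_sqr exprn_gt0.
have pos k : 0 <= q * dotp u u + 2 * (q * dotp u v) * k + q * dotp v v * k ^+ 2.
  have -> : q * dotp u u + 2 * (q * dotp u v) * k + q * dotp v v * k ^+ 2 =
      q * dotp (u + k *: v) (u + k *: v) by rewrite dotpDZ; ring.
  by rewrite mulr_ge0 ?dotpp_ge0// ltW.
have qv : 0 < q * dotp v v by rewrite mulr_gt0.
have := fun h => HK _ _ _ qv (quad_discr qv pos) h (mulr_gt0 q0 uu) pos.
have h : 64 * m%:R ^+ 2 * (q * dotp v v) <= q * dotp u u.
  have -> : 64 * m%:R ^+ 2 * (q * dotp v v) = q * (8 * m%:R * enorm v) ^+ 2.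
    by rewrite -enorm_sqr; ring.
  apply: ler_wpM2l; first exact: ltW.
  by rewrite -enorm_sqr lerXn2r// ?nnegrE ?enorm_ge0// !mulr_ge0// enorm_ge0.
move=> /(_ h) /le_trans; apply.
rewrite -!enorm_sqr powRM ?sqr_ge0//; last exact: ltW.
by rewrite [(q * _) ^+ m]exprMn -exprM le_eqVlt; apply/orP; left; apply/eqP; ring.
Qed.

(** Rescaled by n^(2 nu), the covariance of increments of step v / n at
distance u decays like the (2 nu - 2 m)-th power of n |u|. *)
Lemma scaled_covariance_decay m v : 0 < enorm v -> nu + 2 < m%:R ->
  exists2 K, 0 <= K & forall n u, (0 < n)%N ->
    1 <= n%:R * enorm u -> 8 * m%:R * enorm v <= n%:R * enorm u ->
    `|n%:R `^ (2 * nu) *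
      dsum m (fun k => matern sigma alpha nu (enorm (u + k *: (n%:R^-1 *: v))))| <=
    K / (n%:R * enorm u) ^+ 4.
Proof.
move=> v0 num; have num' : nu < m%:R by apply: lt_trans num; rewrite ltrDl.
have [K K0 HK] := dsum_matern_decay num'.
exists (K * enorm v ^+ (2 * m)); first by rewrite mulr_ge0 ?exprn_ge0 ?enorm_ge0.
move=> n u n0 x1 ux; have n0' : (0 : R) < n%:R by rewrite ltr0n.
have u0 : 0 < enorm u by rewrite -(pmulr_rgt0 _ n0') (lt_le_trans _ x1).
have vn : enorm (n%:R^-1 *: v) = n%:R^-1 * enorm v.
  by rewrite enormZ ger0_norm// invr_ge0 ltW.
have := HK u (n%:R^-1 *: v); rewrite vn mulr_gt0 ?invr_gt0// => /(_ isT u0) H.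
rewrite normrM ger0_norm ?powR_ge0//.
rewrite (le_trans (ler_wpM2l (powR_ge0 _ _) (H _)))//.
  by rewrite mulrCA [leLHS]mulrC ler_pdivrMr// [leRHS]mulrC.
set x := n%:R * enorm u in x1 *.
have -> : n%:R `^ (2 * nu) * (K * (n%:R^-1 * enorm v) ^+ (2 * m) * (enorm u ^+ 2) `^ (nu - m%:R)) =
    K * enorm v ^+ (2 * m) * (x ^+ 2) `^ (nu - m%:R).
  rewrite /x [(n%:R * _) ^+ 2]exprMn [in RHS]powRM ?sqr_ge0// [(n%:R^-1 * _) ^+ _]exprMn.
  have -> : (n%:R ^+ 2 : R) `^ (nu - m%:R) = n%:R `^ (2 * nu) * n%:R^-1 ^+ (2 * m).
    rewrite -[n%:R ^+ 2]powR_mulrn ?ler0n// -powRrM mulrBr powRB; last first.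
      by rewrite (gt_eqF n0') implybT.
    by rewrite -natrM powR_mulrn ?ler0n// exprVn.
  by ring.
apply: ler_wpM2l; first by rewrite mulr_ge0 ?exprn_ge0 ?enorm_ge0.
have x2 : 1 <= x ^+ 2 by rewrite exprn_ege1.
rewrite (le_trans (ler_powR x2 (_ : _ <= - 2%:R)))//.
  by rewrite lerBlDr addrC; apply: ltW; rewrite -subr_gt0 in num *; lra.
by rewrite powRN powR_mulrn ?sqr_ge0// -exprM.
Qed.

End MaternIncrements.

Section Variance.
Context {R : realType} (d : nat).
Variables (sigma alpha nu : R) (M : 'M[R]_d) (h : 'cV[R]_d).
Local Notation mu := (@lebesgue_measure R).
Local Notation v := (M *m h).
Local Notation ca m := (coef_a sigma alpha nu M h m).
Local Notation cb m := (coef_b sigma alpha nu M h m).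
Implicit Types (m n : nat).
Hypotheses (sigma0 : 0 < sigma) (alpha0 : 0 < alpha) (nu0 : 0 < nu) (v0 : 0 < enorm v).

Let c0 := alpha ^+ 2 * enorm v ^+ 2 / 4.
(** The variance of an increment of step h / n is D times a function of
   c0 / n^2. *)
Let D := sigma ^+ 2 / Gamma nu * c0 `^ nu.

Let c0_gt0 : 0 < c0.
Proof. by rewrite divr_gt0// mulr_gt0// exprn_gt0. Qed.

Let D_gt0 : 0 < D.
Proof. by rewrite mulr_gt0 ?powR_gt0// divr_gt0 ?exprn_gt0// Gamma_gt0. Qed.

Let c0_powR a : c0 `^ a * 4 `^ a = alpha `^ (2 * a) * enorm v `^ (2 * a).
Proof.
rewrite -powRM ?ltW// /c0 divfK// powRM ?sqr_ge0//.
by rewrite !powRrM !powR_mulrn ?ltW.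
Qed.

Lemma coef_a_J m : nu < m%:R -> ca m = D * J m nu.
Proof.
move=> num; have := dsum_maternG nu0 num; rewrite /dsum /dcoef /coef_a => ->.
have f4 : (4 : R) `^ nu != 0 by rewrite gt_eqF// powR_gt0.
have Gn : Gamma nu != 0 :> R by rewrite gt_eqF// Gamma_gt0.
rewrite -[sigma ^+ 2 * _ * _]mulrA -c0_powR /D; field.
by rewrite f4 Gn.
Qed.

Lemma coef_a_neq0 m : nu < m%:R -> ca m != 0.
Proof. by move=> num; rewrite coef_a_J// mulf_neq0// gt_eqF// J_gt0. Qed.

Lemma coef_b_J m : nu + 1 < m%:R -> cb m = - (D * c0 * J m (nu + 1)).
Proof.
move=> num; have n1 : 0 < nu + 1 by rewrite addr_gt0.
have := dsum_maternG n1 num; rewrite /dsum /dcoef /coef_b => H.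
under eq_bigr => i _ do under eq_bigr => j _ do rewrite mulrCA.
under eq_bigr => i _ do rewrite -mulr_sumr.
rewrite -mulr_sumr H GammaS//.
have -> : 2 * nu + 2 = 2 * (nu + 1) by ring.
have Gn : Gamma nu != 0 :> R by rewrite gt_eqF// Gamma_gt0.
have f4 : (4 : R) `^ (nu + 1) != 0 by rewrite gt_eqF// powR_gt0.
rewrite -[sigma ^+ 2 * _ * _]mulrA -c0_powR.
have -> : D * c0 = sigma ^+ 2 / Gamma nu * c0 `^ (nu + 1).
  by rewrite powRD ?powRr1 ?ltW ?mulrA// (gt_eqF c0_gt0) implybT.
by field; rewrite f4 Gn gt_eqF.
Qed.

(** The variance, rescaled by n^(2 nu), of an increment of step h / n: it has
the form of the covariance at lag u in scaled_covariance_decay, with u = 0. *)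
Definition scaled_var m n : R := n%:R `^ (2 * nu) *
  dsum m (fun k => matern sigma alpha nu (enorm (0 + k *: (n%:R^-1 *: v)))).

Lemma scaled_varE m n : nu < m%:R -> (0 < n)%N ->
  scaled_var m n = D * Int mu (fun u => expR (- (c0 / n%:R ^+ 2 * expR (- u))) * jkern m nu u).
Proof.
move=> num n0; have n0' : (0 : R) < n%:R by rewrite ltr0n.
pose y := c0 / n%:R ^+ 2.
have y0 : 0 < y by rewrite divr_gt0// exprn_gt0.
rewrite /scaled_var (@eq_dsum _ m _ (fun k => sigma ^+ 2 / Gamma nu * Int mu (mixt nu (k ^+ 2 * y)))).
  rewrite dsumZ dsum_mixt// -/y.
  have -> : y `^ nu = c0 `^ nu / n%:R `^ (2 * nu).
    rewrite /y powRM ?invr_ge0 ?sqr_ge0 ?ltW//; congr (_ * _).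
    by rewrite powRrM powR_mulrn ?ler0n// -powR_inv1 ?sqr_ge0// -powRrM mulN1r powRN.
  by rewrite /D; field; rewrite !gt_eqF// ?powR_gt0// Gamma_gt0.
move=> k; rewrite (matern_quad sigma alpha0 nu0 0 _ k) !dotp0l; congr (_ * Int mu (mixt nu _)).
have := enormZ (n%:R^-1) v => E.
by rewrite -(enorm_sqr (_ *: _)) E exprMn real_normK ?num_real// /y /c0; field; rewrite gt_eqF.
Qed.

(** The expansion of mixt_expansion at y = c0 / n^2. *)
Lemma scaled_var_expansion m : nu + 2 < m%:R -> exists2 K, 0 <= K & forall n, (0 < n)%N ->
  `|n%:R ^+ 2 * (scaled_var m n - ca m) - cb m| <= K / n%:R ^+ 2.
Proof.
move=> num; have num1 : nu + 1 < m%:R by apply: lt_trans num; rewrite ltrD2l ltr1n.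
have num0 : nu < m%:R by apply: lt_trans num1; rewrite ltrDl.
have n2 : 0 < nu + 2 by rewrite addr_gt0.
exists (D * c0 ^+ 2 / 2 * J m (nu + 2)).
  by apply: mulr_ge0; [rewrite divr_ge0// mulr_ge0 ?sqr_ge0// ltW|rewrite ltW// J_gt0].
move=> n n0; have n0' : (0 : R) < n%:R by rewrite ltr0n.
rewrite scaled_varE// coef_a_J// coef_b_J//.
have y0 : 0 < c0 / n%:R ^+ 2 by rewrite divr_gt0// exprn_gt0.
have := mixt_expansion nu0 num y0; set I := Int mu _; set y := c0 / _ => H.
have c0y : c0 = n%:R ^+ 2 * y by rewrite /y mulrC divfK// expf_neq0// gt_eqF.
have -> : n%:R ^+ 2 * (D * I - D * J m nu) - - (D * c0 * J m (nu + 1)) =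
    n%:R ^+ 2 * D * (I - (J m nu - y * J m (nu + 1))) by rewrite c0y; ring.
have nD : 0 <= n%:R ^+ 2 * D by rewrite mulr_ge0 ?sqr_ge0// ltW.
rewrite normrM (ger0_norm nD) (le_trans (ler_wpM2l nD H))//.
rewrite [c0 in leRHS]c0y le_eqVlt; apply/orP; left; apply/eqP.
by field; rewrite gt_eqF.
Qed.

Lemma scaled_var_cvg m : nu + 2 < m%:R ->
  (fun n : nat => n%:R ^+ 2 * (scaled_var m n - ca m)) @ \oo --> cb m.
Proof.
move=> num; have [K K0 HK] := scaled_var_expansion num.
apply/cvgrPdist_le => e e0.
near=> n.
have n0 : (0 < n)%N by near: n; exact: nbhs_infty_gt.
have n0' : (0 : R) < n%:R by rewrite ltr0n.
rewrite distrC (le_trans (HK _ n0))// ler_pdivrMr ?exprn_gt0// -ler_pdivrMl// mulrC.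
apply: (@le_trans _ _ n%:R); first by near: n; exact: nbhs_infty_ger.
by rewrite expr2 ler_peMl// ler1n.
Unshelve. all: end_near. Qed.

Lemma scaled_var_bounded m : nu + 2 < m%:R ->
  exists2 K, 0 <= K & forall n, (0 < n)%N -> `|scaled_var m n| <= K.
Proof.
move=> num; have [K K0 HK] := scaled_var_expansion num.
exists (K + `|cb m| + `|ca m|); first by rewrite !addr_ge0.
move=> n n0; have n0' : (0 : R) < n%:R by rewrite ltr0n.
have n1 : 1 <= n%:R ^+ 2 :> R by rewrite exprn_ege1// ler1n.
have -> : scaled_var m n = (n%:R ^+ 2 * (scaled_var m n - ca m) - cb m) / n%:R ^+ 2 +
    cb m / n%:R ^+ 2 + ca m by field; rewrite gt_eqF.
have small (x : R) : `|x / n%:R ^+ 2| <= `|x|.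
  by rewrite normrM ler_piMr// normfV ger0_norm ?sqr_ge0// invf_le1// (lt_le_trans _ n1).
rewrite (le_trans (ler_normD _ _))// lerD2r (le_trans (ler_normD _ _))// lerD//.
rewrite (le_trans (small _))// (le_trans (HK _ n0))// ler_piMr// invf_le1//.
by rewrite (lt_le_trans _ n1).
Qed.

End Variance.

(** * Weights with bounded sums *)

Section Weights.
Context {R : realType}.
Implicit Types (x y : R) (k K a n : nat).

(** The exponent 3/2 is larger than 1, so that the weights have bounded sums,
and five such weights together have an exponent 15/2 less than 8. *)
Definition weight x : R := Num.sqrt (1 + x) ^- 3.

Lemma weight_ge0 x : 0 <= weight x.
Proof. by rewrite invr_ge0 exprn_ge0// sqrtr_ge0. Qed.

Lemma le_weight x y : 0 <= x -> x <= y -> weight y <= weight x.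
Proof.
move=> x0 xy; have h : 0 < Num.sqrt (1 + x) by rewrite sqrtr_gt0 ltr_pwDl.
have y0 := le_trans x0 xy.
rewrite lef_pV2 ?posrE ?exprn_gt0 ?sqrtr_gt0 ?ltr_pwDl//.
by rewrite lerXn2r ?nnegrE ?sqrtr_ge0// ler_wsqrtr// lerD2l.
Qed.

(** Comparison with the telescoping sum of 2 / sqrt k - 2 / sqrt(k + 1). *)
Lemma weight_sum K : \sum_(0 <= k < K) weight k%:R <= 3.
Proof.
case: K => [|K]; first by rewrite big_geq.
suff : \sum_(0 <= k < K.+1) weight k%:R <= 3 - 2 / Num.sqrt K.+1%:R.
  by move=> /le_trans; apply; rewrite gerBl divr_ge0// sqrtr_ge0.
elim: K => [|K IHK]; first by rewrite big_nat1 /weight addr0 sqrtr1 expr1n invr1; lra.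
rewrite big_nat_recr//=; apply: le_trans (lerD IHK (lexx _)) _.
rewrite /weight; have -> : 1 + K.+1%:R = K.+2%:R :> R by rewrite addrC natr1.
set a := Num.sqrt K.+1%:R; set b := Num.sqrt K.+2%:R.
have a0 : 0 < a by rewrite sqrtr_gt0 ltr0n.
have ab : a <= b by rewrite ler_wsqrtr// ler_nat.
have b0 : 0 < b by exact: lt_le_trans ab.
have e : b ^+ 2 = a ^+ 2 + 1 by rewrite !sqr_sqrtr ?ler0n// natr1.
rewrite -subr_ge0.
have -> : 3 - 2 / b - (3 - 2 / a + b ^- 3) = (2 * b ^+ 2 * (b - a) - a) / (a * b ^+ 3).
  by field; rewrite !gt_eqF.
rewrite divr_ge0//; last by rewrite mulr_ge0 ?exprn_ge0// ltW.
rewrite -(pmulr_rge0 _ (_ : 0 < b + a)) ?addr_gt0//.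
have -> : (b + a) * (2 * b ^+ 2 * (b - a) - a) = 2 * b ^+ 2 * (b ^+ 2 - a ^+ 2) - a * (b + a) by ring.
rewrite [in X in 2 * _ * X]e [X in _ * X](_ : _ = 1); last by ring.
nra.
Qed.

Lemma weight_sum_dist a K : \sum_(0 <= k < K) weight `|a%:R - k%:R| <= 6.
Proof.
have wa : \sum_(0 <= k < a) weight `|a%:R - k%:R| <= 3.
  rewrite big_nat_rev/= add0n; apply: le_trans (weight_sum a).
  rewrite big_nat [leRHS]big_nat; apply: ler_sum => k /andP[_ ka].
  rewrite -natrB ?leq_subr// subKn// ger0_norm ?ler0n//.
  by rewrite le_weight// ler_nat.
have [Ka|/ltnW aK] := leqP K a.
  apply: (@le_trans _ _ 3); last by lra.
  by apply: le_trans wa; rewrite [leRHS](big_cat_nat _ (n := K))//= lerDl sumr_ge0// => k _; exact: weight_ge0.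
rewrite (big_cat_nat _ (n := a))//=.
have -> : 6 = 3 + 3 :> R by lra.
apply: lerD => //; apply: le_trans (weight_sum (K - a)).
rewrite -{1}[a]add0n big_addn; apply: ler_sum => k _.
by rewrite natrD opprD addrCA addrN addr0 normrN ger0_norm.
Qed.

(** The sum over the image of phi is extended to all of the box, where it
factors over the coordinates: five of them give a bounded factor and each of
the e others a factor K. *)
Lemma weight_sum_inj (A : finType) e K (phi : A -> {ffun 'I_(5 + e) -> 'I_K}) (i : A) :
  injective phi ->
  \sum_j \prod_(l < 5) weight `|(phi i (lshift e l))%:R - (phi j (lshift e l))%:R| <= 6 ^+ 5 * K%:R ^+ e.
Proof.
move=> phi_inj.
pose u (l : 'I_(5 + e)) (k : 'I_K) := if (l < 5)%N then weight `|(phi i l)%:R - k%:R| else 1.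
have u0 l (k : 'I_K) : 0 <= u l k by rewrite /u; case: ifP => // _; exact: weight_ge0.
pose G (f : {ffun 'I_(5 + e) -> 'I_K}) := \prod_l u l (f l).
have G0 f : 0 <= G f by apply: prodr_ge0 => l _.
have -> : \sum_j \prod_(l < 5) weight `|(phi i (lshift e l))%:R - (phi j (lshift e l))%:R| =
    \sum_(f in [set phi j | j : A]) G f.
  rewrite big_imset/=; last by move=> x y _ _; exact: phi_inj.
  apply: eq_bigr => j _; rewrite /G big_split_ord/= [X in _ * X]big1 ?mulr1.
    by apply: eq_bigr => l _; rewrite /u /= ltn_ord.
  by move=> l _; rewrite /u /=.
apply: (@le_trans _ _ (\sum_f G f)).
  by rewrite [leRHS](bigID [in [set phi j | j : A]])/= lerDl sumr_ge0.
rewrite -bigA_distr_bigA big_split_ord/=.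
have -> : 6 ^+ 5 * K%:R ^+ e = (\prod_(l < 5) 6) * \prod_(l < e) K%:R :> R.
  by rewrite !prodr_const !card_ord.
apply: ler_pM; try by apply: prodr_ge0 => l _; apply: sumr_ge0.
- apply: ler_prod => l _; rewrite sumr_ge0//=.
  rewrite /u /= ltn_ord -(big_mkord xpredT (fun k => weight `|_ - k%:R|)).
  exact: weight_sum_dist.
- apply: ler_prod => l _; rewrite sumr_ge0//=.
  by rewrite sumr_const card_ord.
Qed.

Lemma inv_pow8_le_weight (t : R) (y : 'I_5 -> R) : 1 <= t ->
  (forall l, 0 <= y l) -> (forall l, 1 + y l <= t) -> t ^- 8 <= \prod_l weight (y l).
Proof.
move=> t1 y0 yt; have t0 : 0 <= t by exact: le_trans t1.
set s := Num.sqrt t; have s1 : 1 <= s by rewrite -sqrtr1 ler_wsqrtr.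
have s0 : 0 < s by exact: lt_le_trans s1.
have -> : t ^- 8 = s ^- 16 by rewrite -[t]sqr_sqrtr// -exprM.
apply: (@le_trans _ _ (\prod_(l < 5) s ^- 3)).
  rewrite prodr_const card_ord exprVn -exprM lef_pV2 ?posrE ?exprn_gt0//.
  exact: ler_weXn2l.
apply: ler_prod => l _; rewrite invr_ge0 exprn_ge0 ?(ltW s0)//=.
rewrite /weight lef_pV2 ?posrE ?exprn_gt0 ?sqrtr_gt0 ?ltr_pwDl ?(lt_le_trans ltr01 t1)//.
by rewrite lerXn2r ?nnegrE ?sqrtr_ge0 ?(ltW s0)// ler_wsqrtr.
Qed.

End Weights.

(** * Counting grid points *)

Section Grid.
Context {R : realType} (d : nat) (Omega : set 'cV[R]_d).
Implicit Types (t : 'cV[R]_d) (n B : nat) (l : 'I_d).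

Lemma bounded_set_entry : bounded_set Omega ->
  exists B : nat, forall t l, Omega t -> `|t l ord0| <= B%:R.
Proof.
move=> [b [breal Hb]]; exists (Num.truncn (b + 1)).+1 => t l Ot.
apply: le_trans (ltW (truncnS_gt _)).
apply: le_trans (Hb (b + 1) _ t Ot); last by rewrite ltrDl.
have /mapP[j Hj ->] : `|t l ord0| \in [seq `|t x.1 x.2| | x : 'I_d * 'I_1].
  by apply/mapP; exists (l, ord0) => //=; rewrite mem_enum.
by rewrite [leRHS]/Num.norm /= mx_normrE; apply/bigmax_geP; right => /=; exists j.
Qed.

(** Grid points are indexed by the integer coordinates of n t, shifted by n B
to make them nonnegative. *)
Definition cell n B t : {ffun 'I_d -> 'I_(2 * n * B).+1} :=
  [ffun l => inord `|(Num.floor (n%:R * t l ord0) + (n * B)%:Z)%R|%N].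

Lemma grid_int n t l : (0 < n)%N -> grid Omega n t ->
  exists z : int, n%:R * t l ord0 = z%:~R.
Proof.
move=> n0 [_ [z _ <-]]; exists (z l ord0).
by rewrite !mxE mulrA divff ?mul1r// pnatr_eq0 -lt0n.
Qed.

Variable B : nat.
Hypothesis HB : forall t l, Omega t -> `|t l ord0| <= B%:R.

Lemma cellE n t l : (0 < n)%N -> grid Omega n t ->
  (cell n B t l)%:R = n%:R * t l ord0 + (n * B)%:R :> R.
Proof.
move=> n0 gt; have [z nz] := grid_int l n0 gt.
have n0' : (0 : R) < n%:R by rewrite ltr0n.
have : `|n%:R * t l ord0| <= (n * B)%:R.
  by rewrite normrM ger0_norm ?ler0n// natrM ler_pM2l// HB//; case: gt.
rewrite ffunE nz intrKfloor ler_norml => /andP[zl zu].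
have z0 : (0 <= z + (n * B)%:Z)%R.
  by rewrite -(ler0z R) intrD -lerBlDr sub0r.
have zB : (`|(z + (n * B)%:Z)%R| < (2 * n * B).+1)%N.
  rewrite ltnS -lez_nat gez0_abs// -(ler_int R) intrD -mulnA mul2n -addnn PoszD intrD.
  by rewrite lerD2r.
by rewrite inordK// -[LHS]/(_%:Z%:~R) gez0_abs// intrD.
Qed.

Lemma cell_inj n t s : (0 < n)%N -> grid Omega n t -> grid Omega n s ->
  cell n B t = cell n B s -> t = s.
Proof.
move=> n0 gt gs e; apply/matrixP => l j; rewrite ord1.
have n0' : n%:R != 0 :> R by rewrite pnatr_eq0 -lt0n.
apply: (mulfI n0'); apply: (addIr (n * B)%:R).
by rewrite -!cellE// e.
Qed.

Lemma grid_finite n : (0 < n)%N -> finite_set (grid Omega n).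
Proof.
move=> n0; pose g (f : {ffun 'I_d -> 'I_(2 * n * B).+1}) : 'cV[R]_d :=
  \col_l (n%:R^-1 * ((f l)%:R - (n * B)%:R)).
apply: (@sub_finite_set _ _ (g @` setT)); last exact/finite_image/finite_finset.
move=> t gt; exists (cell n B t) => //; apply/matrixP => l j; rewrite ord1 mxE cellE//.
by rewrite addrK mulKf// pnatr_eq0 -lt0n.
Qed.

(** Omega contains a ball of radius e for the supremum norm, that is a cube, and
this cube contains k^d grid points with k of order n e. *)
Lemma grid_card_ge : Omega !=set0 -> open Omega ->
  exists2 c : R, 0 < c & exists n0 : nat, forall n, (n0 <= n)%N -> (0 < n)%N ->
    c * n%:R ^+ d <= #|` fset_set (grid Omega n)|%:R.
Proof.
move=> [x Ox] oO.
have /nbhs_ballP[e /= e0 Be] : nbhs x Omega by exact: open_nbhs_nbhs.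
exists ((e / 4) ^+ d); first by rewrite exprn_gt0// divr_gt0.
exists (Num.truncn (4 / e)).+1 => n nn n0; have n0' : (0 : R) < n%:R by rewrite ltr0n.
have ne : 4 <= n%:R * e.
  rewrite -ler_pdivrMr//; apply: (le_trans (ltW (truncnS_gt _))).
  by rewrite ler_nat.
(* Rounding n x costs at most 1, and k + 1 < n e once n e >= 4. *)
pose k := Num.truncn (n%:R * e / 2).
have /andP[k1 k2] : k%:R <= n%:R * e / 2 < k.+1%:R.
  by apply: truncn_itv; rewrite divr_ge0// mulr_ge0// ltW.
rewrite -[k.+1%:R]natr1 in k2.
pose z (f : {ffun 'I_d -> 'I_k}) : 'cV[int]_d := \col_l (Num.floor (n%:R * x l ord0) + (f l)%:Z).
pose g f : 'cV[R]_d := n%:R^-1 *: map_mx intr (z f).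
have gE f l : g f l ord0 = n%:R^-1 * ((Num.floor (n%:R * x l ord0))%:~R + (f l)%:R).
  by rewrite !mxE intrD.
have gg f : grid Omega n (g f).
  split; last by exists (z f).
  apply: Be; split => // l j; rewrite ord1 /ball/= gE.
  have fk : (f l)%:R <= k%:R :> R by rewrite ler_nat ltnW.
  have f0 : 0 <= (f l)%:R :> R by rewrite ler0n.
  have /andP[z1 z2] := floor_itv (n%:R * x l ord0).
  rewrite intrD in z2.
  have -> : x l ord0 - n%:R^-1 * ((Num.floor (n%:R * x l ord0))%:~R + (f l)%:R) =
     n%:R^-1 * (n%:R * x l ord0 - (Num.floor (n%:R * x l ord0))%:~R - (f l)%:R).
    by field; rewrite gt_eqF.
  rewrite normrM gtr0_norm ?invr_gt0// ltr_pdivrMl// ltr_norml.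
  by apply/andP; split; lra.
have fin := grid_finite n0.
have mem f : g f \in fset_set (grid Omega n) by rewrite in_fset_set// inE.
pose G f : fset_set (grid Omega n) := [` mem f]%fset.
have Ginj : injective G.
  move=> f f' /(congr1 val) /= ff'; apply/ffunP => l; apply/val_inj/eqP => /=.
  rewrite -(eqr_nat R); apply/eqP/(addrI (Num.floor (n%:R * x l ord0))%:~R).
  have nV : n%:R^-1 != 0 :> R by rewrite invr_neq0// gt_eqF.
  by apply: (mulfI nV); rewrite -!gE ff'.
have := leq_card _ Ginj; rewrite card_ffun !card_ord -cardfE => kN.
apply: (@le_trans _ _ (k%:R ^+ d)); last by rewrite -natrX ler_nat.
rewrite -exprMn lerXn2r ?nnegrE ?ler0n//.
  by rewrite mulr_ge0// ltW// divr_gt0.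
lra.
Qed.

End Grid.

(** * Almost sure convergence from fourth moments *)

Section AlmostSure.
Context {disp : measure_display} {T : measurableType disp} {R : realType}.
Variable P : probability T R.
Implicit Types (f : T -> R) (n k : nat).

(** Comparison with the telescoping sum of 1 / n - 1 / (n + 1). *)
Lemma sum_invsq_le n : \sum_(k < n) (k.+1%:R ^+ 2)^-1 <= 2 :> R.
Proof.
case: n => [|n]; first by rewrite big_ord0.
suff : \sum_(k < n.+1) (k.+1%:R ^+ 2)^-1 <= 2 - n.+1%:R^-1 :> R.
  by move=> /le_trans; apply; rewrite gerBl.
elim: n => [|n IHn]; first by rewrite big_ord1 expr1n; lra.
rewrite big_ord_recr/=; apply: le_trans (lerD IHn (lexx _)) _.
rewrite -[n.+2%:R]natr1; set x := n.+1%:R; have x0 : 0 < x :> R by rewrite ltr0n.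
rewrite -subr_ge0; have -> : 2 - (x + 1)^-1 - (2 - x^-1 + ((x + 1) ^+ 2)^-1) = (x * (x + 1) ^+ 2)^-1.
  by field; rewrite !gt_eqF// ltr_wpDr.
by rewrite invr_ge0 mulr_ge0 ?sqr_ge0// ltW.
Qed.

(** Summable fourth moments make the sum of the fourth powers integrable, hence
almost surely finite. *)
Lemma ae_cvg0_of_moment4 (F : nat -> T -> R) (C : R) :
  (forall n, measurable_fun setT (F n)) ->
  (forall n, L1 P (fun w => F n w ^+ 4)) ->
  (forall n, Int P (fun w => F n w ^+ 4) <= C / n.+1%:R ^+ 2) ->
  {ae P, forall w, F n w @[n --> \oo] --> (0 : R)}.
Proof.
move=> mF IF FC.
have F0 n w : 0 <= F n w ^+ 4 by rewrite exprn_even_ge0.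
pose g n w : \bar R := (F n w ^+ 4)%:E.
have g0 n w : setT w -> (0 <= g n w)%E by rewrite lee_fin.
have mg n : measurable_fun setT (g n).
  by apply/measurable_EFinP; exact: measurable_funX.
pose S w : \bar R := (\sum_(n <oo) g n w)%E.
have S0 w : (0 <= S w)%E by apply: nneseries_ge0 => n _ _; exact: g0.
have mS : measurable_fun setT S by apply: ge0_emeasurable_sum => [k w _ _|k _]; [exact: g0|exact: mg].
have ES : (\int[P]_w S w <= (2 * C)%:E)%E.
  rewrite integral_nneseries//; apply: lime_le.
    by apply: is_cvg_nneseries => n _ _; apply: integral_ge0 => w _; exact: g0.
  apply: nearW => n; rewrite big_mkord.
  rewrite (eq_bigr (fun k : 'I_n => (Int P (fun w => F k w ^+ 4))%:E)); last first.
    by move=> k _; exact: (EFin_Int (IF k)).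
  rewrite sumEFin lee_fin.
  apply: (@le_trans _ _ (\sum_(k < n) C / k.+1%:R ^+ 2)); first by apply: ler_sum => k _; exact: FC.
  have C0 : 0 <= C.
    by apply: (@le_trans _ _ (Int P (fun w => F 0%N w ^+ 4))); [exact: Int_ge0|have := FC 0%N; rewrite expr1n divr1].
  by rewrite -mulr_sumr mulrC ler_wpM2r// sum_invsq_le.
have IS : P.-integrable setT S.
  apply/integrableP; split => //.
  under eq_integral => w _ do rewrite gee0_abs//.
  by rewrite (le_lt_trans ES)// ltry.
have := integrable_ae measurableT IS.
apply: filterS => w /(_ Logic.I) Sw.
have ub n : \sum_(0 <= k < n) F k w ^+ 4 <= fine (S w).
  rewrite -lee_fin fineK// -sumEFin.
  by apply: nneseries_lim_ge => k _ _; exact: g0.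
have cv : cvgn (series (fun n => F n w ^+ 4)).
  apply: nondecreasing_is_cvgn.
    by apply: nondecreasing_series => k _ _; exact: F0.
  by exists (fine (S w)) => _ [n _ <-]; exact: ub.
have /cvgrPdist_lt cv0 := cvg_series_cvg_0 cv.
apply/cvgrPdist_lt => e e0.
have e4 : 0 < e ^+ 4 by rewrite exprn_gt0.
have := cv0 _ e4; apply: filterS => n.
rewrite !sub0r !normrN ger0_norm ?exprn_even_ge0//.
rewrite -(@ger0_norm _ (F n w ^+ 4)) ?exprn_even_ge0// normrX.
by rewrite ltr_pXn2r// nnegrE ltW.
Qed.

End AlmostSure.

(** * Concentration of the quadratic variations *)

Section Distance.
Context {R : realType} (d : nat) (M : 'M[R]_d).
Implicit Types (z : 'cV[R]_d) (l : 'I_d).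

(** M is invertible, so that distances measured through M control the
coordinates. *)
Lemma entry_le_enorm_mul : \det M = 1 ->
  exists2 c : R, 1 <= c & forall z l, `|z l ord0| <= c * enorm (M *m z).
Proof.
move=> dM; have uM : M \in unitmx by rewrite unitmxE dM unitr1.
pose c := \sum_i \sum_j `|invmx M i j|.
have c0 : 0 <= c by apply: sumr_ge0 => i _; apply: sumr_ge0 => j _.
exists (1 + c) => [|z l]; first by rewrite lerDl.
have {1}-> : z = invmx M *m (M *m z) by rewrite mulKmx.
rewrite mxE (le_trans (ler_norm_sum _ _ _))// (@le_trans _ _ (c * enorm (M *m z)))//; last first.
  by rewrite ler_wpM2r ?enorm_ge0// lerDr.
have cl : \sum_j `|invmx M l j| <= c.
  rewrite [leRHS](bigD1 l)//= lerDl sumr_ge0// => i _; exact: sumr_ge0.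
rewrite (le_trans _ (ler_wpM2r (enorm_ge0 _) cl))//.
rewrite mulr_suml; apply: ler_sum => j _; rewrite normrM ler_wpM2l//.
exact: ler_entry_enorm.
Qed.

Lemma enorm_mul_gt0 z : \det M = 1 -> z != 0 -> 0 < enorm (M *m z).
Proof.
move=> dM z0; have [c c1 Hc] := entry_le_enorm_mul dM.
rewrite lt_neqAle enorm_ge0 andbT; apply: contra z0 => /eqP e0.
apply/eqP/matrixP => l j; rewrite ord1 mxE; apply/eqP; rewrite -normr_le0.
by rewrite (le_trans (Hc z l))// -e0 mulr0.
Qed.

End Distance.

Section Concentration.
Context {disp : measure_display} {T : measurableType disp} {R : realType}.
Variables (P : probability T R) (e : nat).
Local Notation d := (5 + e)%N.
Variables (sigma alpha nu : R) (M : 'M[R]_d) (Y : 'cV[R]_d -> T -> R).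
Variables (Omega : set 'cV[R]_d) (h : 'cV[R]_d) (m : nat).
Hypotheses (sigma0 : 0 < sigma) (alpha0 : 0 < alpha) (nu0 : 0 < nu).
Hypotheses (detM : \det M = 1) (YM : matern_field P sigma alpha nu M Y).
Hypotheses (h0 : h != 0) (num : nu + 2 < m%:R).
Implicit Types (n : nat) (s t : 'cV[R]_d).
Local Notation V := (scaled_var sigma alpha nu M h m).

Definition scaled_inc n t w : R := n%:R `^ nu * iter m (increment (n%:R^-1 *: h)) Y t w.

Definition scaled_cov n s t := Int P (fun w => scaled_inc n s w * scaled_inc n t w).

Let gY : gaussian_field P Y. Proof. by case: YM. Qed.
Let Y0 t : ('E_P[Y t] = 0)%E. Proof. by case: YM. Qed.

Lemma span_scaled_inc n t : linspan Y (scaled_inc n t).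
Proof. exact/spanZ/span_increment. Qed.

Lemma powR_sqr n : n%:R `^ nu * n%:R `^ nu = n%:R `^ (2 * nu) :> R.
Proof. by rewrite mulrC [2 * nu]mulrC powRrM powR_mulrn ?powR_ge0. Qed.

Lemma scaled_covE n s t : scaled_cov n s t = n%:R `^ (2 * nu) *
  dsum m (fun k => matern sigma alpha nu (enorm (M *m (s - t) + k *: (n%:R^-1 *: (M *m h))))).
Proof.
rewrite /scaled_cov (_ : (fun w => _) = fun w => n%:R `^ (2 * nu) *
  (iter m (increment (n%:R^-1 *: h)) Y s w * iter m (increment (n%:R^-1 *: h)) Y t w)); last first.
  by apply/funext => w; rewrite /scaled_inc -powR_sqr; ring.
rewrite IntZ; last by apply: (span_L1M gY Y0); exact: span_increment.
congr (_ * _).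
rewrite (increment_covariance gY Y0 (K := fun z => matern sigma alpha nu (enorm (M *m z)))).
  by apply: eq_dsum => k; rewrite mulmxDr -!scalemxAr.
by move=> s' t'; case: YM => _ _ ->; rewrite mulmxBr.
Qed.

Lemma scaled_cov_diag n t : scaled_cov n t t = V n.
Proof. by rewrite scaled_covE subrr mulmx0. Qed.

(** The inequality 2 |x y| <= x^2 + y^2, and stationarity. *)
Lemma scaled_cov_le_var n s t : `|scaled_cov n s t| <= V n.
Proof.
have I a b : L1 P (fun w => scaled_inc n a w * scaled_inc n b w).
  by apply: (span_L1M gY Y0); exact: span_scaled_inc.
apply: le_trans (le_norm_Int (I s t)) _.
have -> : V n = 2^-1 * (V n + V n) by field.
rewrite -{1}(scaled_cov_diag n s) -(scaled_cov_diag n t) -IntD// -IntZ; last exact: L1D.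
apply: le_Int => [||w]; [exact: L1_norm|exact/L1Z/L1D|].
set x := scaled_inc n s w; set y := scaled_inc n t w.
rewrite normrM; have := sqr_ge0 (`|x| - `|y|).
by rewrite sqrrB !real_normK ?num_real// !expr2; lra.
Qed.

(** At large distance this is the decay of the covariance; the remaining
distances are bounded in the scale 1 / n and the variance is bounded. *)
Lemma scaled_cov_le : exists2 C, 0 <= C & forall n s t, (0 < n)%N ->
  `|scaled_cov n s t| <= C / (1 + n%:R * enorm (M *m (s - t))) ^+ 4.
Proof.
have v0 := enorm_mul_gt0 detM h0.
have [K K0 HK] := scaled_covariance_decay sigma alpha0 nu0 v0 num.
have [W W0 HW] := scaled_var_bounded sigma0 alpha0 nu0 v0 num.
pose x0 := 1 + 8 * m%:R * enorm (M *m h).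
have x01 : 1 <= x0 by rewrite lerDl !mulr_ge0// ltW.
have C1 : 0 <= K * 2 ^+ 4 by rewrite mulr_ge0.
have C2 : 0 <= W * (1 + x0) ^+ 4.
  by rewrite mulr_ge0// exprn_ge0// addr_ge0// (le_trans ler01).
(* 1 + x <= 2 x when x >= 1, whence the factor 2^4. *)
exists (K * 2 ^+ 4 + W * (1 + x0) ^+ 4); first exact: addr_ge0.
move=> n s t n0; set x := n%:R * _.
have x_ge0 : 0 <= x by rewrite mulr_ge0// enorm_ge0.
have x4 : 0 < (1 + x) ^+ 4 by rewrite exprn_gt0// ltr_pwDl.
rewrite ler_pdivlMr//.
have [x0x|xx0] := leP x0 x.
  have x1 : 1 <= x by apply: le_trans x0x.
  apply: (@le_trans _ _ (K * 2 ^+ 4)); last by rewrite lerDl.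
  have xx4 : 0 < x ^+ 4 by rewrite exprn_gt0// (lt_le_trans ltr01).
  have H : `|scaled_cov n s t| <= K / x ^+ 4.
    rewrite scaled_covE; apply: HK => //.
    by apply: le_trans x0x; rewrite lerDr.
  apply: (le_trans (ler_wpM2r (ltW x4) H)); rewrite -mulrA; apply: ler_wpM2l => //.
  rewrite mulrC ler_pdivrMr// -exprMn lerXn2r// ?nnegrE ?(addr_ge0 ler01 x_ge0) ?(mulr_ge0 (ler0n R 2) x_ge0)//.
  by lra.
apply: (@le_trans _ _ (W * (1 + x0) ^+ 4)); last by rewrite lerDr.
apply: ler_pM => //; first exact: ltW.
  by apply: le_trans (scaled_cov_le_var n s t) _; apply: le_trans (ler_norm _) (HW _ n0).
by rewrite lerXn2r ?nnegrE ?(addr_ge0 ler01 x_ge0) ?(addr_ge0 ler01 (le_trans ler01 x01)) ?lerD2l ?(ltW xx0).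
Qed.

Hypotheses (Omega0 : Omega !=set0) (Ob : bounded_set Omega) (Oo : open Omega).

Local Notation A n := (fset_set (grid Omega n)).
Local Notation N n := (#|` A n|%:R : R).

(** Each squared covariance is at most a product of five weights in the first
five coordinates of the difference of the two grid cells. *)
Lemma sum_sqr_scaled_cov : exists2 C, 0 <= C & forall n, (0 < n)%N ->
  \sum_(s : A n) \sum_(t : A n) scaled_cov n (val s) (val t) ^+ 2 <= C * N n * n%:R ^+ e.
Proof.
have [C C0 HC] := scaled_cov_le.
have [c c1 Hc] := entry_le_enorm_mul detM.
have c0 : 0 <= c by apply: le_trans c1.
have [B HB] := bounded_set_entry Ob.
exists (C ^+ 2 * c ^+ 8 * (6 ^+ 5 * (2 * B + 1)%:R ^+ e)).
  by rewrite !mulr_ge0// ?exprn_ge0.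
move=> n n0; have fin := grid_finite HB n0.
have Ag (s : A n) : grid Omega n (val s).
  by have := valP s; rewrite in_fset_set// inE.
pose phi (s : A n) := cell n B (val s).
have phi_inj : injective phi.
  by move=> s t /(cell_inj HB n0 (Ag s) (Ag t)); exact: val_inj.
have H (s t : A n) : scaled_cov n (val s) (val t) ^+ 2 <= C ^+ 2 * c ^+ 8 *
    \prod_(l < 5) weight `|(phi s (lshift e l))%:R - (phi t (lshift e l))%:R|.
  set x := n%:R * enorm (M *m (val s - val t)).
  have x_ge0 : 0 <= x by rewrite mulr_ge0// enorm_ge0.
  have x1 : 1 <= 1 + x by rewrite lerDl.
  have x10 : 0 < 1 + x by exact: lt_le_trans x1.
  have tx : 1 <= c * (1 + x) by rewrite (le_trans c1)// ler_peMr.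
  have := @inv_pow8_le_weight R (c * (1 + x))
    (fun l => `|(phi s (lshift e l))%:R - (phi t (lshift e l))%:R|) tx (fun=> normr_ge0 _).
  have y l : 1 + `|(phi s (lshift e l))%:R - (phi t (lshift e l))%:R| <= c * (1 + x).
    rewrite /phi !(cellE HB)//; set l' := lshift e l.
    have -> : n%:R * val s l' ord0 + (n * B)%:R - (n%:R * val t l' ord0 + (n * B)%:R) =
      n%:R * (val s - val t) l' ord0 by rewrite !mxE; ring.
    rewrite mulrDr mulr1 lerD// normrM ger0_norm ?ler0n// /x mulrCA.
    by rewrite ler_wpM2l// Hc.
  move=> /(_ y) Hw.
  apply: (@le_trans _ _ (C ^+ 2 * c ^+ 8 * (c * (1 + x)) ^- 8)); last first.
    by apply: ler_wpM2l => //; rewrite mulr_ge0 ?exprn_ge0.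
  have -> : C ^+ 2 * c ^+ 8 * (c * (1 + x)) ^- 8 = (C / (1 + x) ^+ 4) ^+ 2.
    by field; rewrite !gt_eqF// (lt_le_trans ltr01).
  rewrite -[leLHS]real_normK ?num_real// lerXn2r ?nnegrE//.
    by rewrite divr_ge0// exprn_ge0// ltW.
  exact: HC.
apply: (@le_trans _ _ (\sum_(s : A n) C ^+ 2 * c ^+ 8 * (6 ^+ 5 * (2 * n * B).+1%:R ^+ e))).
  apply: ler_sum => s _.
  apply: (@le_trans _ _ (\sum_(t : A n) C ^+ 2 * c ^+ 8 *
    \prod_(l < 5) weight `|(phi s (lshift e l))%:R - (phi t (lshift e l))%:R|)).
    by apply: ler_sum => t _; exact: H.
  rewrite -mulr_sumr; apply: ler_wpM2l; first by rewrite mulr_ge0 ?exprn_ge0.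
  exact: weight_sum_inj.
rewrite sumr_const -cardfE -[_ *+ #|` _|]mulr_natr.
have nB : (2 * n * B).+1%:R <= (2 * B + 1)%:R * n%:R :> R.
  by rewrite -natrM ler_nat; move: n0; clear; nia.
have h1 : (2 * n * B).+1%:R ^+ e <= ((2 * B + 1)%:R * n%:R) ^+ e :> R.
  by rewrite lerXn2r ?nnegrE// mulr_ge0.
apply: (@le_trans _ _ (C ^+ 2 * c ^+ 8 * (6 ^+ 5 * ((2 * B + 1)%:R * n%:R) ^+ e) * N n)); last first.
  by rewrite exprMn le_eqVlt; apply/orP; left; apply/eqP; ring.
rewrite ler_wpM2r// ler_wpM2l ?mulr_ge0 ?exprn_ge0// ler_wpM2l//.
Qed.

Definition fluct n w := n%:R ^+ 2 * (qvar Y nu Omega h m n w - V n).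

(** The fluctuation is n^2 / N times a centred sum of squares; N is at least of
order n^(5 + e) and the squared covariances sum up to O(N n^e). *)
Lemma fluct_moment4 : exists2 C, 0 <= C & exists n0 : nat, forall n, (n0 <= n)%N -> (0 < n)%N ->
  allmom P (fluct n) /\ Int P (fun w => fluct n w ^+ 4) <= C / n%:R ^+ 2.
Proof.
have [C C0 HC] := sum_sqr_scaled_cov.
have [B HB] := bounded_set_entry Ob.
have [c c0 [n1 Hc]] := grid_card_ge HB Omega0 Oo.
exists (60 * (C / c) ^+ 2); first by rewrite mulr_ge0 ?sqr_ge0.
exists n1 => n n1n n0; have n0' : (0 : R) < n%:R by rewrite ltr0n.
have cN := Hc n n1n n0.
have N0 : 0 < N n by apply: lt_le_trans cN; rewrite mulr_gt0// exprn_gt0.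
pose X (s : A n) := scaled_inc n (val s).
have sp (a : {ffun A n -> R}) : linspan Y (lin X a).
  by apply: span_sum => s; apply: spanZ; exact: span_scaled_inc.
have mom a := span_moments gY Y0 (sp a).
have meas a := span_measurable gY (sp a).
have fE : fluct n = fun w => n%:R ^+ 2 / N n * csq P X w.
  apply/funext => w; rewrite /fluct -mulrA; congr (_ * _).
  rewrite /qvar fsbig_finite/=; last exact: (grid_finite HB).
  rewrite big_seq_fsetE/= /csq sumrB mulrBr; congr (_ - _).
    congr (_ * _); apply: eq_bigr => s _; rewrite /X /scaled_inc -powR_sqr; ring.
  rewrite (eq_bigr (fun=> V n)); last by move=> s _; exact: scaled_cov_diag.
  by rewrite sumr_const -cardfE -[_ *+ #|` _|]mulr_natr mulrCA mulVf ?mulr1// gt_eqF.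
have Mc := allmom_csq mom meas.
split; first by rewrite fE; exact: allmomZ.
have -> : Int P (fun w => fluct n w ^+ 4) = (n%:R ^+ 2 / N n) ^+ 4 * Int P (fun w => csq P X w ^+ 4).
  rewrite -IntZ; last exact/allmom_L1/allmomX.
  by congr (Int P _); apply/funext => w; rewrite fE exprMn.
have p0 : 0 <= (n%:R ^+ 2 / N n) ^+ 4 by rewrite exprn_ge0// divr_ge0 ?sqr_ge0// ltW.
apply: (le_trans (ler_wpM2l p0 (Int_csq4_le mom meas))).
set p2 := \sum_i _; have p2C : p2 <= C * N n * n%:R ^+ e by exact: HC.
have p20 : 0 <= p2 by apply: sumr_ge0 => s _; apply: sumr_ge0 => t _; exact: sqr_ge0.
have Nn : n%:R ^+ e / N n <= (c * n%:R ^+ 5)^-1.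
  rewrite ler_pdivrMr// mulrC ler_pdivlMr ?mulr_gt0 ?exprn_gt0//.
  by apply: le_trans cN; rewrite exprD mulrC mulrA.
have h1 : p2 / N n ^+ 2 <= C / c / n%:R ^+ 5.
  apply: (@le_trans _ _ (C * (n%:R ^+ e / N n))).
    rewrite ler_pdivrMr ?exprn_gt0// (le_trans p2C)// le_eqVlt; apply/orP; left; apply/eqP.
    by field; rewrite gt_eqF.
  by rewrite -mulrA -invfM; exact: ler_wpM2l.
have -> : (n%:R ^+ 2 / N n) ^+ 4 * (60 * p2 ^+ 2) = 60 * n%:R ^+ 8 * (p2 / N n ^+ 2) ^+ 2.
  by field; rewrite gt_eqF.
have h2 : (p2 / N n ^+ 2) ^+ 2 <= (C / c / n%:R ^+ 5) ^+ 2.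
  have a0 : 0 <= p2 / N n ^+ 2 by rewrite divr_ge0 ?sqr_ge0.
  by rewrite lerXn2r// nnegrE// (le_trans a0).
have q0 : 0 <= 60 * n%:R ^+ 8 :> R by rewrite mulr_ge0 ?exprn_ge0.
apply: (le_trans (ler_wpM2l q0 h2)); rewrite le_eqVlt; apply/orP; left; apply/eqP.
by field; rewrite !gt_eqF.
Qed.

(** The bound on the fourth moment holds from some rank on, so the sequence is
shifted before its moments are summed. *)
Lemma fluct_ae_cvg0 : {ae P, forall w, fluct n w @[n --> \oo] --> (0 : R)}.
Proof.
have [C C0 [n0 HC]] := fluct_moment4.
have HM n : allmom P (fluct (n + n0.+1)) by apply: (HC _ _ _).1; lia.
have := @ae_cvg0_of_moment4 _ _ _ P (fun n => fluct (n + n0.+1)) C.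
move=> /(_ (fun n => (HM n).1)) /(_ (fun n => allmom_L1 (allmomX 4 (HM n)))).
have bnd n : Int P (fun w => fluct (n + n0.+1) w ^+ 4) <= C / n.+1%:R ^+ 2.
  apply: (@le_trans _ _ (C / (n + n0.+1)%:R ^+ 2)); first by apply: (HC _ _ _).2; lia.
  apply: ler_wpM2l => //; rewrite lef_pV2 ?posrE ?exprn_gt0 ?ltr0n ?addnS//.
  by rewrite lerXn2r ?nnegrE// ler_nat; lia.
move=> /(_ bnd); apply: filterS => w cw.
have E := @cvg_shiftn n0.+1 R (fun n => fluct n w) (nbhs (0 : R)).
by rewrite -E.
Qed.

End Concentration.

Lemma quadratic_variations_ae_cvg (disp : measure_display) (T : measurableType disp)
    (R : realType) (P : probability T R)
    (e : nat) (sigma alpha nu : R) (M : 'M[R]_(5 + e))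
    (Y : 'cV[R]_(5 + e) -> T -> R) (Omega : set 'cV[R]_(5 + e)) (h : 'cV[R]_(5 + e))
    (p q : nat) :
  0 < sigma -> 0 < alpha -> 0 < nu -> \det M = 1 ->
  matern_field P sigma alpha nu M Y ->
  Omega !=set0 -> bounded_set Omega -> open Omega ->
  h != 0 -> nu + 2 < p%:R -> nu + 2 < q%:R ->
  {ae P, forall w,
    (fun n : nat => n%:R ^+ 2 *
       (qvar Y nu Omega h p n w
        - coef_a sigma alpha nu M h p / coef_a sigma alpha nu M h q
          * qvar Y nu Omega h q n w)) @ \oo -->
    (coef_b sigma alpha nu M h p
     - coef_a sigma alpha nu M h p / coef_a sigma alpha nu M h q
       * coef_b sigma alpha nu M h q)}.
Proof.
move=> s0 a0 nu0 dM YM O0 Ob Oo h0 np nq.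
have v0 := enorm_mul_gt0 dM h0.
have Fp := fluct_ae_cvg0 s0 a0 nu0 dM YM h0 np O0 Ob Oo.
have Fq := fluct_ae_cvg0 s0 a0 nu0 dM YM h0 nq O0 Ob Oo.
have Vp := scaled_var_cvg s0 a0 nu0 v0 np.
have Vq := scaled_var_cvg s0 a0 nu0 v0 nq.
have aq : coef_a sigma alpha nu M h q != 0.
  by apply: coef_a_neq0 => //; apply: lt_trans nq; rewrite ltrDl.
apply: filterS2 Fp Fq => w Fp Fq.
set r := _ / _.
pose F m n := fluct sigma alpha nu M Y Omega h m n w.
pose G m (n : nat) := n%:R ^+ 2 * (scaled_var sigma alpha nu M h m n - coef_a sigma alpha nu M h m).
have cp : (F p n + G p n) @[n --> \oo] --> 0 + coef_b sigma alpha nu M h p by apply: cvgD.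
have cq : (r * (F q n + G q n)) @[n --> \oo] --> r * (0 + coef_b sigma alpha nu M h q).
  by apply: cvgMl_tmp; apply: cvgD.
have : (F p n + G p n - r * (F q n + G q n)) @[n --> \oo] -->
    0 + coef_b sigma alpha nu M h p - r * (0 + coef_b sigma alpha nu M h q) by apply: cvgB.
rewrite !add0r; apply: cvg_trans.
apply: near_eq_cvg; near=> n.
have ra : r * coef_a sigma alpha nu M h q = coef_a sigma alpha nu M h p by rewrite divfK.
by rewrite /F /G /fluct -ra; ring.
Unshelve. all: end_near. Qed.

Theorem theorem2 (disp : measure_display) (T : measurableType disp)
    (R : realType) (P : probability T R)
    (d : nat) (sigma alpha nu : R) (M : 'M[R]_d)
    (Y : 'cV[R]_d -> T -> R) (Omega : set 'cV[R]_d) (h : 'cV[R]_d)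
    (p q : nat) :
  (1 <= d)%N ->
  0 < sigma -> 0 < alpha -> 0 < nu -> \det M = 1 ->
  matern_field P sigma alpha nu M Y ->
  Omega !=set0 -> bounded_set Omega -> open Omega ->
  h != 0 ->
  p != q -> (0 < p)%N -> (0 < q)%N ->
  nu + 1 < p%:R -> nu + 1 < q%:R ->
  4 < Num.min (2 * p%:R - 2 * nu) d%:R ->
  4 < Num.min (2 * q%:R - 2 * nu) d%:R ->
  {ae P, forall w,
    (fun n : nat => n%:R ^+ 2 *
       (qvar Y nu Omega h p n w
        - coef_a sigma alpha nu M h p / coef_a sigma alpha nu M h q
          * qvar Y nu Omega h q n w)) @ \oo -->
    (coef_b sigma alpha nu M h p
     - coef_a sigma alpha nu M h p / coef_a sigma alpha nu M h q
       * coef_b sigma alpha nu M h q)}.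
Proof.
move=> _ s0 a0 nu0 dM YM O0 Ob Oo h0 _ _ _ _ _.
rewrite !lt_min => /andP[np d5] /andP[nq _].
rewrite ltr_nat in d5.
have [e de] : exists e, d = (5 + e)%N by exists (d - 5)%N; rewrite subnKC.
move: M Y Omega h dM YM O0 Ob Oo h0; rewrite {}de => M Y Omega h dM YM O0 Ob Oo h0.
by apply: quadratic_variations_ae_cvg => //; lra.
Qed.
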